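(* Let $f$ be a holomorphic function on the unit disc $\mathbb{D}=\{z\in\mathbb{C}:|z|<1\}$, let $S_n$ denote the partial sum up to degree $n$ of the Taylor series of $f$ about $0$, and let $(S_{n_k})_{k\ge 1}$ be a subsequence of $(S_n)$. Let $$E=\{\zeta\in\mathbb{T}: S(\zeta):=\lim_{k\to\infty}S_{n_k}(\zeta)\text{ exists}\}$$ and $$F=\{\zeta\in\mathbb{T}: f(\zeta):=\mathrm{nt}\lim_{z\to\zeta}f(z)\text{ exists}\}.$$ Then $S(\zeta)=f(\zeta)$ for $\sigma$-almost every $\zeta\in E\cap F$.
   Context: $\mathbb{T}$ is the unit circle $\{|z|=1\}$ and $\sigma$ denotes arc length measure on $\mathbb{T}$. All limits are required to exist finitely, i.e. in $\mathbb{C}$. The notation $\mathrm{nt}\lim_{z\to\zeta}f(z)$ denotes the nontangential limit of $f$ at $\zeta\in\mathbb{T}$: it exists and equals $l\in\mathbb{C}$ if, for every $\alpha>1$, $f(z)\to l$ as $z\to\zeta$ within the region $\{z\in\mathbb{D}:|z-\zeta|<\alpha(1-|z|)\}$. *)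

(* Defs.v *)
From HB Require Import structures.
From mathcomp Require Import all_boot all_order all_algebra.
From mathcomp Require Import complex.
From mathcomp Require Import all_classical all_reals all_analysis.
From mathcomp Require Import measurable_realfun.
From mathcomp Require Import ring lra.

Set Implicit Arguments.
Unset Strict Implicit.
Unset Printing Implicit Defensive.

Import Order.TTheory GRing.Theory Num.Theory.
Import numFieldNormedType.Exports.

Local Open Scope classical_set_scope.
Local Open Scope complex_scope.
Local Open Scope ring_scope.

(* Packing R[i] as a numClosedFieldType makes the topology and the normed
   module structure over itself (so that derivatives are complex) inferable. *)
Definition CC (R : realType) : numClosedFieldType := R[i].

Definition unit_disc (R : realType) : set (CC R) := [set z | `|z| < 1].

Definition unit_circle (R : realType) : set (CC R) := [set z | `|z| = 1].

Arguments unit_disc : clear implicits.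
Arguments unit_circle : clear implicits.

(* U is meant to be open. *)
Definition holomorphic_on (R : realType) (U : set (CC R)) (f : CC R -> CC R) :=
  forall z, U z -> derivable f z 1.

Definition taylor_sum (R : realType) (f : CC R -> CC R) (n : nat) (z : CC R)
    : CC R :=
  \sum_(j < n.+1) (derive1n j f 0 / j`!%:R) * z ^+ j.

(* The nontangential approach region at zeta of aperture alpha. *)
Definition stolz (R : realType) (alpha : R) (zeta : CC R) : set (CC R) :=
  [set z | unit_disc R z /\ `|z - zeta| < alpha%:C * (1 - `|z|)].

Definition is_ntlim (R : realType) (f : CC R -> CC R) (zeta l : CC R) :=
  forall alpha : R, 1 < alpha ->
    f z @[z --> within (stolz alpha zeta) (nbhs zeta)] --> l.

(* Meaningful only when the limit exists, like lim. *)
Definition ntlim (R : realType) (f : CC R -> CC R) (zeta : CC R) : CC R :=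
  get (is_ntlim f zeta).

(* R[i] with its Borel sigma-algebra. *)
Definition borelCC (R : realType) := g_sigma_algebraType (@open (CC R)).

Definition expi (R : realType) (t : measurableTypeR R) : borelCC R :=
  (cos t +i* sin t : CC R).

Lemma continuous_expi (R : realType) :
  continuous (fun t : R => cos t +i* sin t : CC R).
Proof.
move=> t; apply/cvgrPdist_lt => -[e e'].
rewrite ltcE /= => /andP[/eqP -> e0].
have e2 : 0 < e / 2 by rewrite divr_gt0.
near=> s.
have hc : `|cos t - cos s| < e / 2.
  near: s; have /cvgrPdist_lt/(_ _ e2) := @continuous_cos R t; exact.
have hs : `|sin t - sin s| < e / 2.
  near: s; have /cvgrPdist_lt/(_ _ e2) := @continuous_sin R t; exact.
have -> : (cos t +i* sin t : CC R) - (cos s +i* sin s : CC R) =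
    (cos t - cos s)%:C + 'i * (sin t - sin s)%:C :> R[i].
  by apply/eqP; rewrite eq_complex /=; apply/andP; split; apply/eqP; ring.
apply: (le_lt_trans (ler_normD _ _)).
rewrite !normc_def /= !(mul0r, mul1r, mulr0, subr0, sub0r, oppr0, addr0, add0r) expr0n /=
  addr0 add0r !sqrtr_sqr.
by rewrite -rmorphD /= ltcR [e]splitr ltrD.
Unshelve. all: by end_near.
Qed.

Lemma measurable_expi (R : realType) : measurable_fun setT (@expi R).
Proof.
apply: (@measurability _ _ _ _ setT (@expi R) (@open (CC R))) => //.
move=> _ [U oU <-]; rewrite setTI; apply: open_measurable.
by move/continuousP: (@continuous_expi R); exact.
Qed.

(* Arc length on the circle, as a Borel measure on the plane carried by it:
   the image of Lebesgue measure on [0, 2 pi[ under t |-> e^(it). *)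
Definition arc_length (R : realType) : set (borelCC R) -> \bar R :=
  pushforward
    (mrestr (@lebesgue_measure R) (measurable_itv `[0, pi *+ 2[)) (@expi R).

HB.instance Definition _ (R : realType) :=
  isMeasurableFun.Build _ _ _ _ (@expi R) (@measurable_expi R).

Section arc_length_measure.
Variable R : realType.

Let arc_length0 : @arc_length R set0 = 0%E.
Proof. exact: measure0. Qed.

Let arc_length_ge0 A : (0 <= @arc_length R A)%E.
Proof. exact: measure_ge0. Qed.

Let arc_length_sigma_additive : semi_sigma_additive (@arc_length R).
Proof. exact: measure_semi_sigma_additive. Qed.

HB.instance Definition _ := isMeasure.Build _ _ _
  (@arc_length R) arc_length0 arc_length_ge0 arc_length_sigma_additive.

End arc_length_measure.

(* Main.v *)
(* By a countable exhaustion one may fix a closed subset K of the circle and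
   constants M and e such that the partial sums S_k of degree n_k are bounded
   by M on K and vary there by at most e for large k, and such that |f| <= M on
   the approach regions at the points of K. Nothing is known of S_k off K, but
   env N, the supremum over k >= N of the normalised growth log+ (|S_k| / M) / n_k,
   vanishes on K, tends to 0 uniformly, and is almost superharmonic
   in the sense that G(x) <= log (2 / (1 + r)) + P[G](r x) for G = env N, where P
   denotes the Poisson integral. Integrating this over K shows that
   G(y) / |y - x|^2 is integrable in y for almost every x in K, so
   P[env N](r x) <= e' (1 - r) for all r, with e' -> 0 as N grows.

   At such a point x the partial sum and f are compared at z = (1 - A / n_k) x.
   - The maximum principle, applied in a sawtooth region over K to
     (S_k - f)^2 w^(- n_k) exp (- 2 n_k H), where Re H is the Poisson integral of
     env N plus a multiple of the truncated distance to K, gives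
     |S_k - f|(z) <= 2 M exp (- A / 4).
   - P[1_(~ K)](z) tends to 0 in measure on K, so at almost every x it is small
     for infinitely many k, and the Poisson majorant of log |S_k - S(x)| shows that
     S_k(z) is within 4 e of S(x) for these k.
   Since f(z) tends to the nontangential limit of f at x, letting A tend to
   infinity bounds the difference of the two limits by 4 e. *)
Require Import Defs.
From HB Require Import structures.
From mathcomp Require Import all_boot all_order all_algebra.
From mathcomp Require Import complex.
From mathcomp Require Import all_classical all_reals all_analysis.
From mathcomp Require Import measurable_realfun.
From mathcomp Require Import ring lra.

Set Implicit Arguments.
Unset Strict Implicit.
Unset Printing Implicit Defensive.

Import Order.TTheory GRing.Theory Num.Theory.
Import numFieldNormedType.Exports.

Local Open Scope classical_set_scope.
Local Open Scope ring_scope.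

(** At z = (1 - A / n_k) x the two estimates meet: |z|^(n_k) is about exp (- A), which makes S_k - f
    small once A is large, while n_k (1 - |z|) = A stays bounded, so that S_k has hardly moved from
    its boundary value. Both need n_k P[env N](z) to be a small multiple of A, that is, a bound on
    P[env N](r x) linear in 1 - r. This is the obstacle: off K the partial sums may grow like exp
    (o(n_k)), and the uniform smallness of env N gives no rate. The rate comes from the degree. Once
    its zeros in the disc are reflected, a polynomial of degree n loses at most a factor (2 / (1 +
    r))^n from x to r x; the n-th root of this loss does not depend on n, so all k fit under one
    supremum and share one exceptional null set. The order of choice is A, then N, then k: the bound
    on S_k - f holds for all large k, so the other one is only wanted for infinitely many. *)

Section modulus.
Variable R : realType.
Local Notation C := (CC R).
Implicit Types z w c : C.

(** * Complex numbers through real and imaginary parts *)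

Definition cre z : R := complex.Re z.
Definition cim z : R := complex.Im z.
Definition cofr (x : R) : C := (x%:C)%C.
Definition cmk (x y : R) : C := Complex x y.
(** The norm of [CC R] takes its values in [CC R]; this is the same modulus as a real number, on
    which real arithmetic applies. *)
Definition nrm z : R := Num.sqrt (cre z ^+ 2 + cim z ^+ 2).

Lemma normE z : `|z| = cofr (nrm z).
Proof. exact: normc_def. Qed.

Lemma cofr_le x y : (cofr x <= cofr y) = (x <= y).
Proof. exact: lecR. Qed.

Lemma cofr_lt x y : (cofr x < cofr y) = (x < y).
Proof. exact: ltcR. Qed.

Lemma cofr_inj : injective cofr.
Proof. by move=> x y []. Qed.

Lemma cofrD x y : cofr (x + y) = cofr x + cofr y.
Proof. exact: (rmorphD (real_complex R)). Qed.

Lemma cofrM x y : cofr (x * y) = cofr x * cofr y.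
Proof. exact: (rmorphM (real_complex R)). Qed.

Lemma cofrN x : cofr (- x) = - cofr x.
Proof. exact: (rmorphN (real_complex R)). Qed.

Lemma cofr1 : cofr 1 = 1. Proof. by []. Qed.

Lemma cofrX x n : cofr (x ^+ n) = cofr x ^+ n.
Proof. exact: (rmorphXn (real_complex R)). Qed.

Lemma cofr_nat n : cofr n%:R = n%:R.
Proof. exact: (rmorph_nat (real_complex R)). Qed.

Lemma cofrV x : cofr x^-1 = (cofr x)^-1.
Proof. exact: (fmorphV (real_complex R)). Qed.

Lemma nrm_ge0 z : 0 <= nrm z. Proof. exact: sqrtr_ge0. Qed.
Hint Resolve nrm_ge0 : core.

Lemma nrm0 : nrm 0 = 0.
Proof. by apply: cofr_inj; rewrite -normE normr0. Qed.

Lemma nrm1 : nrm 1 = 1.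
Proof. by apply: cofr_inj; rewrite -normE normr1. Qed.

Lemma nrmD z w : nrm (z + w) <= nrm z + nrm w.
Proof. by rewrite -cofr_le cofrD -!normE ler_normD. Qed.

Lemma nrmN z : nrm (- z) = nrm z.
Proof. by apply: cofr_inj; rewrite -!normE normrN. Qed.

Lemma nrmB z w : nrm (z - w) = nrm (w - z).
Proof. by rewrite -nrmN opprB. Qed.

Lemma nrmM z w : nrm (z * w) = nrm z * nrm w.
Proof. by apply: cofr_inj; rewrite cofrM -!normE normrM. Qed.

Lemma nrmX z n : nrm (z ^+ n) = nrm z ^+ n.
Proof. by apply: cofr_inj; rewrite cofrX -!normE normrX. Qed.

Lemma nrmV z : nrm z^-1 = (nrm z)^-1.
Proof. by apply: cofr_inj; rewrite cofrV -!normE normfV. Qed.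

Lemma nrm_eq0 z : (nrm z == 0) = (z == 0).
Proof.
by rewrite -(inj_eq cofr_inj) -normE; exact: normr_eq0.
Qed.

Lemma nrm_gt0 z : (0 < nrm z) = (z != 0).
Proof. by rewrite lt_def nrm_eq0 nrm_ge0 andbT. Qed.

Lemma nrm_cofr x : nrm (cofr x) = `|x|.
Proof. by rewrite /nrm /= expr0n /= addr0 sqrtr_sqr. Qed.

Lemma nrm_nat n : nrm n%:R = n%:R.
Proof. by rewrite -cofr_nat nrm_cofr ger0_norm. Qed.

Lemma nrm_sqr z : nrm z ^+ 2 = cre z ^+ 2 + cim z ^+ 2.
Proof. by rewrite sqr_sqrtr // addr_ge0 ?sqr_ge0. Qed.

Lemma cre_le z : `|cre z| <= nrm z.
Proof.
rewrite -(@ler_pXn2r _ 2) ?nnegrE // real_normK ?num_real //.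
by rewrite nrm_sqr lerDl sqr_ge0.
Qed.

Lemma cim_le z : `|cim z| <= nrm z.
Proof.
rewrite -(@ler_pXn2r _ 2) ?nnegrE // real_normK ?num_real //.
by rewrite nrm_sqr lerDr sqr_ge0.
Qed.

Lemma cmkK z : cmk (cre z) (cim z) = z.
Proof. by case: z. Qed.

Lemma nrm_le_reim z : nrm z <= `|cre z| + `|cim z|.
Proof.
rewrite -(@ler_pXn2r _ 2) ?nnegrE ?addr_ge0 // nrm_sqr sqrrD.
by rewrite !real_normK ?num_real // -addrA addrCA lerDr mulrn_wge0 // mulr_ge0.
Qed.

Lemma complex_ext z w : cre z = cre w -> cim z = cim w -> z = w.
Proof. by case: z => a b; case: w => c d /= -> ->. Qed.

Lemma creD z w : cre (z + w) = cre z + cre w. Proof. by case: z; case: w. Qed.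
Lemma cimD z w : cim (z + w) = cim z + cim w. Proof. by case: z; case: w. Qed.
Lemma creN z : cre (- z) = - cre z. Proof. by case: z. Qed.
Lemma cimN z : cim (- z) = - cim z. Proof. by case: z. Qed.
Lemma creM z w : cre (z * w) = cre z * cre w - cim z * cim w.
Proof. by case: z; case: w. Qed.
Lemma cimM z w : cim (z * w) = cre z * cim w + cim z * cre w.
Proof. by case: z; case: w. Qed.
Lemma cre_cofr x : cre (cofr x) = x. Proof. by []. Qed.
Lemma cim_cofr x : cim (cofr x) = 0. Proof. by []. Qed.
Lemma cre_mk x y : cre (cmk x y) = x. Proof. by []. Qed.
Lemma cim_mk x y : cim (cmk x y) = y. Proof. by []. Qed.
Lemma cre1 : cre 1 = 1. Proof. by []. Qed.
Lemma cim1 : cim 1 = 0. Proof. by []. Qed.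
Lemma cre0 : cre 0 = 0. Proof. by []. Qed.
Lemma cim0 : cim 0 = 0. Proof. by []. Qed.

Definition reimE := (creD, cimD, creN, cimN, creM, cimM, cre_cofr, cim_cofr,
  cre_mk, cim_mk, cre1, cim1, cre0, cim0).

Definition cj z : C := cmk (cre z) (- cim z).

Lemma cre_cj z : cre (cj z) = cre z. Proof. by []. Qed.
Lemma cim_cj z : cim (cj z) = - cim z. Proof. by []. Qed.

Lemma nrm_cj z : nrm (cj z) = nrm z.
Proof. by rewrite /nrm /= sqrrN. Qed.

Lemma mul_cj z : z * cj z = cofr (nrm z ^+ 2).
Proof. by rewrite nrm_sqr; apply: complex_ext; rewrite !(reimE, cre_cj, cim_cj); ring. Qed.

Lemma cjM z w : cj (z * w) = cj z * cj w.
Proof. by apply: complex_ext; rewrite !(reimE, cre_cj, cim_cj); ring. Qed.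

Lemma cjD z w : cj (z + w) = cj z + cj w.
Proof. by apply: complex_ext; rewrite !(reimE, cre_cj, cim_cj); ring. Qed.

Lemma cjN z : cj (- z) = - cj z.
Proof. by apply: complex_ext; rewrite !(reimE, cre_cj, cim_cj); ring. Qed.

Lemma cj1 : cj 1 = 1.
Proof. by apply: complex_ext; rewrite !(reimE, cre_cj, cim_cj); ring. Qed.

Lemma cjV z : cj z^-1 = (cj z)^-1.
Proof.
have [->|z0] := eqVneq z 0; first by rewrite invr0 /cj /= oppr0; apply/esym/invr0.
have cz0 : cj z != 0 by rewrite -nrm_eq0 nrm_cj nrm_eq0.
by apply: (mulIf cz0); rewrite -cjM mulVf // mulVf // cj1.
Qed.

Lemma cre_mul_cj z w : cre (cj z * w) = cre z * cre w + cim z * cim w.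
Proof. by rewrite !(reimE, cre_cj, cim_cj); ring. Qed.

Lemma nrm_triangle z w c : nrm (z - c) <= nrm (z - w) + nrm (w - c).
Proof. by apply: le_trans (nrmD _ _); rewrite addrA subrK. Qed.

Lemma nrm_sub_le z w : nrm z - nrm w <= nrm (z - w).
Proof. by rewrite lerBlDr; apply: le_trans (nrmD _ _); rewrite subrK. Qed.

Lemma ball_nrm z (e : R) w : ball z (cofr e) w <-> nrm (w - z) < e.
Proof. by rewrite -ball_normE /= normE cofr_lt nrmB. Qed.

Lemma cpos (e : C) : 0 < e -> exists2 d : R, 0 < d & e = cofr d.
Proof.
rewrite (@ltcE R) => /andP[/eqP e1 e2]; exists (cre e) => //.
by apply: complex_ext.
Qed.

Lemma nbhs_nrm z (A : set C) :
  nbhs z A <-> exists2 e : R, 0 < e & forall w, nrm (w - z) < e -> A w.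
Proof.
split.
  move=> /nbhs_ballP[_ /= /cpos[e e0 ->]] sA; exists e => // w we.
  exact/sA/ball_nrm.
move=> [e e0 sA]; apply/nbhs_ballP; exists (cofr e); first by rewrite /= (cofr_lt 0).
by move=> w /ball_nrm; exact: sA.
Qed.

Lemma open_nrm (A : set C) : open A <->
  (forall z, A z -> exists2 e : R, 0 < e & forall w, nrm (w - z) < e -> A w).
Proof.
rewrite openE; split=> oA z Az; first by apply/nbhs_nrm; exact: oA.
by apply/nbhs_nrm; exact: oA.
Qed.

End modulus.
#[global] Hint Extern 0 (is_true (@Order.le _ _ _ (nrm _))) =>
  apply: nrm_ge0 : core.

(** * Continuity, compactness and closed sets in terms of the modulus *)

Section topology.
Variable R : realType.
Local Notation C := (CC R).
Implicit Types (D Q : set C) (F : C -> R).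

Definition cont_on D F := forall x, D x -> forall e : R, 0 < e ->
  exists2 d : R, 0 < d & forall y, D y -> nrm (y - x) < d -> `|F y - F x| < e.

Lemma cont_on_within D F : cont_on D F -> {within D, continuous F}.
Proof.
move=> cF; apply/subspace_continuousP => x Dx; apply/cvgrPdist_lt => e e0.
have [d d0 dF] := cF x Dx e e0.
rewrite /nbhs /= /within; apply/nbhs_nrm; exists d => // y yd Dy.
by rewrite distrC; exact: dF.
Qed.

Lemma cont_on_subset D D' F : D' `<=` D -> cont_on D F -> cont_on D' F.
Proof.
move=> DD cF x D'x e e0; have [d d0 dF] := cF x (DD _ D'x) e e0.
by exists d => // y /DD; exact: dF.
Qed.

Lemma cont_on_unif Q F : compact Q -> cont_on Q F -> forall e : R, 0 < e ->
  exists2 d : R, 0 < d &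
    forall x y, Q x -> Q y -> nrm (y - x) < d -> `|F y - F x| < e.
Proof.
move=> /compact_near_coveringP cQ cF e e0.
have := cQ R (0^'+)
  (fun d x => Q x -> forall y, Q y -> nrm (y - x) < d -> `|F y - F x| < e) _.
case.
  move=> x Qx; have e2 : 0 < e / 2 by rewrite divr_gt0.
  have [d d0 dF] := cF x Qx _ e2; have d2 : 0 < d / 2 by rewrite divr_gt0.
  exists ([set z | nrm (z - x) < d / 2], [set r | r < d / 2]) => /=.
    by split; [apply/nbhs_nrm; exists (d / 2) | exact: nbhs_right_lt].
  move=> [z r] /= [zx rd] Qz y Qy yz.
  have h1 : `|F z - F x| < e / 2 by apply: dF => //; lra.
  have h2 : `|F y - F x| < e / 2.
    by apply: dF => //; apply: le_lt_trans (nrm_triangle _ z _) _; lra.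
  by move: h1 h2; rewrite !ltr_distl => /andP[? ?] /andP[? ?]; lra.
move=> d /= d0 dP; exists (d / 2); first by rewrite divr_gt0.
move=> x y Qx Qy xy; apply: (dP (d / 2)) => //=.
- by rewrite sub0r normrN gtr0_norm ?divr_gt0 // ltr_pdivrMr // ltr_pMr // ltr1n.
- by rewrite divr_gt0.
Qed.

Lemma compact_max Q F : compact Q -> Q !=set0 -> cont_on Q F ->
  exists2 c, Q c & forall x, Q x -> F x <= F c.
Proof.
move=> cQ Q0 /cont_on_within cF.
have [c cQ' cm] := @compact_EVT_max C R F Q Q0 cQ cF.
by exists c; [exact/set_mem | move=> x Qx; apply: cm; exact/mem_set].
Qed.

Lemma cont_on_bounded Q F : compact Q -> cont_on Q F ->
  exists2 B : R, 0 <= B & forall x, Q x -> `|F x| <= B.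
Proof.
move=> cQ cF; have [->|Q0] := eqVneq Q set0; first by exists 0.
have cN : cont_on Q (fun x => `|F x|).
  move=> x Qx e e0; have [d d0 dF] := cF x Qx e e0; exists d => // y Qy yx.
  by apply: le_lt_trans (dF y Qy yx); exact: ler_dist_dist.
move/set0P : Q0 => Q0.
have [c Qc cm] := compact_max cQ Q0 cN.
by exists `|F c|.
Qed.

Lemma closed_nrm D :
  (forall z, ~ D z -> exists2 e : R, 0 < e & forall w, nrm (w - z) < e -> ~ D w) ->
  closed D.
Proof.
move=> h; rewrite -[D]setCK; apply: open_closedC; apply/open_nrm => z /h.
by [].
Qed.

Lemma closedP_nrm D : closed D -> forall z, ~ D z ->
  exists2 e : R, 0 < e & forall w, nrm (w - z) < e -> ~ D w.
Proof.
by move=> cD z Dz; have /open_nrm/(_ z Dz) := closed_openC cD.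
Qed.

Lemma continuous_cmk : continuous (fun p : R * R => cmk p.1 p.2 : C).
Proof.
move=> [x y]; apply/cvgrPdist_lt => _ /cpos[e e0 ->].
have e2 : 0 < e / 2 by rewrite divr_gt0.
exists (ball x (e / 2), ball y (e / 2)) => /=.
  by split; apply: nbhsx_ballx.
move=> [a b] /= []; rewrite -!ball_normE /= => xa yb.
rewrite normE cofr_lt; apply: le_lt_trans (nrm_le_reim _) _.
by rewrite !reimE /=; lra.
Qed.

Lemma compact_disc (r : R) : compact [set z : C | nrm z <= r].
Proof.
have cI : compact (`[- r, r]%classic `*` `[- r, r]%classic : set (R * R)).
  by apply: compact_setX; exact: segment_compact.
refine (subclosed_compact _
  (continuous_compact (continuous_subspaceT continuous_cmk) cI) _).
  apply: closed_nrm => z /negP; rewrite -ltNge => rz.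
  exists (nrm z - r); first by rewrite subr_gt0.
  move=> w wz /=; apply/negP; rewrite -ltNge.
  by have := nrm_sub_le z w; rewrite nrmB; lra.
move=> z /= zr; exists (cre z, cim z) => /=; last exact: cmkK.
have := cre_le z; have := cim_le z; rewrite !ler_norml.
by rewrite !in_itv /= => /andP[? ?] /andP[? ?]; split; apply/andP; split; lra.
Qed.

Lemma compact_closed_nrm Q (r : R) :
  closed Q -> (forall z, Q z -> nrm z <= r) -> compact Q.
Proof. by move=> cQ Qr; exact: (subclosed_compact cQ (@compact_disc r) Qr). Qed.

Lemma cont_onD D F G : cont_on D F -> cont_on D G ->
  cont_on D (fun z => F z + G z).
Proof.
move=> cF cG x Dx e e0; have e2 : 0 < e / 2 by rewrite divr_gt0.
have [d d0 dF] := cF x Dx _ e2; have [d' d'0 dG] := cG x Dx _ e2.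
exists (Num.min d d'); first by rewrite lt_min d0.
move=> y Dy; rewrite lt_min => /andP[/(dF y Dy) h1 /(dG y Dy) h2].
by move: h1 h2; rewrite !ltr_distl => /andP[? ?] /andP[? ?]; lra.
Qed.

Lemma cont_onZ D F k : cont_on D F -> cont_on D (fun z => k * F z).
Proof.
move=> cF x Dx e e0; have k0 : 0 < `|k| + 1 by rewrite ltr_wpDl.
have [|d d0 dF] := cF x Dx (e / (`|k| + 1)); first by rewrite divr_gt0.
exists d => // y Dy /(dF y Dy); rewrite ltr_pdivlMr // => h.
rewrite -mulrBr normrM; apply: le_lt_trans h; rewrite mulrC.
by rewrite ler_wpM2l // lerDl.
Qed.

Lemma cont_on_cst D k : cont_on D (fun=> k).
Proof. by move=> x Dx e e0; exists 1 => // y _ _; rewrite subrr normr0. Qed.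

Lemma cont_on_comp D F (g : R -> R) : (forall x, D x -> {for F x, continuous g}) ->
  cont_on D F -> cont_on D (fun z => g (F z)).
Proof.
move=> cg cF x Dx e e0.
have /cvgrPdist_lt/(_ e e0)/nbhs_ballP[d /= d0 dg] := cg x Dx.
have [d' d'0 dF] := cF x Dx d d0; exists d' => // y Dy yx.
rewrite distrC; apply: (dg (F y)); rewrite -ball_normE /= distrC.
exact: dF.
Qed.

Lemma cont_on_nrm D z0 : cont_on D (fun z => nrm (z - z0)).
Proof.
move=> x Dx e e0; exists e => // y Dy yx; apply: le_lt_trans yx.
have := nrm_sub_le (y - z0) (x - z0); have := nrm_sub_le (x - z0) (y - z0).
rewrite !opprB !addrA !subrK [nrm (x - y)]nrmB ler_norml => ? ?.
by apply/andP; split; lra.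
Qed.

Lemma cont_on_contraction D F (g : R -> R) : (forall p q, `|g p - g q| <= `|p - q|) ->
  cont_on D F -> cont_on D (fun x => g (F x)).
Proof.
move=> gc cF x Dx e e0; have [d d0 dP] := cF x Dx e e0; exists d => // y Dy yx.
exact: le_lt_trans (gc _ _) (dP y Dy yx).
Qed.

Lemma cont_on_max D F (c : R) : cont_on D F -> cont_on D (fun x => Num.max (F x) c).
Proof.
apply: (@cont_on_contraction _ _ (fun p => Num.max p c)) => p q.
have := ler_norm (p - q); have := ler_norm (q - p); rewrite distrC => h1 h2.
by case: (leP p c) => ac; case: (leP q c) => bc; rewrite ler_norml; apply/andP; split; lra.
Qed.

Lemma cont_on_min D F (c : R) : cont_on D F -> cont_on D (fun x => Num.min (F x) c).
Proof.
apply: (@cont_on_contraction _ _ (fun p => Num.min p c)) => p q.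
have := ler_norm (p - q); have := ler_norm (q - p); rewrite distrC => h1 h2.
by case: (leP p c) => ac; case: (leP q c) => bc; rewrite ler_norml; apply/andP; split; lra.
Qed.

End topology.

(** * Complex differentiability *)

Section complex_derivative.
Variable R : realType.
Local Notation C := (CC R).
Implicit Types (f g : C -> C) (z w a b : C).

(** The remainder is bounded without a quotient, so w = z is included and the rules of calculus
    become inequalities between moduli. *)
Definition cder f z a := forall e : R, 0 < e -> exists2 d : R, 0 < d &
  forall w, nrm (w - z) < d -> nrm (f w - f z - a * (w - z)) <= e * nrm (w - z).

Lemma cder_cont f z a : cder f z a -> forall e : R, 0 < e ->
  exists2 d : R, 0 < d & forall w, nrm (w - z) < d -> nrm (f w - f z) < e.
Proof.
move=> df e e0; have [d d0 dP] := df 1 ltr01.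
have k0 : 0 < 1 + nrm a by have := nrm_ge0 a; lra.
exists (Num.min d (e / (1 + nrm a))); first by rewrite lt_min d0 divr_gt0.
move=> w; rewrite lt_min => /andP[/dP h]; rewrite ltr_pdivlMr // => h2.
rewrite -[f w - f z](subrK (a * (w - z))).
apply: le_lt_trans (nrmD _ _) _; apply: le_lt_trans h2.
by rewrite nrmM; lra.
Qed.

Lemma cder_eq f g z a : (exists2 d : R, 0 < d & forall w, nrm (w - z) < d -> f w = g w) ->
  cder f z a -> cder g z a.
Proof.
move=> [d d0 fg] df e e0; have [d' d'0 dP] := df e e0.
exists (Num.min d d'); first by rewrite lt_min d0.
move=> w; rewrite lt_min => /andP[wd wd']; rewrite -!fg ?subrr ?nrm0 //.
exact: dP.
Qed.

Lemma cder_cst b z : cder (fun=> b) z 0.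
Proof.
move=> e e0; exists 1 => // w _; rewrite subrr mul0r subr0 nrm0.
by rewrite mulr_ge0 // ltW.
Qed.

Lemma cder_id z : cder id z 1.
Proof.
move=> e e0; exists 1 => // w _; rewrite mul1r subrr nrm0.
by rewrite mulr_ge0 // ltW.
Qed.

Lemma cderD f g z a b : cder f z a -> cder g z b ->
  cder (fun w => f w + g w) z (a + b).
Proof.
move=> df dg e e0; have e2 : 0 < e / 2 by rewrite divr_gt0.
have [d d0 dP] := df _ e2; have [d' d'0 dP'] := dg _ e2.
exists (Num.min d d'); first by rewrite lt_min d0.
move=> w; rewrite lt_min => /andP[/dP h /dP' h'].
have -> : f w + g w - (f z + g z) - (a + b) * (w - z) =
  (f w - f z - a * (w - z)) + (g w - g z - b * (w - z)) by ring.
by apply: le_trans (nrmD _ _) _; lra.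
Qed.

Lemma cderM f g z a b : cder f z a -> cder g z b ->
  cder (fun w => f w * g w) z (a * g z + f z * b).
Proof.
move=> df dg e e0.
(* The four terms of the remainder below contribute |g z|, |f z|, 1 and |a| times [k * t], which [M]
   adds up; the factor 3 is slack. *)
pose M := nrm (f z) + nrm (g z) + nrm a + 1.
have M0 : 0 < M by rewrite /M; have := nrm_ge0 (f z); have := nrm_ge0 (g z); have := nrm_ge0 a; lra.
have e1 : 0 < e / (3 * M) by rewrite divr_gt0 // mulr_gt0.
have e1' : 0 < Num.min 1 (e / (3 * M)) by rewrite lt_min ltr01.
have [d d0 dP] := df _ e1'; have [d' d'0 dP'] := dg _ e1.
have [d2 d20 dP2] := cder_cont dg e1'.
exists (Num.min d (Num.min d' d2)); first by rewrite !lt_min d0 d'0.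
move=> w; rewrite !lt_min => /andP[/dP h /andP[/dP' h' /dP2 h2]].
have -> : f w * g w - f z * g z - (a * g z + f z * b) * (w - z) =
  (f w - f z - a * (w - z)) * g z + f z * (g w - g z - b * (w - z))
  + (f w - f z - a * (w - z)) * (g w - g z) + a * (w - z) * (g w - g z) by ring.
set t := nrm (w - z) in h h' *; have t0 : 0 <= t by exact: nrm_ge0.
have m1 : Num.min 1 (e / (3 * M)) <= 1 by rewrite ge_min lexx.
have m2 : Num.min 1 (e / (3 * M)) <= e / (3 * M) by rewrite ge_min lexx orbT.
set mm := Num.min _ _ in m1 m2 h h2 e1'.
have he : e = 3 * M * (e / (3 * M)) by rewrite mulrC divfK // mulf_neq0 ?gt_eqF.
set k := e / (3 * M) in he m2 h' e1 *.
have A1 : nrm ((f w - f z - a * (w - z)) * g z) <= k * t * nrm (g z).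
  by rewrite nrmM ler_wpM2r //; apply: le_trans h _; rewrite ler_wpM2r.
have A2 : nrm (f z * (g w - g z - b * (w - z))) <= nrm (f z) * (k * t).
  by rewrite nrmM ler_wpM2l.
have A3 : nrm ((f w - f z - a * (w - z)) * (g w - g z)) <= t * k.
  rewrite nrmM; apply: ler_pM => //; last by apply: le_trans (ltW h2) _.
  by apply: le_trans h _; rewrite ler_piMl.
have A4 : nrm (a * (w - z) * (g w - g z)) <= nrm a * t * k.
  rewrite !nrmM; apply: ler_wpM2l; first by rewrite mulr_ge0.
  by apply: le_trans (ltW h2) _.
have := nrmD ((f w - f z - a * (w - z)) * g z + f z * (g w - g z - b * (w - z))
  + (f w - f z - a * (w - z)) * (g w - g z)) (a * (w - z) * (g w - g z)).
have := nrmD ((f w - f z - a * (w - z)) * g z + f z * (g w - g z - b * (w - z)))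
   ((f w - f z - a * (w - z)) * (g w - g z)).
have := nrmD ((f w - f z - a * (w - z)) * g z) (f z * (g w - g z - b * (w - z))).
move=> B1 B2 B3; apply: le_trans B3 _.
have -> : e * t = 3 * M * (k * t) by rewrite he mulrA.
have kt : 0 <= k * t by rewrite mulr_ge0 // ltW.
have E : 3 * M * (k * t) = 3 * (k * t) * nrm (f z) + 3 * (k * t) * nrm (g z)
  + 3 * (k * t) * nrm a + 3 * (k * t) by rewrite /M; ring.
have n1 : 0 <= k * t * nrm (f z) by rewrite mulr_ge0.
have n2 : 0 <= k * t * nrm (g z) by rewrite mulr_ge0.
have n3 : 0 <= k * t * nrm a by rewrite mulr_ge0.
rewrite E.
lra.
Qed.

Lemma cder_comp f g z a b : cder f (g z) a -> cder g z b ->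
  cder (fun w => f (g w)) z (a * b).
Proof.
move=> df dg e e0.
pose M := nrm b + 1.
have M0 : 0 < M by rewrite /M; have := nrm_ge0 b; lra.
have N0 : 0 < nrm a + 1 by have := nrm_ge0 a; lra.
have e1 : 0 < e / (2 * M) by rewrite divr_gt0 // mulr_gt0.
have e2 : 0 < e / (2 * (nrm a + 1)) by rewrite divr_gt0 // mulr_gt0.
have e2' : 0 < Num.min 1 (e / (2 * (nrm a + 1))) by rewrite lt_min ltr01.
have [d d0 dP] := df _ e1; have [d' d'0 dP'] := dg _ e2'.
have [d2 d20 dP2] := cder_cont dg d0.
exists (Num.min d' d2); first by rewrite lt_min d'0.
move=> w; rewrite lt_min => /andP[/dP' h' /dP2 h2].
have h := dP _ h2.
have -> : f (g w) - f (g z) - a * b * (w - z) =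
  (f (g w) - f (g z) - a * (g w - g z)) + a * (g w - g z - b * (w - z)) by ring.
apply: le_trans (nrmD _ _) _; rewrite nrmM.
set t := nrm (w - z) in h' *; have t0 : 0 <= t by exact: nrm_ge0.
have m1 : Num.min 1 (e / (2 * (nrm a + 1))) <= 1 by rewrite ge_min lexx.
have m2 : Num.min 1 (e / (2 * (nrm a + 1))) <= e / (2 * (nrm a + 1)) by rewrite ge_min lexx orbT.
have gb : nrm (g w - g z) <= M * t.
  rewrite -[g w - g z](subrK (b * (w - z))) /M.
  apply: le_trans (nrmD _ _) _; rewrite [nrm (b * _)]nrmM -/t addrC mulrDl mul1r lerD2l.
  by apply: le_trans h' _; rewrite ler_piMl.
have B1 : nrm (f (g w) - f (g z) - a * (g w - g z)) <= e / 2 * t.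
  apply: le_trans h _; apply: (le_trans (ler_wpM2l (ltW e1) gb)).
  have -> : e / (2 * M) * (M * t) = e / 2 * t by field; rewrite gt_eqF.
  by [].
have B2 : nrm a * nrm (g w - g z - b * (w - z)) <= e / 2 * t.
  apply: (@le_trans _ _ ((nrm a + 1) * (e / (2 * (nrm a + 1)) * t))).
    apply: ler_pM => //; first by rewrite lerDl.
    by apply: le_trans h' _; rewrite ler_wpM2r.
  have -> // : (nrm a + 1) * (e / (2 * (nrm a + 1)) * t) = e / 2 * t.
  by field; rewrite gt_eqF.
lra.
Qed.

Lemma cderN f z a : cder f z a -> cder (fun w => - f w) z (- a).
Proof.
move=> df e e0; have [d d0 dP] := df e e0; exists d => // w /dP h.
by rewrite -nrmN; have -> : - (- f w - - f z - - a * (w - z)) =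
  f w - f z - a * (w - z) by ring.
Qed.

Lemma cderB f g z a b : cder f z a -> cder g z b ->
  cder (fun w => f w - g w) z (a - b).
Proof. by move=> df dg; apply: cderD => //; exact: cderN. Qed.

Lemma cderZ b f z a : cder f z a -> cder (fun w => b * f w) z (b * a).
Proof.
move=> df; have := cderM (cder_cst b z) df.
by rewrite mul0r add0r.
Qed.

Lemma cderV z : z != 0 -> cder (fun w => w^-1) z (- (z ^- 2)).
Proof.
move=> z0 e e0; have nz : 0 < nrm z by rewrite nrm_gt0.
exists (Num.min (nrm z / 2) (e * nrm z ^+ 3 / 2)).
  by rewrite lt_min !divr_gt0 // mulr_gt0 // exprn_gt0.
move=> w; rewrite lt_min => /andP[h1 h2].
have nw : nrm z / 2 < nrm w.
  by have := nrm_sub_le z w; rewrite nrmB => ?; lra.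
have w0 : w != 0 by rewrite -nrm_gt0; apply: lt_trans nw; rewrite divr_gt0.
have -> : w^-1 - z^-1 - - z ^- 2 * (w - z) = (w - z) ^+ 2 * (w^-1 * z^-1 ^+ 2).
  by field; rewrite z0 w0.
rewrite !(nrmM, nrmX, nrmV); set t := nrm (w - z) in h2 *.
have nw0 : 0 < nrm w by rewrite nrm_gt0.
have -> : t ^+ 2 * ((nrm w)^-1 * (nrm z)^-1 ^+ 2) =
    t / (nrm w * nrm z ^+ 2) * t by field; rewrite !gt_eqF.
apply: ler_wpM2r; first exact: nrm_ge0.
rewrite ler_pdivrMr ?mulr_gt0 ?exprn_gt0 //; apply: (le_trans (ltW h2)).
have -> : e * nrm z ^+ 3 / 2 = e * (nrm z / 2 * nrm z ^+ 2) by field.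
by rewrite ler_pM2l // ler_pM2r ?exprn_gt0 // ltW.
Qed.

Lemma cderX n z : cder (fun w => w ^+ n.+1) z (n.+1%:R * z ^+ n).
Proof.
elim: n => [|n ih].
  rewrite expr0 mulr1; apply: cder_eq (cder_id z).
  by exists 1.
have -> : n.+2%:R * z ^+ n.+1 = 1 * z ^+ n.+1 + z * (n.+1%:R * z ^+ n).
  by rewrite [n.+2%:R]mulrS mulrDl exprS; ring.
have := cderM (cder_id z) ih; apply: cder_eq.
by exists 1 => // w _; rewrite exprS.
Qed.

Lemma cder_ex_cont (D : set C) f : (forall z, D z -> exists a, cder f z a) ->
  [/\ cont_on D (fun z => cre (f z)), cont_on D (fun z => cim (f z)) &
      cont_on D (fun z => nrm (f z))].
Proof.
move=> df; split=> z Dz e e0; have [a da] := df z Dz;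
  have [d d0 dP] := cder_cont da e0; exists d => // w _ /dP h; apply: le_lt_trans h.
- by apply: le_trans (cre_le _); rewrite !reimE.
- by apply: le_trans (cim_le _); rewrite !reimE.
- have := nrm_sub_le (f w) (f z); have := nrm_sub_le (f z) (f w).
  by rewrite [nrm (f z - f w)]nrmB ler_norml => ? ?; apply/andP; split; lra.
Qed.

Lemma cder_quot f z a : cder f z a <-> (forall e : R, 0 < e -> exists2 d : R, 0 < d &
  forall h, h != 0 -> nrm h < d -> nrm (a - h^-1 * (f (h + z) - f z)) <= e).
Proof.
split=> df e e0; have [d d0 dP] := df e e0; exists d => //.
  move=> h h0 hd; have := dP (h + z); rewrite addrK => /(_ hd).
  have -> : f (h + z) - f z - a * h = - (h * (a - h^-1 * (f (h + z) - f z))).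
    by field.
  by rewrite nrmN nrmM mulrC ler_pM2r // nrm_gt0.
move=> w wd; have [->|wz] := eqVneq w z.
  by rewrite !subrr mulr0 subr0 nrm0 mulr0.
have := dP (w - z); rewrite subr_eq0 subrK => /(_ wz wd).
have h0 : w - z != 0 by rewrite subr_eq0.
have -> : f w - f z - a * (w - z) =
    - ((w - z) * (a - (w - z)^-1 * (f w - f z))) by field.
move=> h; rewrite nrmN nrmM mulrC; apply: ler_wpM2r => //.
Qed.

Lemma cder_cvg f z a : cder f z a <->
  (h^-1 *: ((f \o shift z) (h *: 1) - f z) @[h --> 0^'] --> a).
Proof.
rewrite cder_quot; split=> [df|/cvgrPdist_le df].
  apply/cvgrPdist_le => _ /cpos[e e0 ->]; have [d d0 dP] := df e e0.
  apply/nbhs_nrm; exists d => // h; rewrite subr0 => hd h0.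
  by rewrite normE cofr_le /= [h *: 1]mulr1; exact: dP.
move=> e e0; have := df (cofr e); rewrite (cofr_lt 0) => /(_ e0) /nbhs_nrm[d d0 dP].
exists d => // h h0 hd; have := dP h; rewrite subr0 => /(_ hd h0).
by rewrite normE cofr_le /= [h *: 1]mulr1.
Qed.

Lemma derivable_cder f z : derivable f z 1 -> exists a, cder f z a.
Proof. by move=> /cvg_ex[a fa]; exists a; apply/cder_cvg. Qed.

Lemma cder_derive1 f z a : cder f z a -> derive1 f z = a.
Proof.
move=> /cder_cvg fa; rewrite derive1E /derive; apply: cvg_lim => //.
Qed.

End complex_derivative.

(** * The complex exponential and the parametrised circle *)

Section complex_exponential.
Variable R : realType.
Local Notation C := (CC R).

Definition cexp (z : C) : C := cmk (expR (cre z) * cos (cim z)) (expR (cre z) * sin (cim z)).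

Lemma cexpD z w : cexp (z + w) = cexp z * cexp w.
Proof.
apply: complex_ext; rewrite /cexp !reimE expRD ?cosD ?sinD; ring.
Qed.

Lemma nrm_cexp z : nrm (cexp z) = expR (cre z).
Proof.
rewrite /nrm !reimE !exprMn -mulrDr cos2Dsin2 mulr1 sqrtr_sqr ger0_norm ?expR_ge0 //.
Qed.

Lemma cexp0 : cexp 0 = 1.
Proof. by apply: complex_ext; rewrite /cexp !reimE expR0 ?cos0 ?sin0 mul1r. Qed.

Lemma is_derive_eps (f : R -> R) (x d : R) : is_derive x 1 f d ->
  forall e : R, 0 < e -> exists2 r : R, 0 < r &
    forall h, `|h| < r -> `|f (x + h) - f x - d * h| <= e * `|h|.
Proof.
move=> [df <-] e e0; move/cvgrPdist_le/(_ e e0): df.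
move=> /nbhs_ballP[r /= r0 rP]; exists r => // h hr.
have [->|h0] := eqVneq h 0; first by rewrite addr0 subrr mulr0 subr0 normr0 mulr0.
have := rP h; rewrite -ball_normE /= sub0r normrN => /(_ hr h0).
rewrite /derive /= [h *: 1]mulr1 -[h^-1 *: _]/(h^-1 * _) [h + x]addrC => H.
set L := (X in X * h); have {}H : `|L - h^-1 * (f (x + h) - f x)| <= e by [].
have -> : f (x + h) - f x - L * h = - (h * (L - h^-1 * (f (x + h) - f x))).
  by field.
by rewrite normrN normrM mulrC ler_pM2r // normr_gt0.
Qed.

(** The real derivatives of exp, cos and sin at 0 each leave an error at most [k * t]. The product
    of increments (exp x - 1) sin y is quadratic in t and is absorbed because t < k / 2. The
    addition formula [cexpD] then carries the result from 0 to every point. *)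
Lemma cder_cexp0 : cder cexp 0 1.
Proof.
move=> e e0; have e1 : 0 < Num.min 1 (e / 8) by rewrite lt_min ltr01 divr_gt0.
set k := Num.min 1 (e / 8) in e1.
have k1 : k <= 1 by rewrite ge_min lexx.
have k2 : k <= e / 8 by rewrite ge_min lexx orbT.
have [r1 r10 P1] := is_derive_eps (is_derive_expR (0 : R)) e1.
have [r2 r20 P2] := is_derive_eps (is_derive_cos (0 : R)) e1.
have [r3 r30 P3] := is_derive_eps (is_derive_sin (0 : R)) e1.
exists (Num.min r1 (Num.min r2 (Num.min r3 (k / 2)))).
  by rewrite !lt_min r10 r20 r30 divr_gt0.
move=> w; rewrite subr0 !lt_min => /and4P[w1 w2 w3 w4].
have hx := cre_le w; have hy := cim_le w.
set t := nrm w in w1 w2 w3 w4 hx hy *; have t0 : 0 <= t by exact: nrm_ge0.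
set x := cre w in hx *; set y := cim w in hy *.
have := P1 x (le_lt_trans hx w1); rewrite add0r expR0 mul1r => {}P1.
have := P2 y (le_lt_trans hy w2); rewrite add0r cos0 sin0 oppr0 mul0r subr0 => {}P2.
have := P3 y (le_lt_trans hy w3); rewrite add0r sin0 cos0 mul1r subr0 => {}P3.
have Ex : `|expR x - 1| <= 2 * t.
  have := ler_normD (expR x - 1 - x) x; rewrite subrK => H.
  have : k * `|x| <= `|x| by rewrite ler_piMl.
  lra.
have Sy : `|sin y| <= 2 * t.
  have := ler_normD (sin y - y) y; rewrite subrK => H.
  have : k * `|y| <= `|y| by rewrite ler_piMl.
  lra.
have E3 : `|expR x| <= 2.
  by have := ler_normD (expR x - 1) 1; rewrite subrK normr1; lra.
have kx : k * `|x| <= k * t by rewrite ler_wpM2l // ltW.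
have ky : k * `|y| <= k * t by rewrite ler_wpM2l // ltW.
have RE : `|expR x * cos y - 1 - x| <= 3 * (k * t).
  have -> : expR x * cos y - 1 - x = (expR x - 1 - x) + expR x * (cos y - 1) by ring.
  apply: le_trans (ler_normD _ _) _; rewrite normrM.
  have : `|expR x| * `|cos y - 1| <= 2 * (k * t) by apply: ler_pM => //; lra.
  lra.
have IM : `|expR x * sin y - y| <= 3 * (k * t).
  have -> : expR x * sin y - y = (sin y - y) + (expR x - 1) * sin y by ring.
  apply: le_trans (ler_normD _ _) _; rewrite normrM.
  have : `|expR x - 1| * `|sin y| <= 2 * t * (2 * t) by apply: ler_pM => //; lra.
  have : 2 * t * (2 * t) <= 2 * (k * t) by nra.
  lra.
rewrite cexp0; apply: le_trans (nrm_le_reim _) _.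
rewrite /cexp !reimE -/x -/y.
have -> : expR x * cos y - 1 - (1 * x - 0 * y) = expR x * cos y - 1 - x by ring.
have -> : expR x * sin y - 0 - (1 * y + 0 * x) = expR x * sin y - y by ring.
have : k * t <= e / 8 * t by rewrite ler_wpM2r.
have : 0 <= e / 8 * t by rewrite mulr_ge0 // divr_ge0 // ltW.
lra.
Qed.

Lemma cder_cexp z : cder cexp z (cexp z).
Proof.
have d1 : cder (fun w : C => w - z) z 1.
  by have := cderB (cder_id z) (cder_cst z z); rewrite subr0.
have d2 : cder (fun w => cexp (w - z)) z (1 * 1).
  have e0 : cder cexp (z - z) 1 by rewrite subrr; exact: cder_cexp0.
  exact: (@cder_comp R cexp (fun w => w - z) z 1 1 e0 d1).
have := cderZ (cexp z) d2; rewrite !mulr1; apply: cder_eq.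
by exists 1 => // w _; rewrite -cexpD addrC subrK.
Qed.

Lemma expiE t : expi t = cexp (cmk 0 t).
Proof. by rewrite /cexp cre_mk cim_mk expR0 !mul1r. Qed.

Lemma nrm_expi t : nrm (expi t : C) = 1.
Proof. by rewrite expiE nrm_cexp expR0. Qed.

Lemma circleE (z : C) : unit_circle R z <-> nrm z = 1.
Proof.
rewrite /unit_circle /= normE; split=> [|->] //; exact: (@cofr_inj R _ 1).
Qed.

Lemma discE (z : C) : unit_disc R z <-> nrm z < 1.
Proof. by rewrite /unit_disc /= normE -(cofr_lt _ 1). Qed.

End complex_exponential.

(** * Goursat's theorem on rectangles, for a pair of real functions *)

Section goursat.
Variable R : realType.
Local Notation mu := (@lebesgue_measure R).
Implicit Types (g : R -> R) (u v : R -> R -> R) (a b c : R).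

Definition RI g a b : R := \int[mu]_(t in `[a, b]) g t.

Lemma within_integrable g a b : {within `[a, b], continuous g} ->
  mu.-integrable `[a, b] (EFin \o g).
Proof. by move=> cg; apply: continuous_compact_integrable => //; exact: segment_compact. Qed.

Lemma RI_split g a b c : a <= c -> c <= b -> {within `[a, b], continuous g} ->
  RI g a b = RI g a c + RI g c b.
Proof.
move=> ac cb cg; have ig := within_integrable cg.
rewrite /RI -(@Rintegral_itv_obnd_cbnd _ c (BRight b)); last first.
  apply: integrableS ig => //; apply: subset_itv; rewrite ?bnd_simp //.
rewrite -(@Rintegral_itvB _ _ (BLeft a) (BRight b) c) ?bnd_simp //.
by rewrite addrC subrK.
Qed.

Lemma RI_cst a b k : a <= b -> RI (cst k) a b = k * (b - a).
Proof.
move=> ab; rewrite /RI Rintegral_cst //.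
have E : mu `[a, b]%classic = (if a%:E < b%:E then b%:E - a%:E else 0)%E.
  exact: (lebesgue_measure_itv `[a, b]).
rewrite [X in fine X](_ : _ = if a%:E < b%:E then b%:E - a%:E else 0)%E; last exact: E.
rewrite lte_fin.
by case: ltP => //= ba; rewrite (le_anti (_ : a <= b <= a)) ?subrr ?mulr0 // ab.
Qed.

Lemma RI_bound g a b (B : R) : a <= b -> {within `[a, b], continuous g} ->
  (forall x, a <= x <= b -> `|g x| <= B) -> `|RI g a b| <= B * (b - a).
Proof.
move=> ab cg gB; have ig := within_integrable cg.
apply: le_trans (le_normr_Rintegral _ ig) _ => //.
have iB : mu.-integrable `[a, b] (EFin \o cst B).
  by apply: within_integrable; exact: continuous_subspaceT (@cst_continuous _ _ B).
rewrite -(RI_cst B ab); apply: le_Rintegral => //; exact: (integrable_norm ig).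
Qed.

Lemma RID g1 g2 a b : {within `[a, b], continuous g1} ->
  {within `[a, b], continuous g2} ->
  RI (fun x => g1 x + g2 x) a b = RI g1 a b + RI g2 a b.
Proof. by move=> c1 c2; apply: RintegralD => //; exact: within_integrable. Qed.

Lemma RIB g1 g2 a b : {within `[a, b], continuous g1} ->
  {within `[a, b], continuous g2} ->
  RI (fun x => g1 x - g2 x) a b = RI g1 a b - RI g2 a b.
Proof. by move=> c1 c2; apply: RintegralB => //; exact: within_integrable. Qed.

(** Real differentiability with u_x = v_y (both equal to a): closedness at the point of the form u
    dy + v dx, whose integral around a rectangle is [circulation]. *)
Definition CR_at u v (x0 y0 : R) := exists a b c, forall e : R, 0 < e ->
  exists2 d : R, 0 < d & forall x y, `|x - x0| < d -> `|y - y0| < d ->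
    `|u x y - u x0 y0 - a * (x - x0) - b * (y - y0)| <= e * (`|x - x0| + `|y - y0|) /\
    `|v x y - v x0 y0 - c * (x - x0) - a * (y - y0)| <= e * (`|x - x0| + `|y - y0|).

Lemma eps_within g a b : (forall x0, a <= x0 <= b -> forall e : R, 0 < e ->
    exists2 d : R, 0 < d & forall x, `|x - x0| < d -> `|g x - g x0| < e) ->
  {within `[a, b], continuous g}.
Proof.
move=> h; apply: continuous_in_subspaceT => x; rewrite inE /= in_itv /= => xab.
apply/cvgrPdist_lt => e e0; have [d d0 dP] := h x xab e e0.
apply/nbhs_ballP; exists d => // y xy; rewrite /= distrC dP // distrC.
exact: xy.
Qed.

Lemma CR_at_cont u v x0 y0 : CR_at u v x0 y0 -> forall e : R, 0 < e ->
  exists2 d : R, 0 < d & forall x y, `|x - x0| < d -> `|y - y0| < d ->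
    `|u x y - u x0 y0| < e /\ `|v x y - v x0 y0| < e.
Proof.
move=> [a [b [c h]]] e e0; have [d d0 dP] := h 1 ltr01.
pose M := `|a| + `|b| + `|c| + 1.
have M0 : 0 < M.
  by rewrite /M; have := normr_ge0 a; have := normr_ge0 b; have := normr_ge0 c; lra.
exists (Num.min d (e / (4 * M))); first by rewrite lt_min d0 divr_gt0 ?mulr_gt0.
move=> x y; rewrite !lt_min ltr_pdivlMr ?mulr_gt0 // => /andP[xd xe].
rewrite ltr_pdivlMr ?mulr_gt0 // => /andP[yd ye]; have [H1 H2] := dP _ _ xd yd.
set X := `|x - x0| in H1 H2 xe *; set Y := `|y - y0| in H1 H2 ye *.
have X0 : 0 <= X by exact: normr_ge0.
have Y0 : 0 <= Y by exact: normr_ge0.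
have XM : X + X * (`|a| + `|b| + `|c|) = X * M by rewrite /M; ring.
have YM : Y + Y * (`|a| + `|b| + `|c|) = Y * M by rewrite /M; ring.
have pos : forall t (k : R), 0 <= t -> 0 <= t * `|k| by move=> *; rewrite mulr_ge0.
have := pos _ a X0; have := pos _ b X0; have := pos _ c X0.
have := pos _ a Y0; have := pos _ b Y0; have := pos _ c Y0 => *.
split.
  have -> : u x y - u x0 y0 = (u x y - u x0 y0 - a * (x - x0) - b * (y - y0))
     + a * (x - x0) + b * (y - y0) by ring.
  apply: le_lt_trans (ler_normD _ _) _; rewrite [X in _ + X]normrM -/Y.
  have := ler_normD (u x y - u x0 y0 - a * (x - x0) - b * (y - y0)) (a * (x - x0)).
  rewrite [X in _ <= _ + X]normrM -/X; lra.
have -> : v x y - v x0 y0 = (v x y - v x0 y0 - c * (x - x0) - a * (y - y0))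
   + c * (x - x0) + a * (y - y0) by ring.
apply: le_lt_trans (ler_normD _ _) _; rewrite [X in _ + X]normrM -/Y.
have := ler_normD (v x y - v x0 y0 - c * (x - x0) - a * (y - y0)) (c * (x - x0)).
rewrite [X in _ <= _ + X]normrM -/X; lra.
Qed.

Definition circulation u v (s t h k : R) :=
  RI (u (s + h)) t (t + k) - RI (u s) t (t + k)
  + (RI (v ^~ t) s (s + h) - RI (v ^~ (t + k)) s (s + h)).

Section rectangle.
Variables (u v : R -> R -> R) (S T H K : R).
Hypotheses (H0 : 0 <= H) (K0 : 0 <= K).
Hypothesis CR : forall x y, S <= x <= S + H -> T <= y <= T + K -> CR_at u v x y.

Let within_u s t k : S <= s <= S + H -> T <= t -> t + k <= T + K ->
  {within `[t, t + k], continuous (u s)}.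
Proof.
move=> sH tT tK; apply: eps_within => y /andP[ty yt] e e0.
have yT : T <= y <= T + K by lra.
have [d d0 dP] := CR_at_cont (CR sH yT) e0.
by exists d => // y' yd; apply: (dP s y' _ yd).1; rewrite subrr normr0.
Qed.

Let within_v t s h : T <= t <= T + K -> S <= s -> s + h <= S + H ->
  {within `[s, s + h], continuous (v ^~ t)}.
Proof.
move=> tK sS sH; apply: eps_within => y /andP[ty yt] e e0.
have yS : S <= y <= S + H by lra.
have [d d0 dP] := CR_at_cont (CR yS tK) e0.
by exists d => // y' yd; apply: (dP y' t yd _).2; rewrite subrr normr0.
Qed.

Lemma circulation_quarters s t h k : 0 <= h -> 0 <= k -> S <= s -> s + h <= S + H ->
    T <= t -> t + k <= T + K ->
  circulation u v s t h k =
    circulation u v s t (h / 2) (k / 2) + circulation u v (s + h / 2) t (h / 2) (k / 2)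
  + (circulation u v s (t + k / 2) (h / 2) (k / 2)
     + circulation u v (s + h / 2) (t + k / 2) (h / 2) (k / 2)).
Proof.
move=> h0 k0 sS sH tT tK; rewrite /circulation.
have hh : s + h / 2 + h / 2 = s + h by field.
have kk : t + k / 2 + k / 2 = t + k by field.
rewrite !hh !kk.
rewrite !(@RI_split _ s (s + h) (s + h / 2)) ?(@RI_split _ t (t + k) (t + k / 2));
  try lra; try (by apply: within_u; lra); try (by apply: within_v; lra).
Qed.

(** The affine part has zero circulation: the terms in b and c agree on opposite sides, and the two
    contributions [a * h * k] cancel. The remainder is at most [2 * e * (h + k)] on each pair of
    opposite sides. *)
Lemma circulation_local (x0 y0 e d s t h k : R) a b c : 0 < e ->
  (forall x y, `|x - x0| < d -> `|y - y0| < d ->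
    `|u x y - u x0 y0 - a * (x - x0) - b * (y - y0)| <= e * (`|x - x0| + `|y - y0|) /\
    `|v x y - v x0 y0 - c * (x - x0) - a * (y - y0)| <= e * (`|x - x0| + `|y - y0|)) ->
  h < d -> k < d -> 0 <= h -> 0 <= k -> S <= s -> s + h <= S + H ->
  T <= t -> t + k <= T + K -> s <= x0 <= s + h -> t <= y0 <= t + k ->
  `|circulation u v s t h k| <= 2 * e * (h + k) ^+ 2.
Proof.
move=> e0 dP hd kd h0 k0 sS sH tT tK sxs tyt.
have /andP[sx xs] := sxs; have /andP[ty yt] := tyt.
have cu : forall s', S <= s' <= S + H -> {within `[t, t + k], continuous (u s')}.
  by move=> s' s'H; apply: within_u; lra.
have cv : forall t', T <= t' <= T + K -> {within `[s, s + h], continuous (v ^~ t')}.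
  by move=> t' t'H; apply: within_v; lra.
have ck : forall k' x y, {within `[x, y], continuous (cst k' : R -> R)}.
  by move=> k' x y; apply: eps_within => *; exists 1 => // *; rewrite subrr normr0.
have c1 : {within `[t, t + k], continuous (fun y => u (s + h) y - u s y)}.
  by move=> y; apply: cvgB; [apply: (cu (s + h)); lra | apply: (cu s); lra].
have c2 : {within `[s, s + h], continuous (fun x => v x t - v x (t + k))}.
  by move=> x; apply: cvgB; [apply: (cv t); lra | apply: (cv (t + k)); lra].
have E : circulation u v s t h k =
    RI (fun y => u (s + h) y - u s y - a * h) t (t + k)
  + RI (fun x => v x t - v x (t + k) + a * k) s (s + h).
  rewrite (@RIB _ (cst (a * h))) // (@RID _ (cst (a * k))) // !RI_cst; try lra.
  rewrite RIB ?RIB //; first by rewrite /circulation; ring.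
  - by apply: cv; lra.
  - by apply: cv; lra.
  - by apply: cu; lra.
  - by apply: cu; lra.
have N : forall p q r : R, q <= p <= q + r -> `|q - p| + `|q + r - p| = r.
  by move=> p q r /andP[qp pq]; rewrite ler0_norm ?ger0_norm; lra.
have N1 : forall p q r : R, q <= p <= q + r -> `|q - p| <= r /\ `|q + r - p| <= r.
  by move=> p q r /andP[qp pq]; rewrite ler0_norm ?ger0_norm; lra.
have N2 : forall p q r w : R, q <= p <= q + r -> q <= w <= q + r -> `|w - p| <= r.
  by move=> p q r w /andP[qp pq] /andP[? ?]; rewrite ler_norml; lra.
rewrite E; apply: le_trans (ler_normD _ _) _.
have B1 : `|RI (fun y => u (s + h) y - u s y - a * h) t (t + k)| <= 2 * e * (h + k) * k.
  have := @RI_bound (fun y => u (s + h) y - u s y - a * h) t (t + k) (2 * e * (h + k)).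
  rewrite [t + k - t]addrC addKr; apply; first lra.
    by move=> y; apply: cvgB; [exact: c1 | exact: (ck (a * h))].
  move=> y yk; have yy : `|y - y0| <= k by apply: (N2 _ t); lra.
  have [n1 n2] := N1 x0 s h sxs.
  have [G1 _] := dP (s + h) y (le_lt_trans n2 hd) (le_lt_trans yy kd).
  have [G2 _] := dP s y (le_lt_trans n1 hd) (le_lt_trans yy kd).
  have -> : u (s + h) y - u s y - a * h =
    (u (s + h) y - u x0 y0 - a * (s + h - x0) - b * (y - y0))
    - (u s y - u x0 y0 - a * (s - x0) - b * (y - y0)) by ring.
  apply: le_trans (ler_normB _ _) _.
  have : e * (`|s + h - x0| + `|y - y0|) <= e * (h + k) by rewrite ler_pM2l //; lra.
  have : e * (`|s - x0| + `|y - y0|) <= e * (h + k) by rewrite ler_pM2l //; lra.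
  lra.
have B2 : `|RI (fun x => v x t - v x (t + k) + a * k) s (s + h)| <= 2 * e * (h + k) * h.
  have := @RI_bound (fun x => v x t - v x (t + k) + a * k) s (s + h) (2 * e * (h + k)).
  rewrite [s + h - s]addrC addKr; apply; first lra.
    by move=> y; apply: cvgD; [exact: c2 | exact: (ck (a * k))].
  move=> x xk; have xx : `|x - x0| <= h by apply: (N2 _ s); lra.
  have [n1 n2] := N1 y0 t k tyt.
  have [_ G1] := dP x (t + k) (le_lt_trans xx hd) (le_lt_trans n2 kd).
  have [_ G2] := dP x t (le_lt_trans xx hd) (le_lt_trans n1 kd).
  have -> : v x t - v x (t + k) + a * k =
    (v x t - v x0 y0 - c * (x - x0) - a * (t - y0))
    - (v x (t + k) - v x0 y0 - c * (x - x0) - a * (t + k - y0)) by ring.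
  apply: le_trans (ler_normB _ _) _.
  have : e * (`|x - x0| + `|t + k - y0|) <= e * (h + k) by rewrite ler_pM2l //; lra.
  have : e * (`|x - x0| + `|t - y0|) <= e * (h + k) by rewrite ler_pM2l //; lra.
  lra.
have -> : 2 * e * (h + k) ^+ 2 = 2 * e * (h + k) * k + 2 * e * (h + k) * h by ring.
lra.
Qed.

(** Bisection: some quarter carries at least a fourth of the circulation, and the rectangles so
    chosen shrink to a point. There the bound of [circulation_local], quadratic in the size with a
    small constant, contradicts a circulation of at least A / 4^n. *)
Lemma goursat : circulation u v S T H K = 0.
Proof.
apply/eqP; rewrite -normr_le0 leNgt; apply/negP => c0.
set A := `|circulation u v S T H K| in c0.
pose hn n := H / 2 ^+ n; pose kn n := K / 2 ^+ n.
have p2 n : 0 < (2 : R) ^+ n by exact: exprn_gt0.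
have hn0 n : 0 <= hn n by rewrite /hn divr_ge0 // ltW.
have kn0 n : 0 <= kn n by rewrite /kn divr_ge0 // ltW.
have hnS n : hn n / 2 = hn n.+1 by rewrite /hn exprSr invfM mulrA.
have knS n : kn n / 2 = kn n.+1 by rewrite /kn exprSr invfM mulrA.
pose P n (p : R * R) := [/\ S <= p.1, p.1 + hn n <= S + H, T <= p.2,
  p.2 + kn n <= T + K & A / 4 ^+ n <= `|circulation u v p.1 p.2 (hn n) (kn n)|].
pose N n (p q : R * R) := [/\ p.1 <= q.1, q.1 + hn n.+1 <= p.1 + hn n, p.2 <= q.2 &
  q.2 + kn n.+1 <= p.2 + kn n].
(* Stated for every pair, with the dummy value (0, 0) where the invariant [P] fails, so that
   [choice] yields a total function to iterate. *)
have step : forall np : nat * (R * R), exists q, P np.1 np.2 -> P np.1.+1 q /\ N np.1 np.2 q.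
  move=> [n [s t]] /=; have [h|h] := pselect (P n (s, t)); last by exists (0, 0).
  have [/= sS sH tT tK Ap] := h.
  have hn2 := hnS n; have kn2 := knS n.
  have := hn0 n.+1; have := kn0 n.+1 => kS hS.
  move: (Ap); rewrite circulation_quarters // hnS knS => Aq.
  have Ap4 : A / 4 ^+ n = 4 * (A / 4 ^+ n.+1) by rewrite exprS; field; rewrite lt0r_neq0 // exprn_gt0.
  rewrite Ap4 in Aq.
  have [q [q1 q2 qA]] : exists q : R * R, [/\ q.1 = s \/ q.1 = s + hn n.+1,
      q.2 = t \/ q.2 = t + kn n.+1 &
      A / 4 ^+ n.+1 <= `|circulation u v q.1 q.2 (hn n.+1) (kn n.+1)|].
    apply: contrapT => nq.
    have F q : (q.1 = s \/ q.1 = s + hn n.+1) -> (q.2 = t \/ q.2 = t + kn n.+1) ->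
        `|circulation u v q.1 q.2 (hn n.+1) (kn n.+1)| < A / 4 ^+ n.+1.
      move=> q1 q2; rewrite ltNge; apply/negP => le; apply: nq; by exists q.
    have F1 := F (s, t) (or_introl erefl) (or_introl erefl).
    have F2 := F (s + hn n.+1, t) (or_intror erefl) (or_introl erefl).
    have F3 := F (s, t + kn n.+1) (or_introl erefl) (or_intror erefl).
    have F4 := F (s + hn n.+1, t + kn n.+1) (or_intror erefl) (or_intror erefl).
    move: Aq; apply/negP; rewrite -ltNge /=; apply: le_lt_trans (ler_normD _ _) _.
    have := ler_normD (circulation u v s t (hn n.+1) (kn n.+1))
      (circulation u v (s + hn n.+1) t (hn n.+1) (kn n.+1)).
    have := ler_normD (circulation u v s (t + kn n.+1) (hn n.+1) (kn n.+1))
      (circulation u v (s + hn n.+1) (t + kn n.+1) (hn n.+1) (kn n.+1)).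
    move: F1 F2 F3 F4 => /=; lra.
  exists q => _; case: q q1 q2 qA => a b /= q1 q2 qA.
  by rewrite /P /N /=; split; split=> //; clear Aq Ap Ap4 qA h; case: q1 => q1; case: q2 => q2; lra.
have [g gP] := choice step.
pose p := fix p n := if n is n'.+1 then g (n', p n') else (S, T).
have Pp n : P n (p n).
  elim: n => [|n ih]; last by have [] := gP (n, p n) ih.
  by rewrite /P /= /hn /kn !expr0 !divr1; split.
have Np n : N n (p n) (p n.+1) by have [] := gP (n, p n) (Pp n).
have mono1 n m : (p n).1 <= (p (n + m)%N).1 /\ (p (n + m)%N).1 + hn (n + m)%N <= (p n).1 + hn n.
  elim: m => [|m [i1 i2]]; first by rewrite addn0.
  by rewrite addnS; have [? ? _ _] := Np (n + m)%N; split; lra.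
have mono2 n m : (p n).2 <= (p (n + m)%N).2 /\ (p (n + m)%N).2 + kn (n + m)%N <= (p n).2 + kn n.
  elim: m => [|m [i1 i2]]; first by rewrite addn0.
  by rewrite addnS; have [_ _ ? ?] := Np (n + m)%N; split; lra.
have cross1 n m : (p m).1 <= (p n).1 + hn n.
  have [nm|/ltnW mn] := leqP n m.
    by have := mono1 n (m - n)%N; rewrite subnKC // => -[_]; have := hn0 m; lra.
  by have := mono1 m (n - m)%N; rewrite subnKC // => -[? _]; have := hn0 n; lra.
have cross2 n m : (p m).2 <= (p n).2 + kn n.
  have [nm|/ltnW mn] := leqP n m.
    by have := mono2 n (m - n)%N; rewrite subnKC // => -[_]; have := kn0 m; lra.
  by have := mono2 m (n - m)%N; rewrite subnKC // => -[? _]; have := kn0 n; lra.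
(* By [cross1] and [cross2] no lower left corner passes the opposite side of any of the rectangles,
   so these suprema lie in all of them. *)
pose x0 := sup (range (fun n => (p n).1)); pose y0 := sup (range (fun n => (p n).2)).
have x0P n : (p n).1 <= x0 <= (p n).1 + hn n.
  apply/andP; split.
    by apply: ub_le_sup; [exists ((p 0%N).1 + hn 0%N) => _ [m _ <-]; exact: cross1 | exists n].
  by apply: ge_sup; [exists (p 0%N).1, 0%N | move=> _ [m _ <-]; exact: cross1].
have y0P n : (p n).2 <= y0 <= (p n).2 + kn n.
  apply/andP; split.
    by apply: ub_le_sup; [exists ((p 0%N).2 + kn 0%N) => _ [m _ <-]; exact: cross2 | exists n].
  by apply: ge_sup; [exists (p 0%N).2, 0%N | move=> _ [m _ <-]; exact: cross2].
have [a [b [c abc]]] : CR_at u v x0 y0.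
  apply: CR; first by have := x0P 0%N; rewrite /= /hn expr0 divr1.
  by have := y0P 0%N; rewrite /= /kn expr0 divr1.
(* Chosen so that 2 e (H + K)^2 < A; the added 1 keeps the denominator positive when H = K = 0. *)
pose e := A / (4 * ((H + K) ^+ 2 + 1)).
have D0 : 0 < (H + K) ^+ 2 + 1 by rewrite ltr_wpDl // sqr_ge0.
have e0 : 0 < e by rewrite /e divr_gt0 // mulr_gt0.
have [d d0 dP] := abc e e0.
have [n nP] : exists n, hn n < d /\ kn n < d.
  have [n hk] : exists n, (H + K) / d < 2 ^+ n.
    have := @archi_boundP R ((H + K) / d).
    rewrite divr_ge0 ?addr_ge0 // ?(ltW d0) // => /(_ isT) h.
    exists (Num.Def.archi_bound ((H + K) / d)); apply: lt_le_trans h _.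
    by rewrite -natrX ler_nat ltnW // ltn_expl.
  move: hk; rewrite ltr_pdivrMr // => hk.
  rewrite mulrC in hk.
  by exists n; rewrite /hn /kn !ltr_pdivrMr //; split; apply: le_lt_trans hk; rewrite ?lerDl ?lerDr.
have [/= sS sH tT tK Ap] := Pp n.
have := circulation_local e0 dP nP.1 nP.2 (hn0 n) (kn0 n) sS sH tT tK (x0P n) (y0P n).
move=> /(le_trans Ap).
have -> : 2 * e * (hn n + kn n) ^+ 2 = 2 * e * (H + K) ^+ 2 / 4 ^+ n.
  rewrite /hn /kn -mulrDl exprMn exprVn mulrA -!exprM mulnC exprM.
  by have -> : (2 : R) ^+ 2 = 4 by rewrite expr2 -natrM.
rewrite ler_pdivrMr ?exprn_gt0 // divfK ?lt0r_neq0 ?exprn_gt0 //; apply/negP; rewrite -ltNge.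
have Ae : A = e * (4 * ((H + K) ^+ 2 + 1)) by rewrite /e divfK // lt0r_neq0 // mulr_gt0.
rewrite [ltRHS]Ae; have : 0 <= (H + K) ^+ 2 by exact: sqr_ge0.
by move=> q0; nra.
Qed.

End rectangle.

End goursat.

(** * Normalised means over the circle *)

Section circle_mean.
Variable R : realType.
Local Notation C := (CC R).
Local Notation T := (unit_circle R).
Local Notation sigma := (@arc_length R).
Local Notation mu := (@lebesgue_measure R).
Implicit Types (F G : C -> R).

Lemma measurable_open_CC (A : set (borelCC R)) : open (A : set C) -> measurable A.
Proof. by move=> oA; exact: sub_sigma_algebra. Qed.

Lemma measurable_closed_CC (A : set (borelCC R)) : closed (A : set C) -> measurable A.
Proof.
by move=> cA; rewrite -[A]setCK; apply: measurableC; apply: measurable_open_CC; exact: closed_openC.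
Qed.

Lemma closed_circle : closed (T : set C).
Proof.
apply: closed_nrm => z zT.
have n1 : nrm z != 1 by apply/negP => /eqP h; apply: zT; apply/circleE.
exists `|nrm z - 1|; first by rewrite normr_gt0 subr_eq0.
move=> w wz /circleE w1; move: wz; rewrite -w1 ltNge; apply/negP/negPn.
have := nrm_sub_le z w; have := nrm_sub_le w z; rewrite [nrm (z - w)]nrmB ler_norml => ? ?.
by apply/andP; split; lra.
Qed.

Lemma measurable_circle : measurable (T : set (borelCC R)).
Proof. apply: measurable_closed_CC; exact: closed_circle. Qed.
Hint Resolve measurable_circle : core.

Lemma compact_circle : compact (T : set C).
Proof.
have h (z : C) : T z -> nrm z <= 1 by move=> /circleE ->.
exact: (compact_closed_nrm closed_circle h).
Qed.

Lemma arc_length_full (A : set (borelCC R)) : measurable A -> T `<=` A ->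
  sigma A = (pi *+ 2)%:E.
Proof.
move=> mA TA; rewrite /arc_length /pushforward /mrestr.
have -> : @expi R @^-1` A = setT.
  by apply/seteqP; split=> // t _; apply/TA/circleE; exact: nrm_expi.
rewrite setTI.
have E : mu `[0, pi *+ 2[%classic = (if (0 : R)%:E < (pi *+ 2)%:E then (pi *+ 2)%:E - 0%:E else 0)%E.
  exact: (lebesgue_measure_itv `[0, pi *+ 2[).
rewrite [LHS]E lte_fin mulrn_wgt0 ?pi_gt0 // sube0 //.
Qed.

Lemma arc_length_circle : sigma T = (pi *+ 2)%:E.
Proof. exact: arc_length_full. Qed.

(** Bounded measurable functions form an algebra inside the integrable ones, so this single
    predicate carries every integrability condition. *)
Definition bm F := measurable_fun (T : set (borelCC R)) (F : borelCC R -> R) /\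
  exists B : R, forall x, T x -> `|F x| <= B.

Lemma bm_integrable F : bm F -> sigma.-integrable (T : set (borelCC R)) (EFin \o F).
Proof.
move=> [mF [B FB]]; apply: measurable_bounded_integrable => //.
  have h : (sigma T < +oo)%E by rewrite arc_length_circle ltry.
  exact: h.
exists B; split; first by rewrite num_real.
by move=> B' BB' x Tx /=; apply: le_trans (FB x Tx) _; exact: ltW.
Qed.

Definition mean F : R := (\int[sigma]_(x in (T : set (borelCC R))) F x) / (pi *+ 2).

Lemma pi2_gt0 : 0 < (pi *+ 2 : R).
Proof. by rewrite mulrn_wgt0 // pi_gt0. Qed.
Hint Resolve pi2_gt0 : core.

Lemma eq_mean F G : (forall x, nrm x = 1 -> F x = G x) -> mean F = mean G.
Proof.
move=> FG; congr (_ / _); apply: eq_Rintegral => x; rewrite inE => /circleE.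
exact: FG.
Qed.

Lemma bm_eq F G : (forall x, nrm x = 1 -> F x = G x) -> bm F -> bm G.
Proof.
move=> FG [mF [B FB]]; split.
  by apply: eq_measurable_fun mF => x; rewrite inE => /circleE /FG.
by exists B => x Tx; rewrite -FG ?FB //; exact/circleE.
Qed.

Lemma bmD F G : bm F -> bm G -> bm (fun x => F x + G x).
Proof.
move=> [mF [B FB]] [mG [B' GB]]; split; first exact: measurable_funD.
by exists (B + B') => x Tx; apply: le_trans (ler_normD _ _) _; apply: lerD; [exact: FB | exact: GB].
Qed.

Lemma bmM F G : bm F -> bm G -> bm (fun x => F x * G x).
Proof.
move=> [mF [B FB]] [mG [B' GB]]; split; first exact: measurable_funM.
by exists (B * B') => x Tx; rewrite normrM ler_pM // ?FB ?GB.
Qed.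

Lemma bm_cst k : bm (fun=> k).
Proof. by split; [exact: measurable_cst | exists `|k|]. Qed.

Lemma bmZ k F : bm F -> bm (fun x => k * F x).
Proof. by move=> bF; apply: bmM => //; exact: bm_cst. Qed.

Lemma bmN F : bm F -> bm (fun x => - F x).
Proof. by move=> /(bmZ (-1)); apply: bm_eq => x _; rewrite mulN1r. Qed.

Lemma bmB F G : bm F -> bm G -> bm (fun x => F x - G x).
Proof. by move=> bF bG; apply: bmD => //; exact: bmN. Qed.

Lemma meanD F G : bm F -> bm G -> mean (fun x => F x + G x) = mean F + mean G.
Proof.
by move=> bF bG; rewrite /mean RintegralD ?mulrDl //; exact: bm_integrable.
Qed.

Lemma meanB F G : bm F -> bm G -> mean (fun x => F x - G x) = mean F - mean G.
Proof.
by move=> bF bG; rewrite /mean RintegralB ?mulrBl //; exact: bm_integrable.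
Qed.

Lemma meanZ k F : bm F -> mean (fun x => k * F x) = k * mean F.
Proof.
by move=> bF; rewrite /mean RintegralZl ?mulrA //; exact: bm_integrable.
Qed.

Lemma mean_cst k : mean (fun=> k) = k.
Proof.
rewrite /mean Rintegral_cst // [X in fine X]arc_length_circle /=.
by rewrite mulfK // gt_eqF.
Qed.

Lemma mean_le F G : bm F -> bm G -> (forall x, nrm x = 1 -> F x <= G x) ->
  mean F <= mean G.
Proof.
move=> bF bG FG; rewrite /mean ler_pM2r ?invr_gt0 //.
apply: le_Rintegral => //; try exact: bm_integrable.
by move=> x /circleE; exact: FG.
Qed.

Lemma mean_ge0 F : (forall x, nrm x = 1 -> 0 <= F x) -> 0 <= mean F.
Proof.
move=> F0; apply: divr_ge0; last exact/ltW/pi2_gt0.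
by apply: Rintegral_ge0 => x /circleE; exact: F0.
Qed.

Lemma mean_norm F (B : R) : bm F -> (forall x, nrm x = 1 -> `|F x| <= B) ->
  `|mean F| <= B.
Proof.
move=> bF FB; rewrite ler_norml -(mean_cst (- B)) -[X in _ <= _ <= X](mean_cst B).
by apply/andP; split; apply: mean_le => //; try exact: bm_cst;
  move=> x /FB; rewrite ler_norml => /andP[].
Qed.

Lemma cont_on_measurable (D : set C) F : measurable (D : set (borelCC R)) ->
  cont_on D F -> measurable_fun (D : set (borelCC R)) (F : borelCC R -> R).
Proof.
move=> mD cF; apply: (measurability (RGenOpens.G (R:=R))).
  exact: RGenOpens.measurableE.
move=> _ [_ [a [b ->]] <-].
(* [V] is the union of the discs centred on D on whose trace F stays between a and b; it is open in
   the plane. *)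
pose V : set C := [set z | exists x, [/\ D x, a < F x < b & exists2 d : R,
  0 < d & nrm (z - x) < d /\ forall y, D y -> nrm (y - x) < d -> a < F y < b]].
have -> : D `&` F @^-1` `]a, b[%classic = D `&` V.
  apply/seteqP; split=> x [Dx].
    rewrite /= in_itv /= => /andP[ax xb]; split=> //; exists x; split; rewrite ?ax //.
    have e0 : 0 < Num.min (F x - a) (b - F x) by rewrite lt_min !subr_gt0 ax.
    have [d d0 dP] := cF x Dx _ e0; exists d => //; split; first by rewrite subrr nrm0.
    move=> y Dy /(dP y Dy); rewrite lt_min !ltr_norml => /andP[/andP[? ?] /andP[? ?]].
    by apply/andP; split; lra.
  move=> [x0 [_ _ [d d0 [xd dP]]]]; split=> //=; rewrite in_itv /=; exact: dP.
apply: measurableI => //; apply: measurable_open_CC; apply/open_nrm.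
move=> z [x [Dx xab [d d0 [zd dP]]]]; exists (d - nrm (z - x)); first by rewrite subr_gt0.
move=> w wz; exists x; split=> //; exists d => //; split=> //.
by apply: le_lt_trans (nrm_triangle _ z _) _; lra.
Qed.

Lemma cont_on_bm F : cont_on T F -> bm F.
Proof.
move=> cF; split; first exact: cont_on_measurable.
by have [B _ FB] := cont_on_bounded compact_circle cF; exists B.
Qed.

Lemma mean_param F : cont_on T F ->
  mean F = RI (fun t => F (expi t)) 0 (pi *+ 2) / (pi *+ 2).
Proof.
move=> cF; congr (_ / _).
have bF := cont_on_bm cF; have [mF _] := bF.
have wF : {within `[0, pi *+ 2 : R], continuous (fun t => F (expi t))}.
  apply: continuous_subspaceT => t; apply/cvgrPdist_lt => e e0.
  have Tt : T (expi t) by apply/circleE; exact: nrm_expi.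
  have [d d0 dP] := cF _ Tt e e0.
  have /cvgrPdist_lt/(_ (cofr d)) := @continuous_expi R t.
  rewrite (cofr_lt 0) => /(_ d0); apply: filterS => s; rewrite normE cofr_lt nrmB => sd.
  by rewrite distrC; apply: dP => //; apply/circleE; exact: nrm_expi.
have iF := within_integrable wF.
pose I : set R := `[0, pi *+ 2[%classic.
have mI : measurable (I : set (measurableTypeR R)) by exact: measurable_itv.
(* Extending by 0 makes the integrand measurable on the whole plane, and its pullback measurable on
   the whole line. *)
pose F' : borelCC R -> R := F \_ T.
have mF' : measurable_fun setT F' by apply/(measurable_restrictT _ _).1.
have F'E t : F' (expi t) = F (expi t).
  by rewrite /F' patchE mem_set //; apply/circleE; exact: nrm_expi.
have preT : @expi R @^-1` T = setT.
  by apply/seteqP; split=> // t _; apply/circleE; exact: nrm_expi.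
pose m := mrestr (@lebesgue_measure R) (measurable_itv `[0, pi *+ 2[).
have mF'e : measurable_fun setT (EFin \o F') by exact/measurable_EFinP.
have mexp : measurable_fun setT (EFin \o F' \o @expi R).
  by apply: measurableT_comp mF'e _; exact: measurable_expi.
have mTfin : (m setT < +oo)%E.
  rewrite /m /mrestr setTI.
  have E : mu `[0, pi *+ 2[%classic = (if (0 : R)%:E < (pi *+ 2)%:E then (pi *+ 2)%:E - 0%:E else 0)%E.
    exact: (lebesgue_measure_itv `[0, pi *+ 2[).
  by rewrite [X in (X < _)%E]E; case: ifP; rewrite ?ltry.
have im : m.-integrable setT (EFin \o F' \o @expi R).
  apply: (@measurable_bounded_integrable _ _ _ _ (F' \o @expi R)) => //.
    by apply: measurableT_comp mF' _; exact: measurable_expi.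
  have [_ [B FB]] := bF; exists B; split; first by rewrite num_real.
  move=> B' BB' t _ /=; rewrite F'E; apply: le_trans (ltW BB'); apply: FB.
  by apply/circleE; exact: nrm_expi.
transitivity (\int[sigma]_(x in (T : set (borelCC R))) F' x).
  by apply: eq_Rintegral => x xT; rewrite /F' patchE xT.
rewrite /Rintegral.
rewrite (@eq_measure_integral _ _ _ _ (pushforward m (@expi R))) //.
rewrite (@integral_pushforward _ _ _ _ _ _ (@measurable_expi R) m T (EFin \o F')) //; last first.
  by rewrite preT.
(* The restricted measure [m] gives no mass to the complement of [I] and agrees with Lebesgue
   measure inside it; the endpoint 2 pi is added at the end at no cost. *)
rewrite preT (@negligible_integral _ _ _ m setT (~` I)) //; last 2 first.
- by apply: measurableC; exact: mI.
- have I0 : ~` I `&` I = set0 by exact: setICl.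
  have h : mu (~` I `&` I) = 0%E by rewrite I0 measure0.
  exact: h.
rewrite setTD setCK (@eq_measure_integral _ _ _ _ mu) //; last first.
  move=> A mA AI; have AE : A `&` I = A by exact: setIidl.
  have h : mu (A `&` I) = mu A by rewrite AE.
  exact: h.
transitivity (\int[mu]_(t in I) (F (expi t))).
  by congr fine; apply: eq_integral => t _ /=; rewrite F'E.
rewrite /I Rintegral_itv_bndo_bndc //.
apply: integrableS iF => //; apply: subset_itvl; rewrite bnd_simp.
by [].
Qed.

End circle_mean.
#[global] Hint Resolve measurable_circle pi2_gt0 : core.

(** * The mean value property and the maximum principle *)

Section mean_value_property.
Variable R : realType.
Local Notation C := (CC R).
Local Notation T := (unit_circle R).
Implicit Types (f g : C -> C).

Definition cbm f := bm (fun x => cre (f x)) /\ bm (fun x => cim (f x)).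
Definition cmean f : C := cmk (mean (fun x => cre (f x))) (mean (fun x => cim (f x))).

Lemma cder_cbm f : (forall z, nrm z = 1 -> exists a, cder f z a) -> cbm f.
Proof.
move=> df; have [|c1 c2 _] := @cder_ex_cont _ T f; last by split; exact: cont_on_bm.
by move=> z /circleE; exact: df.
Qed.

Lemma cder_affine (z0 : C) (r : C) z : cder (fun w => z0 + r * w) z r.
Proof.
have := cderD (cder_cst z0 z) (cderZ r (cder_id z)).
by rewrite add0r mulr1.
Qed.

Lemma cder_CR f (s0 t0 : R) a : cder f (cmk s0 t0) a ->
  CR_at (fun s t => cre (f (cmk s t))) (fun s t => cim (f (cmk s t))) s0 t0.
Proof.
move=> df; exists (cre a), (- cim a), (cim a) => e e0; have [d d0 dP] := df e e0.
have d2 : 0 < d / 2 by rewrite divr_gt0.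
exists (d / 2) => // s t sd td.
have E : cmk s t - cmk s0 t0 = cmk (s - s0) (t - t0) :> C by apply: complex_ext; rewrite !reimE.
have nE : nrm (cmk s t - cmk s0 t0) <= `|s - s0| + `|t - t0|.
  by rewrite E; exact: nrm_le_reim.
have nd : nrm (cmk s t - cmk s0 t0) < d by lra.
have {dP} h : nrm (f (cmk s t) - f (cmk s0 t0) - a * (cmk s t - cmk s0 t0)) <=
    e * (`|s - s0| + `|t - t0|) by apply: le_trans (dP _ nd) _; rewrite ler_pM2l.
have [h1 h2] := (cre_le (f (cmk s t) - f (cmk s0 t0) - a * (cmk s t - cmk s0 t0)),
  cim_le (f (cmk s t) - f (cmk s0 t0) - a * (cmk s t - cmk s0 t0))).
split; apply: le_trans h; [apply: le_trans h1 | apply: le_trans h2];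
  rewrite E !reimE le_eqVlt; apply/orP; left; apply/eqP; congr `|_|; ring.
Qed.

Section disc.
Variables (f : C -> C) (z0 : C) (rho : R).
Hypothesis df : forall w, nrm (w - z0) < rho -> exists a, cder f w a.

Lemma circle_cder (r : R) z : 0 < r < rho -> nrm z = 1 ->
  exists a, cder (fun w => f (z0 + cofr r * w)) z a.
Proof.
move=> /andP[r0 rr] z1; have [|a da] := df (w := z0 + cofr r * z).
  by rewrite addrC addKr nrmM nrm_cofr z1 mulr1 gtr0_norm.
by exists (a * cofr r); exact: (@cder_comp R f (fun w => z0 + cofr r * w) z a (cofr r) da (cder_affine _ _ _)).
Qed.

Lemma circle_bm (r : R) : 0 < r < rho -> cbm (fun w => f (z0 + cofr r * w)).
Proof. by move=> rr; apply: cder_cbm => z; exact: circle_cder. Qed.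

(** In logarithmic coordinates f becomes w |-> f (z0 + exp w), and the annulus becomes the rectangle
    [ln r1, ln r2] x [0, 2 pi]. The horizontal sides cancel by periodicity, and the vertical sides
    are the two means, so Goursat's theorem equates them. *)
Lemma mean_radius (r1 r2 : R) : 0 < r1 -> r1 <= r2 -> r2 < rho ->
  mean (fun w => cre (f (z0 + cofr r1 * w))) = mean (fun w => cre (f (z0 + cofr r2 * w))).
Proof.
move=> r10 r12 r2r; have r20 : 0 < r2 by exact: lt_le_trans r12.
have c (r : R) : 0 < r -> r < rho -> cont_on T (fun w => cre (f (z0 + cofr r * w))).
  move=> r0 rr; have [|//] := @cder_ex_cont _ T (fun w => f (z0 + cofr r * w)).
  by move=> z /circleE; apply: circle_cder; rewrite r0.
rewrite !mean_param; [|exact: c|by apply: c => //; exact: le_lt_trans r2r]; congr (_ / _).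
pose g w := f (z0 + cexp w).
pose u s t := cre (g (cmk s t)); pose v s t := cim (g (cmk s t)).
have ce (s t : R) : cexp (cmk s t) = cofr (expR s) * expi t.
  by apply: complex_ext; rewrite /cexp !reimE //; ring.
have ln12 : ln r1 <= ln r2 by rewrite ler_ln ?posrE.
have := @goursat _ u v (ln r1) 0 (ln r2 - ln r1) (pi *+ 2).
rewrite subr_ge0 ln12 => /(_ isT (ltW (pi2_gt0 R))); rewrite subrKC => H.
have {}H : circulation u v (ln r1) 0 (ln r2 - ln r1) (pi *+ 2) = 0.
  apply: H => s t /andP[s1 s2] _.
  have es : expR s <= r2 by rewrite -[r2]lnK ?posrE // ler_expR.
  have [|a da] := df (w := z0 + cexp (cmk s t)).
    rewrite addrC addKr nrm_cexp; exact: le_lt_trans r2r.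
  have dz : cder (fun w => z0 + cexp w) (cmk s t) (cexp (cmk s t)).
    by have := cderD (cder_cst z0 _) (cder_cexp (cmk s t)); rewrite add0r.
  exact: (cder_CR (@cder_comp R f (fun w => z0 + cexp w) _ _ _ da dz)).
move: H; rewrite /circulation subrKC add0r.
have -> : v ^~ (pi *+ 2) = v ^~ 0.
  apply/funext => s; rewrite /v /g !ce; congr (cim (f (z0 + _ * _))).
  by apply: complex_ext; rewrite /= ?cos2pi ?sin2pi ?cos0 ?sin0.
rewrite [X in _ + X]subrr addr0 => /subr0_eq H.
have E (r : R) : 0 < r -> (fun t => cre (f (z0 + cofr r * expi t))) = u (ln r).
  by move=> r0; apply/funext => t; rewrite /u /g ce lnK.
by rewrite (E r1 r10) (E r2 r20); exact: (esym H).
Qed.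

(** The mean does not depend on the radius, which may therefore be shrunk until f is within e of
    [f z0] on the circle. *)
Lemma mean_value_re (r : R) : 0 < r < rho ->
  mean (fun w => cre (f (z0 + cofr r * w))) = cre (f z0).
Proof.
move=> /andP[r0 rr]; apply/eqP; rewrite -subr_eq0 -normr_le0; apply/ler_addgt0Pr => e e0.
rewrite add0r; have [|a da] := df (w := z0); first by rewrite subrr nrm0; exact: lt_trans rr.
have [d d0 dP] := cder_cont da e0.
pose r' := Num.min r (d / 2).
have r'0 : 0 < r' by rewrite lt_min r0 divr_gt0.
have r'r : r' <= r by rewrite ge_min lexx.
have r'd : r' < d.
  by apply: (@le_lt_trans _ _ (d / 2)); [rewrite ge_min lexx orbT|lra].
rewrite -(mean_radius r'0 r'r rr).
have r'rho : 0 < r' < rho by rewrite r'0 /=; exact: le_lt_trans rr.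
have [b1 _] := circle_bm r'rho.
rewrite -(mean_cst (cre (f z0))) -meanB //; last exact: bm_cst.
apply: mean_norm => [|x x1]; first by apply: bmB => //; exact: bm_cst.
rewrite -creN -creD; apply: le_trans (cre_le _) _; apply/ltW/dP.
by rewrite addrC addKr nrmM nrm_cofr x1 mulr1 gtr0_norm.
Qed.

End disc.

Lemma mean_value f z0 (rho r : R) : (forall w, nrm (w - z0) < rho -> exists a, cder f w a) ->
  0 < r < rho -> cmean (fun w => f (z0 + cofr r * w)) = f z0.
Proof.
move=> df rr; apply: complex_ext; rewrite /cmean !reimE.
  exact: (mean_value_re df).
pose g w := - 'i%C * f w : C.
have dg w : nrm (w - z0) < rho -> exists a, cder g w a.
  by move=> /df[a da]; exists (- 'i%C * a); exact: cderZ.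
have gE w : cre (g w) = cim (f w) by rewrite /g !reimE /=; ring.
by rewrite -gE -(mean_value_re dg rr); apply: eq_mean => x _; rewrite gE.
Qed.

Lemma mean_value1 f (rho : R) : 1 < rho -> (forall w, nrm w < rho -> exists a, cder f w a) ->
  cmean f = f 0.
Proof.
move=> r1 df; have := @mean_value f 0 rho 1; rewrite r1 ltr01 => <- //; last first.
  by move=> w; rewrite subr0; exact: df.
by apply: complex_ext; rewrite !reimE; apply: eq_mean => x _; rewrite add0r mul1r.
Qed.

(** Adding k |w|^2 makes |f|^2 strictly subharmonic, so the maximum of the sum over Q cannot be at
    an interior point and the bound B applies there; k is then made small. Boundary points are those
    with no disc around them inside Q, which suits a region described by inequalities. *)
Lemma max_principle (Q : set C) f (B : R) : compact Q ->
  (forall z, Q z -> exists a, cder f z a) -> 0 <= B ->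
  (forall z, Q z -> ~ (exists2 d : R, 0 < d & forall w, nrm (w - z) < d -> Q w) ->
     nrm (f z) <= B) ->
  forall z, Q z -> nrm (f z) <= B.
Proof.
move=> cQ df B0 fB z Qz.
have [M M0 QM] := cont_on_bounded cQ (@cont_on_nrm _ Q 0).
have {}QM w : Q w -> nrm w <= M by move=> /QM; rewrite subr0 ger0_norm.
rewrite -(@ler_pXn2r _ 2) ?nnegrE //; apply/ler_addgt0Pr => e e0.
pose k := e / (M ^+ 2 + 1).
have M1 : 0 < M ^+ 2 + 1 by rewrite ltr_wpDl // sqr_ge0.
have k0 : 0 < k by rewrite divr_gt0.
have [_ _ cf] := cder_ex_cont df.
pose N w := nrm (f w) ^+ 2 + k * nrm (w - 0) ^+ 2.
have sqc (x : R) : {for x, continuous (fun y : R => y ^+ 2)} by exact: exprn_continuous.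
have cN : cont_on Q N.
  apply: cont_onD.
    by apply: (@cont_on_comp _ Q _ (fun y => y ^+ 2) _ cf) => w _; exact: sqc.
  apply: cont_onZ.
  by apply: (@cont_on_comp _ Q _ (fun y => y ^+ 2) _ (@cont_on_nrm _ Q 0)) => w _; exact: sqc.
have [w Qw wM] := compact_max cQ (ex_intro _ z Qz) cN.
have wB : nrm (f w) <= B.
  apply: fB => // -[d d0 dQ].
  pose r := d / 2; have rd : 0 < r < d by rewrite /r; apply/andP; split; lra.
  (* [g] linearises [N] at w. From 2 Re (conj a * b) <= |a|^2 + |b|^2 and the maximality of [N w],
     its real part on the circle of radius r is at most its value at w minus k r^2, against the mean
     value property. *)
  pose g x := cofr 2 * (cj (f w) * f x + cofr k * (cj w * (x - w))).
  have dg x : nrm (x - w) < d -> exists a, cder g x a.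
    move=> /dQ /df[a da]; eexists.
    exact: (cderZ _ (cderD (cderZ _ da) (cderZ _ (cderZ _ (cderB (cder_id x) (cder_cst w x)))))).
  have := mean_value_re dg rd; apply/eqP; rewrite lt_eqF //.
  have [b1 _] := circle_bm dg rd.
  have gw : cre (g w) = 2 * nrm (f w) ^+ 2.
    by rewrite /g subrr !mulr0 addr0 [cj _ * _]mulrC mul_cj -cofrM.
  rewrite gw.
  have r0 : 0 < k * r ^+ 2 by rewrite mulr_gt0 // exprn_gt0 //; case/andP: rd.
  apply: (@le_lt_trans _ _ (mean (fun=> 2 * nrm (f w) ^+ 2 - k * r ^+ 2) : R)); last first.
    by rewrite mean_cst ltrBlDr ltrDl.
  apply: mean_le => //; first exact: bm_cst.
  move=> x x1; have Qx : Q (w + cofr r * x).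
    apply: dQ; rewrite addrC addKr nrmM nrm_cofr x1 mulr1.
    by case/andP: rd => ? ?; rewrite gtr0_norm.
  have := wM _ Qx; rewrite /N !subr0 => h.
  have h1 : nrm (w + cofr r * x) ^+ 2 = nrm w ^+ 2 + 2 * r * cre (cj w * x) + r ^+ 2.
    have := nrm_sqr x; rewrite x1 expr1n cre_mul_cj !nrm_sqr !reimE => h1.
    rewrite (_ : r ^+ 2 = r ^+ 2 * (cre x ^+ 2 + cim x ^+ 2)); last by rewrite -h1 mulr1.
    ring.
  have h2 : 2 * cre (cj (f w) * f (w + cofr r * x)) <= nrm (f (w + cofr r * x)) ^+ 2 + nrm (f w) ^+ 2.
    rewrite cre_mul_cj !nrm_sqr.
    set a := cre (f w); set b := cim (f w); set c := cre (f _); set d' := cim (f _).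
    by have := sqr_ge0 (a - c); have := sqr_ge0 (b - d'); rewrite !sqrrB; lra.
  have -> : cre (g (w + cofr r * x)) =
     2 * cre (cj (f w) * f (w + cofr r * x)) + k * (2 * r * cre (cj w * x)).
    rewrite /g [w + _]addrC addrK; move: (f (_ + w)) => y.
    by rewrite !reimE; ring.
  move: h; rewrite h1; set p := k * (2 * r * _) => h.
  have pE : k * (nrm w ^+ 2 + 2 * r * cre (cj w * x) + r ^+ 2) =
     k * nrm w ^+ 2 + p + k * r ^+ 2 by rewrite /p; ring.
  rewrite pE in h; lra.
have := wM _ Qz; rewrite /N !subr0 => h.
have h1 : k * nrm w ^+ 2 <= e.
  apply: (@le_trans _ _ (k * (M ^+ 2 + 1))); last by rewrite /k divfK // gt_eqF.
  rewrite ler_pM2l //; apply: (@le_trans _ _ (M ^+ 2)); last by rewrite lerDl.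
  by rewrite ler_pXn2r ?nnegrE // QM.
have h2 : nrm (f w) ^+ 2 <= B ^+ 2 by rewrite ler_pXn2r ?nnegrE.
have h3 : 0 <= k * nrm z ^+ 2 by rewrite mulr_ge0 ?sqr_ge0 // ltW.
lra.
Qed.

End mean_value_property.

(** * Cauchy and Poisson integrals *)

Section cauchy_integrals.
Variable R : realType.
Local Notation C := (CC R).
Local Notation T := (unit_circle R).
Implicit Types (f g phi : C -> C) (z w : C) (b : C -> R).

Lemma bm_cre f : cbm f -> bm (fun x => cre (f x)). Proof. by case. Qed.
Lemma cbmD f g : cbm f -> cbm g -> cbm (fun x => f x + g x).
Proof.
move=> [f1 f2] [g1 g2]; split.
  by apply: bm_eq (bmD f1 g1) => x _; rewrite reimE.
by apply: bm_eq (bmD f2 g2) => x _; rewrite reimE.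
Qed.

Lemma cbmM f g : cbm f -> cbm g -> cbm (fun x => f x * g x).
Proof.
move=> [f1 f2] [g1 g2]; split.
  by apply: bm_eq (bmB (bmM f1 g1) (bmM f2 g2)) => x _; rewrite reimE.
by apply: bm_eq (bmD (bmM f1 g2) (bmM f2 g1)) => x _; rewrite reimE.
Qed.

Lemma cbm_cst z : cbm (fun=> z).
Proof. by split; exact: bm_cst. Qed.

Lemma cbm_cofr b : bm b -> cbm (fun x => cofr (b x)).
Proof. by move=> bb; split=> //; exact: bm_cst. Qed.

Lemma cbmX f n : cbm f -> cbm (fun x => f x ^+ n).
Proof.
move=> cf; elim: n => [|n ih]; first by have := cbm_cst 1.
have := cbmM cf ih; congr cbm; apply/funext => x; by rewrite exprS.
Qed.

Lemma cbm_eq f g : (forall x, nrm x = 1 -> f x = g x) -> cbm f -> cbm g.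
Proof. by move=> fg [f1 f2]; split; [apply: bm_eq f1|apply: bm_eq f2] => x /fg ->. Qed.

Lemma eq_cmean f g : (forall x, nrm x = 1 -> f x = g x) -> cmean f = cmean g.
Proof. by move=> fg; congr cmk; apply: eq_mean => x /fg ->. Qed.

Lemma cmeanD f g : cbm f -> cbm g -> cmean (fun x => f x + g x) = cmean f + cmean g.
Proof.
move=> [f1 f2] [g1 g2]; apply: complex_ext; rewrite !reimE -meanD //;
  by apply: eq_mean => x _; rewrite reimE.
Qed.

Lemma cmeanZ z f : cbm f -> cmean (fun x => z * f x) = z * cmean f.
Proof.
move=> [f1 f2]; apply: complex_ext; rewrite !reimE -!meanZ //.
  by rewrite -meanB; [apply: eq_mean => x _; rewrite reimE|exact: bmZ|exact: bmZ].
by rewrite -meanD; [apply: eq_mean => x _; rewrite reimE|exact: bmZ|exact: bmZ].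
Qed.

Lemma cmeanN f : cbm f -> cmean (fun x => - f x) = - cmean f.
Proof.
by move=> cf; rewrite -mulN1r -cmeanZ //; apply: eq_cmean => x _; rewrite mulN1r.
Qed.

Lemma cbmN f : cbm f -> cbm (fun x => - f x).
Proof.
by move=> cf; apply: cbm_eq (cbmM (cbm_cst (-1)) cf) => x _; rewrite mulN1r.
Qed.

Lemma cmeanB f g : cbm f -> cbm g -> cmean (fun x => f x - g x) = cmean f - cmean g.
Proof. by move=> cf cg; rewrite cmeanD ?cmeanN //; exact: cbmN. Qed.

Lemma cmean_cst z : cmean (fun=> z) = z.
Proof. by rewrite /cmean !mean_cst cmkK. Qed.

Lemma cmean_sum n (F : nat -> C -> C) : (forall j, cbm (F j)) ->
  cmean (fun x => \sum_(j < n) F j x) = \sum_(j < n) cmean (F j) /\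
  cbm (fun x => \sum_(j < n) F j x).
Proof.
move=> cF; elim: n => [|n [ih1 ih2]].
  split; first by rewrite big_ord0 -[RHS]cmean_cst; apply: eq_cmean => x _; rewrite big_ord0.
  by apply: cbm_eq (cbm_cst 0) => x _; rewrite big_ord0.
split.
  rewrite big_ord_recr /= -ih1 -cmeanD //; apply: eq_cmean => x _.
  by rewrite big_ord_recr.
by apply: cbm_eq (cbmD ih2 (cF n)) => x _; rewrite big_ord_recr.
Qed.

Lemma nrm_cmean f (B : R) : cbm f -> (forall x, nrm x = 1 -> nrm (f x) <= B) ->
  nrm (cmean f) <= B.
Proof.
move=> cf fB; have B0 : 0 <= B by apply: le_trans (fB 1 (nrm1 R)); exact: nrm_ge0.
have [->|c0] := eqVneq (cmean f) 0; first by rewrite nrm0.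
have n0 : 0 < nrm (cmean f) by rewrite nrm_gt0.
(* Multiplying f by the conjugate of its mean turns the modulus into a real part; treating real and
   imaginary parts separately would lose a constant. *)
rewrite -(ler_pM2l n0) -expr2 -[leLHS]cre_cofr -mul_cj mulrC -cmeanZ // cre_mk.
rewrite -[leRHS](@mean_cst R); apply: mean_le; [|exact: bm_cst|].
  exact/bm_cre/cbmM/cf/cbm_cst.
move=> x x1; apply: le_trans (ler_norm _) _; apply: le_trans (cre_le _) _.
by rewrite nrmM nrm_cj ler_pM2l // fB.
Qed.

Lemma dist_circle z x : nrm z < 1 -> nrm x = 1 -> 1 - nrm z <= nrm (x - z).
Proof. by move=> z1 x1; rewrite -x1 nrm_sub_le. Qed.

Lemma circle_subr_neq0 z x : nrm z < 1 -> nrm x = 1 -> x - z != 0.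
Proof.
move=> z1 x1; rewrite -nrm_gt0; apply: lt_le_trans (dist_circle z1 x1).
by rewrite subr_gt0.
Qed.

Lemma cbm_inv z : nrm z < 1 -> cbm (fun x => (x - z)^-1).
Proof.
move=> z1; apply: cder_cbm => x x1; eexists.
apply: (@cder_comp R (fun w => w^-1) (fun w => w - z)).
  exact: cderV (circle_subr_neq0 z1 x1).
exact: cderB (cder_id _) (cder_cst _ _).
Qed.

Lemma cbm_id : cbm (fun x : C => x).
Proof. by apply: cder_cbm => x _; exists 1; exact: cder_id. Qed.

(** Integration is against normalised arc length. Since d zeta = i zeta d theta, the Cauchy integral
    of g is the case k = 0, phi x = g x * x. *)
Definition cauchy_int k phi z := cmean (fun x => phi x * (x - z)^-1 ^+ k.+1).

(** Meant for x = 1 / (s - w), y = 1 / (s - z) and h = w - z, for which x - y = h x y. It bounds the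
    second order remainder of (s - z)^(- k) uniformly in s, as differentiation under the integral
    sign requires. *)
Lemma inv_pow_bound (k : nat) (D : R) : 0 <= D -> exists2 B : R, 0 <= B &
  forall x y h : C, x - y = h * x * y -> nrm x <= D -> nrm y <= D ->
  nrm (x ^+ k - y ^+ k - k%:R * h * y ^+ k.+1) <= B * nrm h ^+ 2.
Proof.
move=> D0; elim: k => [|k [B B0 ih]].
  by exists 0 => // x y h _ _ _; rewrite !expr0 subrr !mul0r subr0 nrm0.
exists (D * B + k%:R * D ^+ k.+3 + D ^+ k.+3).
  have D3 : 0 <= D ^+ k.+3 by exact: exprn_ge0.
  by apply: addr_ge0 => //; apply: addr_ge0; apply: mulr_ge0.
move=> x y h xy xD yD.
have -> : x ^+ k.+1 - y ^+ k.+1 - k.+1%:R * h * y ^+ k.+2 =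
  x * (x ^+ k - y ^+ k - k%:R * h * y ^+ k.+1) + k%:R * h * y ^+ k.+1 * (x - y)
  + ((x - y) - h * y ^+ 2) * y ^+ k.
  by rewrite mulrSr !exprS; ring.
have -> : x - y - h * y ^+ 2 = h ^+ 2 * x * y ^+ 2.
  rewrite xy; have -> : h * x * y - h * y ^+ 2 = h * y * (x - y) by ring.
  by rewrite xy; ring.
rewrite xy; set E := _ - _ - k%:R * h * _.
have EB : nrm E <= B * nrm h ^+ 2 by apply: ih.
have kx : nrm x * nrm E <= D * (B * nrm h ^+ 2) by apply: ler_pM.
have pw m : nrm (x * y ^+ m) <= D ^+ m.+1.
  by rewrite nrmM nrmX exprS; apply: ler_pM; rewrite ?exprn_ge0 // lerXn2r ?nnegrE.
have t2 : nrm (k%:R * h * y ^+ k.+1 * (h * x * y)) <= k%:R * D ^+ k.+3 * nrm h ^+ 2.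
  have -> : k%:R * h * y ^+ k.+1 * (h * x * y) = k%:R * h ^+ 2 * (x * y ^+ k.+2).
    by rewrite [y ^+ k.+2]exprS; ring.
  rewrite nrmM [nrm (k%:R * _)]nrmM nrm_nat nrmX [leRHS]mulrAC.
  by apply: ler_wpM2l; rewrite ?mulr_ge0 ?exprn_ge0 ?ler0n // pw.
have t3 : nrm (h ^+ 2 * x * y ^+ 2 * y ^+ k) <= D ^+ k.+3 * nrm h ^+ 2.
  have -> : h ^+ 2 * x * y ^+ 2 * y ^+ k = h ^+ 2 * (x * y ^+ k.+2).
    by rewrite !exprS; ring.
  by rewrite nrmM nrmX mulrC; apply: ler_wpM2r; rewrite ?exprn_ge0 // pw.
apply: le_trans (nrmD _ _) _; apply: le_trans (lerD (nrmD _ _) (lexx _)) _.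
rewrite nrmM !mulrDl; apply: lerD t3; apply: lerD t2.
by rewrite -mulrA.
Qed.

Lemma cbm_kernel k phi z : cbm phi -> nrm z < 1 -> cbm (fun x => phi x * (x - z)^-1 ^+ k).
Proof. by move=> cp z1; apply/cbmM/cbmX/cbm_inv. Qed.

Lemma cbm_bound phi : cbm phi -> exists2 B : R, 0 <= B & forall x, nrm x = 1 -> nrm (phi x) <= B.
Proof.
move=> [[_ [B1 h1]] [_ [B2 h2]]]; exists (B1 + B2).
  by apply: addr_ge0; [apply: le_trans (h1 1 _)|apply: le_trans (h2 1 _)] => //;
     apply/circleE; exact: nrm1.
move=> x /circleE Tx; apply: le_trans (nrm_le_reim _) _.
by apply: lerD; [exact: h1|exact: h2].
Qed.

Lemma cder_cauchy k phi z : cbm phi -> nrm z < 1 ->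
  cder (cauchy_int k phi) z (k.+1%:R * cauchy_int k.+1 phi z).
Proof.
(* Half the distance from z to the circle: for w within d of z, both kernels are bounded by 1 / d on
   the whole circle. *)
move=> cp z1 e e0; pose d := (1 - nrm z) / 2.
have d0 : 0 < d by rewrite divr_gt0 // subr_gt0.
have D0 : 0 <= d^-1 by rewrite invr_ge0 ltW.
have [B B0 hB] := inv_pow_bound k.+1 D0.
have [M M0 hM] := cbm_bound cp.
have BM0 : 0 <= B * M by exact: mulr_ge0.
have BM : 0 < B * M + 1 by rewrite ltr_wpDl.
exists (Num.min d (e / (B * M + 1))); first by rewrite lt_min d0 divr_gt0.
move=> w; rewrite lt_min => /andP[wd we].
have w1 : nrm w < 1.
  have := nrm_sub_le w z; rewrite /d in wd; lra.
have -> : cauchy_int k phi w - cauchy_int k phi z - k.+1%:R * cauchy_int k.+1 phi z * (w - z) =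
  cmean (fun x => phi x * ((x - w)^-1 ^+ k.+1 - (x - z)^-1 ^+ k.+1
     - k.+1%:R * (w - z) * (x - z)^-1 ^+ k.+2)).
  rewrite mulrAC -cmeanZ; last exact: cbm_kernel.
  rewrite /cauchy_int -!cmeanB.
  - by apply: eq_cmean => x _; ring.
  - by apply: cbmD; [|apply: cbmN]; exact: cbm_kernel.
  - by apply: cbmM (cbm_kernel _ _ _) => //; exact: cbm_cst.
  - exact: cbm_kernel.
  - exact: cbm_kernel.
have cb : cbm (fun x => phi x * ((x - w)^-1 ^+ k.+1 - (x - z)^-1 ^+ k.+1
     - k.+1%:R * (w - z) * (x - z)^-1 ^+ k.+2)).
  apply: cbmM => //; apply: cbmD; first apply: cbmD; last first.
  - by apply/cbmN/cbmM/cbmX/cbm_inv => //; exact: cbm_cst.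
  - by apply/cbmN/cbmX/cbm_inv.
  - by apply/cbmX/cbm_inv.
apply: (@le_trans _ _ (M * (B * nrm (w - z) ^+ 2))).
  apply: nrm_cmean => // x x1; rewrite nrmM ler_pM ?hM //; apply: hB.
  - have := circle_subr_neq0 z1 x1; have := circle_subr_neq0 w1 x1 => ? ?.
    by field; apply/andP.
  - rewrite nrmV lef_pV2 ?posrE ?nrm_gt0 ?circle_subr_neq0 //.
    have := dist_circle z1 x1; have := nrm_triangle x w z; rewrite /d in wd *; lra.
  - rewrite nrmV lef_pV2 ?posrE ?nrm_gt0 ?circle_subr_neq0 //.
    have := dist_circle z1 x1; rewrite /d in d0 *; lra.
rewrite expr2 !mulrA; apply: ler_wpM2r => //.
rewrite ltr_pdivlMr // in we; apply: le_trans (ltW we).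
rewrite mulrC [M * B]mulrC; apply: ler_wpM2l => //; lra.
Qed.

Definition pk z x : R := (1 - nrm z ^+ 2) / nrm (x - z) ^+ 2.

Definition poisson b z : R := mean (fun x => b x * pk z x).

Lemma pk_ge0 z x : nrm z < 1 -> 0 <= pk z x.
Proof.
move=> z1; apply: divr_ge0; last by rewrite exprn_ge0.
by rewrite subr_ge0 expr_le1 // ltW.
Qed.

Lemma herglotz_cre z x : nrm z < 1 -> nrm x = 1 ->
  cre (2 * x * (x - z)^-1 - 1) = pk z x.
Proof.
move=> z1 x1; have n0 := circle_subr_neq0 z1 x1.
have n1 : nrm (x - z) ^+ 2 != 0 by rewrite expf_neq0 // nrm_eq0.
have -> : 2 * x * (x - z)^-1 - 1 = (x + z) * (x - z)^-1.
  by field.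
have -> : (x - z)^-1 = cj (x - z) * cofr (nrm (x - z) ^+ 2)^-1.
  by apply: (mulfI n0); rewrite mulfV // mulrA mul_cj -cofrM mulfV.
rewrite mulrA creM cim_cofr mulr0 subr0 cre_cofr /pk; congr (_ / _).
have := nrm_sqr x; rewrite x1 expr1n nrm_sqr => ->.
by rewrite !(reimE, cre_cj, cim_cj); ring.
Qed.

(** The expression in [herglotz_cre] is holomorphic in z; this one is holomorphic in x across the
    closed disc, which opens the kernel to the mean value property in x. *)
Lemma pk_cre_conj z x : nrm z < 1 -> nrm x = 1 ->
  pk z x = cre (2 * (1 - cj z * x)^-1 - 1).
Proof.
move=> z1 x1; rewrite -herglotz_cre //.
have n0 := circle_subr_neq0 z1 x1.
have x0 : x != 0 by rewrite -nrm_gt0 x1.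
have xx : x * cj x = 1 by rewrite mul_cj x1 expr1n.
have E : 1 - cj z * x = cj ((x - z) * x^-1).
  rewrite mulrBl mulfV // cjD cjN cj1 cjM cjV; congr (1 - _ * _).
  have cx0 : cj x != 0 by rewrite -nrm_gt0 nrm_cj x1.
  by apply: (mulIf cx0); rewrite mulVf.
have -> : 2 * (1 - cj z * x)^-1 - 1 = cj (2 * x * (x - z)^-1 - 1).
  rewrite E -cjV invfM invrK cjD cjN cj1 -!mulrA; congr (_ - _).
  rewrite cjM; congr (_ * _); last by rewrite mulrC.
  by rewrite -(cofr_nat R 2); apply: complex_ext; rewrite !(reimE, cre_cj, cim_cj) ?oppr0.
by rewrite cre_cj.
Qed.

Lemma bm_pk z : nrm z < 1 -> bm (pk z).
Proof.
move=> z1; apply: (@bm_eq _ (fun x => cre (2 * x * (x - z)^-1 - 1))).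
  by move=> x x1; rewrite herglotz_cre.
apply/bm_cre/cbmD; last exact: cbm_cst.
apply: cbmM (cbm_inv z1); apply: cbmM cbm_id; exact: cbm_cst.
Qed.

Lemma mean_pk z : nrm z < 1 -> mean (pk z) = 1.
Proof.
move=> z1; rewrite (@eq_mean _ _ (fun x => cre (2 * (1 - cj z * x)^-1 - 1))); last first.
  by move=> x x1; rewrite pk_cre_conj.
(* A radius above 1 and below 1 / |z|, where the pole of the kernel lies; this form also makes sense
   at z = 0. *)
pose rho := 2 / (1 + nrm z); have z0 := nrm_ge0 z.
have rho1 : 1 < rho by rewrite /rho ltr_pdivlMr; lra.
have dg (w : C) : nrm w < rho -> exists a, cder (fun x => 2 * (1 - cj z * x)^-1 - 1) w a.
  have zp : 0 < 1 + nrm z by lra.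
  rewrite /rho ltr_pdivlMr // => wr; eexists.
  apply: cderB (cder_cst _ _); apply: cderZ.
  apply: (@cder_comp R (fun w => w^-1) (fun w => 1 - cj z * w)).
    apply: cderV; rewrite subr_eq0; apply/negP => /eqP /(congr1 (@nrm R)).
    rewrite nrm1 nrmM nrm_cj => h; nra.
  exact: cderB (cder_cst _ _) (cderZ _ (cder_id _)).
have := mean_value1 rho1 dg => /(congr1 (@cre R)); rewrite cre_mk => ->.
by rewrite mulr0 subr0 invr1 mulr1 !reimE; ring.
Qed.

Lemma bm_poisson b z : bm b -> nrm z < 1 -> bm (fun x => b x * pk z x).
Proof. by move=> bb z1; apply: bmM => //; exact: bm_pk. Qed.

Lemma poisson_le b b' z : bm b -> bm b' -> nrm z < 1 ->
  (forall x, nrm x = 1 -> b x <= b' x) -> poisson b z <= poisson b' z.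
Proof.
move=> bb bb' z1 h; apply: mean_le; try exact: bm_poisson.
by move=> x x1; rewrite ler_wpM2r ?pk_ge0 // h.
Qed.

Lemma poisson_ge0 b z : nrm z < 1 -> (forall x, nrm x = 1 -> 0 <= b x) -> 0 <= poisson b z.
Proof. by move=> z1 b0; apply: mean_ge0 => x x1; rewrite mulr_ge0 ?b0 ?pk_ge0. Qed.

Lemma poissonD b b' z : bm b -> bm b' -> nrm z < 1 ->
  poisson (fun x => b x + b' x) z = poisson b z + poisson b' z.
Proof.
move=> bb bb' z1; rewrite /poisson -meanD; try exact: bm_poisson.
by apply: eq_mean => x _; rewrite mulrDl.
Qed.

Lemma poissonZ k b z : bm b -> nrm z < 1 ->
  poisson (fun x => k * b x) z = k * poisson b z.
Proof.
move=> bb z1; rewrite /poisson -meanZ; last exact: bm_poisson.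
by apply: eq_mean => x _; rewrite mulrA.
Qed.

Lemma poisson_cst k z : nrm z < 1 -> poisson (fun=> k) z = k.
Proof. by move=> z1; rewrite /poisson meanZ ?mean_pk ?mulr1 //; exact: bm_pk. Qed.

(** U need not be harmonic: it is compared with its Poisson integral only near the circle, at the
    same interior point w. Where |x - w| < d uniform continuity applies; elsewhere the kernel is at
    most (1 - |w|^2) / d^2. *)
Lemma poisson_boundary (U : C -> R) : cont_on [set z | nrm z <= 1] U ->
  forall e : R, 0 < e -> exists2 d : R, 0 < d &
    forall w, 1 - d < nrm w -> nrm w < 1 -> `|poisson U w - U w| <= e.
Proof.
move=> cU e e0; have cD := @compact_disc R 1.
have e2 : 0 < e / 2 by rewrite divr_gt0.
have [d d0 dP] := cont_on_unif cD cU e2.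
have [B B0 UB] := cont_on_bounded cD cU.
pose K := 2 * B / d ^+ 2; have K0 : 0 <= K by rewrite divr_ge0 ?mulr_ge0 ?exprn_ge0 // ltW.
exists (Num.min 1 (e / (4 * (K + 1)))).
  by rewrite lt_min ltr01 divr_gt0 // mulr_gt0 // ltr_wpDl.
have K1 : 0 < 4 * (K + 1) by rewrite mulr_gt0 // ltr_wpDl.
move=> w wd w1.
have {wd} wd : (1 - nrm w) * (4 * (K + 1)) < e.
  rewrite -ltr_pdivlMr // ltrBlDr -ltrBlDl; apply: le_lt_trans wd.
  by rewrite lerB // ge_min lexx orbT.
have bU : bm U by apply: cont_on_bm; apply: cont_on_subset cU => x /circleE /= ->.
have bUw : bm (fun x => U x - U w) by apply: bmB => //; exact: bm_cst.
rewrite -[U w in X in _ - X](poisson_cst (U w) w1).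
have -> : poisson U w - poisson (fun=> U w) w = mean (fun x => (U x - U w) * pk w x).
  rewrite /poisson -meanB; try exact: bm_poisson.
    by apply: eq_mean => x _; rewrite mulrBl.
  by apply: bm_poisson => //; exact: bm_cst.
have est x : nrm x = 1 -> `|(U x - U w) * pk w x| <= e / 2 * pk w x + K * (1 - nrm w ^+ 2).
  move=> x1; rewrite normrM [`|pk w x|]ger0_norm ?pk_ge0 //.
  have [xd|dx] := ltP (nrm (x - w)) d.
    apply: (@le_trans _ _ (e / 2 * pk w x)).
      by rewrite ler_wpM2r ?pk_ge0 // ltW // dP //= ?x1 // ltW.
    by rewrite lerDl mulr_ge0 // subr_ge0 expr_le1 // ltW.
  apply: (@le_trans _ _ (K * (1 - nrm w ^+ 2))); last first.
    by rewrite lerDr mulr_ge0 ?pk_ge0 // ltW.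
  have u2 : `|U x - U w| <= 2 * B.
    apply: le_trans (ler_normB _ _) _.
    by have := UB x _; have := UB w _; rewrite /= x1 (ltW w1) => /(_ isT) ? /(_ (lexx _)) ?; lra.
  apply: (@le_trans _ _ (2 * B * pk w x)); first by rewrite ler_wpM2r ?pk_ge0.
  rewrite /K /pk -!mulrA; apply: ler_wpM2l => //; apply: ler_wpM2l => //.
  rewrite mulrC; apply: ler_wpM2r; first by rewrite subr_ge0 expr_le1 // ltW.
  rewrite lef_pV2 ?posrE ?exprn_gt0 // ?lerXn2r ?nnegrE //; first exact: ltW.
  exact: lt_le_trans dx.
have b1 : bm (fun x => (U x - U w) * pk w x) by exact: bm_poisson.
have b2 : bm (fun x => e / 2 * pk w x + K * (1 - nrm w ^+ 2)).
  by apply: bmD; [apply/bmZ/bm_pk|exact: bm_cst].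
have m2 : mean (fun x => e / 2 * pk w x + K * (1 - nrm w ^+ 2)) = e / 2 + K * (1 - nrm w ^+ 2).
  rewrite meanD; [|by apply/bmZ/bm_pk|exact: bm_cst].
  by rewrite meanZ ?mean_pk ?mulr1 ?mean_cst //; exact: bm_pk.
have le1 : mean (fun x => (U x - U w) * pk w x) <= e / 2 + K * (1 - nrm w ^+ 2).
  by rewrite -m2; apply: mean_le => // x x1; apply: le_trans (ler_norm _) (est x x1).
have le2 : - mean (fun x => (U x - U w) * pk w x) <= e / 2 + K * (1 - nrm w ^+ 2).
  rewrite -mulN1r -meanZ // -m2; apply: mean_le => //; first exact: bmZ.
  by move=> x x1; rewrite mulN1r; apply: le_trans (ler_norm _) _; rewrite normrN est.
have fin : e / 2 + K * (1 - nrm w ^+ 2) <= e.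
  have w0 := nrm_ge0 w; have -> : 1 - nrm w ^+ 2 = (1 - nrm w) * (1 + nrm w) by ring.
  have : K * ((1 - nrm w) * (1 + nrm w)) <= K * ((1 - nrm w) * 2).
    by rewrite ler_wpM2l // ler_wpM2l //; lra.
  nra.
rewrite ler_norml; apply/andP; split; lra.
Qed.

End cauchy_integrals.

(** * Cauchy's formula, Taylor sums, and majorants of logarithms of moduli *)

Section cauchy_taylor.
Variable R : realType.
Local Notation C := (CC R).
Local Notation T := (unit_circle R).
Implicit Types (f g : C -> C) (z w x : C).

Lemma max_principle_disc (r B : R) f : 0 <= B ->
  (forall z, nrm z <= r -> exists a, cder f z a) ->
  (forall z, nrm z = r -> nrm (f z) <= B) ->
  forall z, nrm z <= r -> nrm (f z) <= B.
Proof.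
move=> B0 df fB z zr; apply: (max_principle (@compact_disc R r) df B0) => // w /= wr nw.
apply: fB; apply/eqP; rewrite eq_le wr /= leNgt; apply/negP => wr'; apply: nw.
exists (r - nrm w); first by rewrite subr_gt0.
by move=> x xw; have := nrm_sub_le x w => /= ?; lra.
Qed.

(** The Poisson kernel is the Cauchy kernel plus a function of x that is holomorphic across the
    closed disc and vanishes at 0. Against a holomorphic function the second term has mean 0, so the
    Cauchy and Poisson integrals coincide. *)
Lemma pkE z x : nrm z < 1 -> nrm x = 1 ->
  cofr (pk z x) = x * (x - z)^-1 + cj z * x * (1 - cj z * x)^-1.
Proof.
move=> z1 x1; have n0 := circle_subr_neq0 z1 x1.
have x0 : x != 0 by rewrite -nrm_gt0 x1.
have xx : x * cj x = 1 by rewrite mul_cj x1 expr1n.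
have cx : cj x = x^-1 by apply: (mulfI x0); rewrite xx mulfV.
have E : 1 - cj z * x = cj (x - z) * x.
  by rewrite cjD cjN cx mulrBl mulVf.
have n1 : 1 - cj z * x != 0.
  by rewrite E mulf_neq0 // -nrm_gt0 nrm_cj nrm_gt0.
rewrite /pk cofrM cofrV -mul_cj.
have -> : cj (x - z) = (1 - cj z * x) / x by rewrite E mulfK.
have -> : cofr (1 - nrm z ^+ 2) = 1 - z * cj z by rewrite mul_cj cofrD cofrN.
by field; rewrite x0 n0 n1.
Qed.

Lemma cder_conj_kernel z w : nrm (cj z * w) < 1 ->
  exists a, cder (fun x => (1 - cj z * x)^-1) w a.
Proof.
move=> zw; eexists; apply: (@cder_comp R (fun w => w^-1) (fun w => 1 - cj z * w)).
  apply: cderV; rewrite subr_eq0; apply/negP => /eqP /(congr1 (@nrm R)).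
  by rewrite nrm1 => h; move: zw; rewrite -h ltxx.
exact: cderB (cder_cst _ _) (cderZ _ (cder_id _)).
Qed.

Lemma cauchy_poisson g (rho : R) z : 1 < rho ->
  (forall w, nrm w < rho -> exists a, cder g w a) -> nrm z < 1 ->
  cauchy_int 0 (fun x => g x * x) z =
    cmk (poisson (fun x => cre (g x)) z) (poisson (fun x => cim (g x)) z).
Proof.
move=> rho1 dg z1; pose h x := g x * (cj z * x * (1 - cj z * x)^-1).
have z0 := nrm_ge0 z; have zp : 0 < 1 + nrm z by lra.
pose rho' := Num.min rho (2 / (1 + nrm z)).
have rho'1 : 1 < rho' by rewrite lt_min rho1 ltr_pdivlMr //; lra.
have dh w : nrm w < rho' -> exists a, cder h w a.
  rewrite lt_min ltr_pdivlMr // => /andP[/dg[a da] wz].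
  have [|b db] := @cder_conj_kernel z w; first by rewrite nrmM nrm_cj; nra.
  eexists; exact: cderM da (cderM (cderZ _ (cder_id w)) db).
have bh : cbm h.
  by apply: cder_cbm => x x1; apply: dh; rewrite x1.
have bg : cbm g.
  by apply: cder_cbm => x x1; apply: dg; rewrite x1.
have := mean_value1 rho'1 dh; rewrite {2}/h mulr0 mul0r mulr0 => h0.
have bk : cbm (fun x => g x * x * (x - z)^-1 ^+ 1).
  by apply/cbmM/cbmX/cbm_inv => //; apply/cbmM/cbm_id.
rewrite -[LHS]addr0 -h0 /cauchy_int -cmeanD //.
rewrite (@eq_cmean _ _ (fun x => g x * cofr (pk z x))).
  by congr cmk; apply: eq_mean => x _; rewrite !reimE; ring.
by move=> x x1; rewrite pkE // /h expr1; ring.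
Qed.

(** The difference between the Cauchy integral and g is holomorphic. As the Cauchy integral is a
    Poisson integral, the difference is small on circles close to the unit circle, hence inside them
    by the maximum principle. *)
Lemma cauchy_formula g (rho : R) z : 1 < rho ->
  (forall w, nrm w < rho -> exists a, cder g w a) -> nrm z < 1 ->
  cauchy_int 0 (fun x => g x * x) z = g z.
Proof.
move=> rho1 dg z1; apply/eqP; rewrite -subr_eq0 -nrm_eq0 eq_le nrm_ge0 andbT.
apply/ler_addgt0Pr => e e0; rewrite add0r.
have bg : cbm (fun x => g x * x).
  by apply/cbmM/cbm_id; apply: cder_cbm => x x1; apply: dg; rewrite x1.
have [c1 c2 _] := @cder_ex_cont _ [set z | nrm z <= 1] g
  (fun w (w1 : nrm w <= 1) => dg w (le_lt_trans w1 rho1)).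
have e2 : 0 < e / 2 by rewrite divr_gt0.
have [d1 d10 P1] := poisson_boundary c1 e2.
have [d2 d20 P2] := poisson_boundary c2 e2.
pose r := Num.max (nrm z) (1 - Num.min d1 d2 / 2).
have m0 : 0 < Num.min d1 d2 by rewrite lt_min d10.
have r1 : r < 1 by rewrite /r gt_max z1 /=; lra.
have rz : nrm z <= r by rewrite le_max lexx.
have rm : 1 - Num.min d1 d2 < r.
  by rewrite lt_max; apply/orP; right; lra.
have rd1 : 1 - d1 < r by apply: le_lt_trans rm; rewrite lerD2l lerN2 ge_min lexx.
have rd2 : 1 - d2 < r by apply: le_lt_trans rm; rewrite lerD2l lerN2 ge_min lexx orbT.
apply: (@max_principle_disc r e (fun w => cauchy_int 0 (fun x => g x * x) w - g w)) => //.
- exact: ltW.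
- move=> w wr; have w1 := le_lt_trans wr r1; have [a da] := dg w (lt_trans w1 rho1).
  eexists; exact: cderB (cder_cauchy 0 bg w1) da.
move=> w wr; have w1 : nrm w < 1 by rewrite wr.
rewrite (cauchy_poisson rho1 dg w1); apply: le_trans (nrm_le_reim _) _.
rewrite !reimE; have := P1 w; have := P2 w; rewrite wr => /(_ rd2 r1) ? /(_ rd1 r1) ?.
lra.
Qed.

Section taylor.
Variables (f : C -> C) (r : R).
Hypotheses (hf : holomorphic_on (unit_disc R) f) (r0 : 0 < r) (r1 : r < 1).

Let df w : nrm w < 1 -> exists a, cder f w a.
Proof. by move=> /discE /hf; exact: derivable_cder. Qed.

Let g x := f (cofr r * x).

Let dg w : nrm w < r^-1 -> exists a, cder g w a.
Proof.
move=> wr; have [|a da] := @df (cofr r * w).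
  by rewrite nrmM nrm_cofr gtr0_norm // mulrC -ltr_pdivlMr // mul1r.
exists (a * (cofr r * 1)).
exact: (@cder_comp R f (fun w => cofr r * w) _ _ _ da (cderZ _ (cder_id _))).
Qed.

Let cr0 : cofr r != 0 :> C.
Proof. by rewrite -nrm_gt0 nrm_cofr normr_gt0 gt_eqF. Qed.

Let rV1 : 1 < r^-1. Proof. by rewrite invf_gt1. Qed.

Let bgc : cbm g.
Proof. by apply: cder_cbm => x x1; apply: dg; rewrite x1. Qed.

Let bgx : cbm (fun x => g x * x).
Proof. by apply: cbmM => //; exact: cbm_id. Qed.

Let fE z : nrm z < r -> f z = cauchy_int 0 (fun x => g x * x) (z / cofr r).
Proof.
move=> zr; have zr1 : nrm (z / cofr r) < 1.
  by rewrite nrmM nrmV nrm_cofr gtr0_norm // ltr_pdivrMr // mul1r.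
by rewrite (cauchy_formula rV1 dg zr1) /g mulrC divfK.
Qed.

Lemma derive1n_cauchy j z : nrm z < r ->
  derive1n j f z = j`!%:R * (cofr r)^-1 ^+ j * cauchy_int j (fun x => g x * x) (z / cofr r).
Proof.
elim: j z => [|j ih] z zr; first by rewrite fact0 expr0 !mul1r -fE.
rewrite /derive1n iterS -/(derive1n j f); apply: cder_derive1.
have zr1 : nrm (z / cofr r) < 1.
  by rewrite nrmM nrmV nrm_cofr gtr0_norm // ltr_pdivrMr // mul1r.
apply: (@cder_eq _ (fun z => j`!%:R * (cofr r)^-1 ^+ j * cauchy_int j (fun x => g x * x) (z / cofr r))).
  exists (r - nrm z); first by rewrite subr_gt0.
  move=> w wz; rewrite ih //; have := nrm_sub_le w z; lra.
have dz : cder (fun w => w / cofr r) z ((cofr r)^-1).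
  have := cderZ (cofr r)^-1 (cder_id z); rewrite mulr1; apply: cder_eq.
  by exists 1 => // w _; rewrite mulrC.
have := cderZ (j`!%:R * (cofr r)^-1 ^+ j)
  (@cder_comp R (cauchy_int j (fun x => g x * x)) (fun w => w / cofr r) _ _ _ (cder_cauchy j bgx zr1) dz).
congr cder; rewrite factS natrM exprS; ring.
Qed.

Lemma taylor_coefE j : derive1n j f 0 / j`!%:R =
  (cofr r)^-1 ^+ j * cmean (fun x => g x * x^-1 ^+ j).
Proof.
rewrite derive1n_cauchy ?nrm0 // mul0r.
have jn : j`!%:R != 0 :> C by rewrite pnatr_eq0 -lt0n fact_gt0.
set c := cauchy_int _ _ _; set k := (cofr r)^-1 ^+ j.
have -> : j`!%:R * k * c / j`!%:R = k * c by field.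
congr (_ * _); apply: eq_cmean => x x1; have x0 : x != 0 by rewrite -nrm_gt0 x1.
by rewrite subr0 exprS mulrA -[g x * x * _]mulrA mulfV // mulr1.
Qed.

(** Taylor sum and f are both Cauchy integrals over the circle of radius r. With w = z / r, their
    kernels differ by the tail of a geometric series in w / x, of modulus at most |w|^(n + 1) / (1 -
    |w|). *)
Lemma taylor_bounds : exists2 M : R, 0 <= M &
  (forall j, nrm (derive1n j f 0 / j`!%:R) <= M / r ^+ j) /\
  (forall n z, nrm z < r -> nrm (taylor_sum f n z - f z) <=
      M * (nrm z / r) ^+ n.+1 / (1 - nrm z / r)).
Proof.
have [M M0 gM] := cbm_bound bgc; exists M => //.
have bj j : cbm (fun x => g x * x^-1 ^+ j).
  by apply/cbmM/cbmX => //; have := @cbm_inv R 0; rewrite nrm0 => /(_ ltr01);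
    apply: cbm_eq => x _; rewrite subr0.
split=> [j|n z zr].
  rewrite taylor_coefE nrmM nrmX nrmV nrm_cofr gtr0_norm // mulrC exprVn.
  rewrite ler_pM2r ?invr_gt0 ?exprn_gt0 //; apply: nrm_cmean => // x x1.
  by rewrite nrmM nrmX nrmV x1 invr1 expr1n mulr1 gM.
set w := z / cofr r; have wE : nrm w = nrm z / r by rewrite nrmM nrmV nrm_cofr gtr0_norm.
have w1 : nrm w < 1 by rewrite wE ltr_pdivrMr // mul1r.
have [sE sb] := @cmean_sum R n.+1 (fun j x => w ^+ j * (g x * x^-1 ^+ j))
  (fun j => cbmM (cbm_cst _) (bj j)).
have -> : taylor_sum f n z = cmean (fun x => \sum_(j < n.+1) w ^+ j * (g x * x^-1 ^+ j)).
  rewrite sE; apply: eq_bigr => j _; rewrite taylor_coefE cmeanZ // /w exprMn.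
  by set k := (cofr r)^-1 ^+ j; set c := cmean _; ring.
rewrite fE // -/w /cauchy_int -cmeanB //; last by apply: cbm_kernel.
clearbody w; rewrite -wE; apply: nrm_cmean.
  by apply: cbmD => //; apply/cbmN/cbm_kernel.
move=> x x1; have x0 : x != 0 by rewrite -nrm_gt0 x1.
have xw := circle_subr_neq0 w1 x1.
have -> : \sum_(j < n.+1) w ^+ j * (g x * x^-1 ^+ j) =
   g x * (1 - (w / x) ^+ n.+1) * (x * (x - w)^-1).
  have -> : \sum_(j < n.+1) w ^+ j * (g x * x^-1 ^+ j) = g x * \sum_(j < n.+1) (w / x) ^+ j.
    by rewrite big_distrr /=; apply: eq_bigr => j _; rewrite [(w / x) ^+ j]exprMn mulrCA.
  have -> : 1 - (w / x) ^+ n.+1 = (x - w) / x * \sum_(j < n.+1) (w / x) ^+ j.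
    have -> : (x - w) / x = - (w / x - 1) by field.
    by rewrite mulNr -subrX1 opprB.
  by field; rewrite xw x0.
rewrite expr1.
have -> : g x * (1 - (w / x) ^+ n.+1) * (x * (x - w)^-1) - g x * x * (x - w)^-1 =
  - (g x * (w / x) ^+ n.+1 * (x * (x - w)^-1)) by ring.
rewrite nrmN !nrmM nrmX !nrmM !nrmV x1 invr1 mulr1 mul1r.
apply: ler_pM; rewrite ?invr_ge0 ?mulr_ge0 ?exprn_ge0 //.
  by rewrite ler_wpM2r ?exprn_ge0 // gM.
by rewrite lef_pV2 ?posrE ?nrm_gt0 ?subr_gt0 // dist_circle.
Qed.

End taylor.

Lemma herglotz b : bm b -> exists H : C -> C, forall z, nrm z < 1 ->
  cre (H z) = poisson b z /\ exists a, cder H z a.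
Proof.
move=> bb; have cb : cbm (fun x => cofr (b x) * (2 * x)).
  by apply: cbmM; [exact: cbm_cofr|apply: cbmM; [exact: cbm_cst|exact: cbm_id]].
exists (fun z => cauchy_int 0 (fun x => cofr (b x) * (2 * x)) z - cmean (fun x => cofr (b x))) => z z1.
split; last by eexists; exact: cderB (cder_cauchy 0 cb z1) (cder_cst _ _).
rewrite /cauchy_int -cmeanB; [|exact: cbm_kernel|exact: cbm_cofr].
rewrite cre_mk; apply: eq_mean => x x1; rewrite -herglotz_cre //.
by rewrite !reimE ?expr1; ring.
Qed.

Lemma le_expR_eps (a b : R) : 0 < b -> (forall e : R, 0 < e -> a <= expR e * b) -> a <= b.
Proof.
move=> b0 h; rewrite leNgt; apply/negP => ba.
have a0 : 0 < a by exact: lt_trans ba.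
have q1 : 1 < a / b by rewrite ltr_pdivlMr // mul1r.
have := h (ln (a / b) / 2) _; rewrite divr_gt0 ?ln_gt0 // => /(_ isT).
rewrite -ler_pdivrMr // -{1}[a / b]lnK ?posrE ?divr_gt0 // ler_expR.
by have := ln_gt0 q1; lra.
Qed.

(** The truncation at c makes the logarithm continuous in spite of the zeros of p. If Re H is the
    Poisson integral of the truncated logarithm, p exp (- H) has modulus at most exp e near the
    circle, and the maximum principle brings this bound inside. *)
Lemma poisson_majorant (p : C -> C) (rho c : R) z : 1 < rho -> 0 < c ->
  (forall w, nrm w < rho -> exists a, cder p w a) -> nrm z < 1 ->
  nrm (p z) <= expR (poisson (fun x => ln (Num.max (nrm (p x)) c)) z).
Proof.
move=> rho1 c0 dp z1; pose u w := ln (Num.max (nrm (p w)) c).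
have mc w : 0 < Num.max (nrm (p w)) c by rewrite lt_max c0 orbT.
have [_ _ cp] := @cder_ex_cont _ [set z | nrm z <= 1] p
  (fun w (w1 : nrm w <= 1) => dp w (le_lt_trans w1 rho1)).
have cu : cont_on [set z | nrm z <= 1] u.
  have cm := cont_on_max c cp.
  by apply: (@cont_on_comp _ _ _ (@ln R) _ cm) => w _; apply: continuous_ln.
have bu : bm u by apply: cont_on_bm; apply: cont_on_subset cu => x /circleE /= ->.
have [H HP] := herglotz bu.
apply: le_expR_eps => [|e e0]; first exact: expR_gt0.
have [d d0 dP] := poisson_boundary cu e0.
pose r := Num.max (nrm z) (1 - d / 2).
have r1 : r < 1 by rewrite /r gt_max z1 /=; lra.
have rz : nrm z <= r by rewrite le_max lexx.
have rd : 1 - d < r by rewrite lt_max; apply/orP; right; lra.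
have nE w : nrm w < 1 -> nrm (p w * cexp (- H w)) = nrm (p w) / expR (poisson u w).
  by move=> w1; rewrite nrmM nrm_cexp creN expRN (HP w w1).1.
have : nrm (p z * cexp (- H z)) <= expR e.
  apply: (@max_principle_disc r _ (fun w => p w * cexp (- H w))) => //.
  - move=> w wr; have w1 := le_lt_trans wr r1; have [a da] := dp w (lt_trans w1 rho1).
    have [_ [b db]] := HP w w1; eexists.
    exact: cderM da (@cder_comp R (@cexp R) (fun w => - H w) w _ _ (cder_cexp _) (cderN db)).
  move=> w wr; have w1 : nrm w < 1 by rewrite wr.
  rewrite nE // ler_pdivrMr ?expR_gt0 // -expRD.
  have := dP w; rewrite wr => /(_ rd r1); rewrite ler_norml => /andP[h _].
  apply: (@le_trans _ _ (expR (u w))); last by rewrite ler_expR; lra.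
  by rewrite /u lnK ?posrE // le_max lexx.
by rewrite nE // ler_pdivrMr ?expR_gt0.
Qed.

(** The extremal case is z = - x, where the two moduli are 2 and 1 + r. The difference of the
    squares is 1 - r times an expression that is affine in Re (conj x * z) and is nonnegative down
    to - |z|. *)
Lemma factor_out (r : R) z x : 0 <= r < 1 -> nrm x = 1 -> 1 <= nrm z ->
  nrm (x - z) <= 2 / (1 + r) * nrm (cofr r * x - z).
Proof.
move=> /andP[r0 r1] x1 z1; have rp : 0 < 1 + r by lra.
rewrite mulrAC ler_pdivlMr // -(@ler_pXn2r _ 2) ?nnegrE ?mulr_ge0 // ?(ltW rp) //.
rewrite !exprMn !nrm_sqr !reimE.
have := nrm_sqr x; rewrite x1 expr1n; have := nrm_sqr z.
have := cre_le (cj x * z); rewrite nrmM nrm_cj x1 mul1r cre_mul_cj ler_norml => /andP[s0 _].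
set m := nrm z in z1 s0 *.
set a := cre x in s0 *; set b := cim x in s0 *; set c := cre z in s0 *; set d := cim z in s0 *.
move=> mE E1.
have -> : ((a - c) ^+ 2 + (b - d) ^+ 2) = 1 - 2 * (a * c + b * d) + m ^+ 2.
  by rewrite mE; lra.
have -> : ((r * a - 0 * b - c) ^+ 2 + (r * b + 0 * a - d) ^+ 2) =
  r ^+ 2 - 2 * r * (a * c + b * d) + m ^+ 2.
  by have r2 : r ^+ 2 = r ^+ 2 * (a ^+ 2 + b ^+ 2) by [rewrite -E1 mulr1]; rewrite mE; lra.
set s := a * c + b * d in s0 *; rewrite -subr_ge0.
have -> : 2 ^+ 2 * (r ^+ 2 - 2 * r * s + m ^+ 2) - (1 - 2 * s + m ^+ 2) * (1 + r) ^+ 2 =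
  (1 - r) * (m ^+ 2 * (3 + r) - (1 + 3 * r) + 2 * s * (1 - r)) by ring.
apply: mulr_ge0; first lra.
have : 0 <= (1 - r) * (s + m) by rewrite mulr_ge0 //; lra.
have : 0 <= m * (m - 1) * (1 - r) by rewrite !mulr_ge0 //; lra.
have : 0 <= (m ^+ 2 - 1) * (1 + 3 * r) by rewrite mulr_ge0 // ?subr_ge0 ?expr_ge1 //; lra.
nra.
Qed.

(** The reflected factor replaces x - z when z is in the disc; the extremal case is again conj z * x
    = -1. *)
Lemma factor_in (r : R) z x : 0 <= r < 1 -> nrm x = 1 -> nrm z <= 1 ->
  nrm (1 - cj z * x) <= 2 / (1 + r) * nrm (1 - cj z * (cofr r * x)).
Proof.
move=> /andP[r0 r1] x1 z1; have rp : 0 < 1 + r by lra.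
have -> : cj z * (cofr r * x) = cofr r * (cj z * x) by ring.
have : nrm (cj z * x) <= 1 by rewrite nrmM nrm_cj x1 mulr1.
move: (cj z * x) => w w1.
rewrite mulrAC ler_pdivlMr // -(@ler_pXn2r _ 2) ?nnegrE ?mulr_ge0 // ?(ltW rp) //.
rewrite !exprMn !nrm_sqr !reimE.
have := nrm_sqr w; have := cre_le w; rewrite ler_norml => /andP[s0 _].
have m0 := nrm_ge0 w.
set m := nrm w in w1 s0 m0 *; set a := cre w in s0 *; set b := cim w in s0 *.
move=> mE.
have -> : ((1 - a) ^+ 2 + (0 - b) ^+ 2) = 1 - 2 * a + m ^+ 2.
  by rewrite mE; ring.
have -> : ((1 - (r * a - 0 * b)) ^+ 2 + (0 - (r * b + 0 * a)) ^+ 2) =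
  1 - 2 * r * a + r ^+ 2 * m ^+ 2.
  by rewrite mE; ring.
rewrite -subr_ge0.
have -> : 2 ^+ 2 * (1 - 2 * r * a + r ^+ 2 * m ^+ 2) - (1 - 2 * a + m ^+ 2) * (1 + r) ^+ 2 =
  (1 - r) * ((3 + r) - m ^+ 2 * (1 + 3 * r) + 2 * a * (1 - r)) by ring.
apply: mulr_ge0; first lra.
have : 0 <= (1 - r) * (a + m) by rewrite mulr_ge0 //; lra.
have : 0 <= (1 - m) * (1 - r) by rewrite !mulr_ge0 //; lra.
have : 0 <= (1 - m ^+ 2) * (1 + 3 * r) by rewrite mulr_ge0 // ?subr_ge0 ?expr_le1 //; lra.
nra.
Qed.

(** For a polynomial with zeros in the disc, p (r x) may vanish while p x is large. Replacing x - z
    by 1 - conj z * x for such zeros keeps the modulus on the circle and removes these zeros; each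
    linear factor then costs at most 2 / (1 + r). *)
Lemma reflected_poly (p : {poly C}) (n : nat) : (size p <= n.+1)%N ->
  exists q : C -> C, [/\ forall w, exists a, cder q w a,
    forall x, nrm x = 1 -> nrm (q x) = nrm p.[x] &
    forall (r : R) x, 0 <= r < 1 -> nrm x = 1 ->
      nrm (q x) <= (2 / (1 + r)) ^+ n * nrm (q (cofr r * x))].
Proof.
have [s ->] := closed_field_poly_normal p.
have [->|l0] := eqVneq (lead_coef p) 0.
  exists (fun=> 0); split=> [w|x _|r x _ _]; first by exists 0; exact: cder_cst.
    by rewrite scale0r horner0.
  by rewrite nrm0 mulr0.
rewrite size_scale // size_prod_XsubC ltnS; set l := lead_coef p => sn.
have [q [dq q1 q2]] : exists q : C -> C, [/\ forall w, exists a, cder q w a,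
    forall x, nrm x = 1 -> nrm (q x) = nrm (l *: \prod_(z <- s) ('X - z%:P)).[x] &
    forall (r : R) x, 0 <= r < 1 -> nrm x = 1 ->
      nrm (q x) <= (2 / (1 + r)) ^+ size s * nrm (q (cofr r * x))].
  elim: s {sn} => [|z s [q [dq q1 q2]]].
    exists (fun=> l); split=> [w|x _|r x _ _]; first by exists 0; exact: cder_cst.
      by rewrite big_nil hornerZ hornerC mulr1.
    by rewrite expr0 mul1r.
  have E x : (l *: \prod_(j <- z :: s) ('X - j%:P)).[x] =
     (x - z) * (l *: \prod_(j <- s) ('X - j%:P)).[x].
    by rewrite big_cons !hornerZ hornerM hornerXsubC mulrCA.
  have step (k : C -> C) : (forall w, exists a, cder k w a) ->
      (forall x, nrm x = 1 -> nrm (k x) = nrm (x - z)) ->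
      (forall (r : R) x, 0 <= r < 1 -> nrm x = 1 ->
        nrm (k x) <= 2 / (1 + r) * nrm (k (cofr r * x))) ->
      exists q : C -> C, [/\ forall w, exists a, cder q w a,
        forall x, nrm x = 1 -> nrm (q x) = nrm (l *: \prod_(z <- z :: s) ('X - z%:P)).[x] &
        forall (r : R) x, 0 <= r < 1 -> nrm x = 1 ->
        nrm (q x) <= (2 / (1 + r)) ^+ size (z :: s) * nrm (q (cofr r * x))].
    move=> dk k1 k2; exists (fun x => k x * q x); split.
    - by move=> w; have [a da] := dk w; have [b db] := dq w; eexists; exact: cderM da db.
    - by move=> x x1; rewrite E !nrmM k1 // q1.
    - move=> r x r01 x1; rewrite !nrmM exprS mulrACA; apply: ler_pM => //; [exact: k2|exact: q2].
  have [z1|z1] := ltP (nrm z) 1.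
    apply: (step (fun x => 1 - cj z * x)).
    - by move=> w; eexists; exact: cderB (cder_cst _ _) (cderZ _ (cder_id _)).
    - move=> x x1; have xx : x * cj x = 1 by rewrite mul_cj x1 expr1n.
      have -> : 1 - cj z * x = x * cj (x - z) by rewrite cjD cjN mulrBr xx [x * _]mulrC.
      by rewrite nrmM x1 mul1r nrm_cj.
    - by move=> r x r01 x1; apply: factor_in => //; exact: ltW.
  apply: (step (fun x => x - z)) => //.
  - by move=> w; eexists; exact: cderB (cder_id _) (cder_cst _ _).
  - by move=> r x r01 x1; exact: factor_out.
exists q; split=> // r x r01 x1; apply: le_trans (q2 r x r01 x1) _.
apply: ler_wpM2r => //; apply: ler_weXn2l => //; case/andP: r01 => ? ?.
by rewrite ler_pdivlMr; lra.
Qed.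

Lemma poly_radial_majorant (p : {poly C}) (n : nat) (r c : R) x :
  (size p <= n.+1)%N -> 0 <= r < 1 -> 0 < c -> nrm x = 1 ->
  nrm p.[x] <= (2 / (1 + r)) ^+ n *
    expR (poisson (fun y => ln (Num.max (nrm p.[y]) c)) (cofr r * x)).
Proof.
move=> /reflected_poly[q [dq q1 q2]] r01 c0 x1.
have /andP[r0 r1] := r01; have n2 : 1 < (2 : R) by lra.
have rx : nrm (cofr r * x) < 1 by rewrite nrmM nrm_cofr x1 mulr1 ger0_norm.
rewrite -q1 //; apply: le_trans (q2 r x r01 x1) _; apply: ler_wpM2l.
  by rewrite exprn_ge0 // divr_ge0 //; lra.
apply: le_trans (poisson_majorant n2 c0 (fun w _ => dq w) rx) _.
rewrite ler_expR le_eqVlt; apply/orP; left; apply/eqP; apply: eq_mean => y y1.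
by rewrite q1.
Qed.

End cauchy_taylor.

(** * Symmetry of the Poisson kernel on the circle *)

Section arc_length_integrals.
Variable R : realType.
Local Notation C := (CC R).
Local Notation T := (unit_circle R : set (borelCC R)).
Local Notation sigma := (@arc_length R).
Implicit Types (b F G : C -> R).

Let arc_length_fin : fin_num_fun sigma.
Proof.
move=> A mA; rewrite ge0_fin_numE ?measure_ge0 //.
apply: (@le_lt_trans _ _ (sigma setT)); first by apply: le_measure; rewrite ?inE.
by rewrite (@arc_length_full R setT) ?ltry.
Qed.

HB.instance Definition _ := @Measure_isFinite.Build _ _ R sigma arc_length_fin.

Lemma integral_mean F : bm F -> (\int[sigma]_(x in T) (F x)%:E)%E = (pi *+ 2 * mean F)%:E.
Proof.
move=> bF; have iF := bm_integrable bF.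
have -> : pi *+ 2 * mean F = \int[sigma]_(x in T) F x.
  by rewrite /mean mulrC divfK // lt0r_neq0 // pi2_gt0.
apply/esym/fineK; exact: (integrable_fin_num _ iF).
Qed.

Lemma bm_poisson_radial b (r : R) : bm b -> 0 <= r < 1 ->
  cont_on (unit_circle R) (fun x => poisson b (cofr r * x)).
Proof.
move=> bb /andP[r0 r1]; have [H HP] := herglotz bb.
have rx (x : C) : nrm x = 1 -> nrm (cofr r * x) < 1.
  by move=> x1; rewrite nrmM nrm_cofr x1 mulr1 ger0_norm.
have [|c1 _ _] := @cder_ex_cont _ (unit_circle R) (fun x => H (cofr r * x)).
  move=> x /circleE x1; have [_ [a da]] := HP _ (rx x x1); exists (a * (cofr r * 1)).
  exact: (@cder_comp R H (fun x => cofr r * x) x a _ da (cderZ _ (cder_id x))).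
move=> x Tx e e0; have [d d0 dP] := c1 x Tx e e0; exists d => // y Ty yx.
have := dP y Ty yx; rewrite !(HP _ _).1 //; apply: rx; exact/circleE.
Qed.

Lemma measurable_cre : measurable_fun setT (fun x : borelCC R => cre x).
Proof.
apply: (@cont_on_measurable R setT) => // x _ e e0; exists e => // y _ yx.
by apply: le_lt_trans yx; rewrite -creN -creD; exact: cre_le.
Qed.

Lemma measurable_cim : measurable_fun setT (fun x : borelCC R => cim x).
Proof.
apply: (@cont_on_measurable R setT) => // x _ e e0; exists e => // y _ yx.
by apply: le_lt_trans yx; rewrite -cimN -cimD; exact: cim_le.
Qed.

Lemma measurable_inv_dist (r : R) :
  measurable_fun setT (fun p : borelCC R * borelCC R =>
    (nrm ((p.2 : C) - cofr r * (p.1 : C)) ^+ 2)^-1).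
Proof.
pose q (p : borelCC R * borelCC R) : R :=
  (cre p.2 - r * cre p.1) ^+ 2 + (cim p.2 - r * cim p.1) ^+ 2.
have -> : (fun p : borelCC R * borelCC R => (nrm ((p.2 : C) - cofr r * (p.1 : C)) ^+ 2)^-1) =
   (fun p => q p `^ (-1)).
  apply/funext => p; rewrite powR_inv1 /q ?addr_ge0 ?sqr_ge0 // nrm_sqr !reimE.
  by congr (_ ^-1); ring.
have mc1 : measurable_fun setT (fun p : borelCC R * borelCC R => cre p.1).
  by apply: measurableT_comp measurable_cre _; exact: measurable_fst.
have mc2 : measurable_fun setT (fun p : borelCC R * borelCC R => cre p.2).
  by apply: measurableT_comp measurable_cre _; exact: measurable_snd.
have mi1 : measurable_fun setT (fun p : borelCC R * borelCC R => cim p.1).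
  by apply: measurableT_comp measurable_cim _; exact: measurable_fst.
have mi2 : measurable_fun setT (fun p : borelCC R * borelCC R => cim p.2).
  by apply: measurableT_comp measurable_cim _; exact: measurable_snd.
have mq : measurable_fun setT q.
  apply: measurable_funD; apply: measurable_funX; apply: measurable_funB => //;
    apply: measurable_funM => //; exact: measurable_cst.
exact: measurableT_comp (@measurable_powR R (-1)) mq.
Qed.

Lemma dist_sym (r : R) (x y : C) : nrm x = 1 -> nrm y = 1 ->
  nrm (y - cofr r * x) ^+ 2 = nrm (x - cofr r * y) ^+ 2.
Proof.
move=> x1 y1; rewrite !nrm_sqr !reimE.
by have := nrm_sqr x; have := nrm_sqr y; rewrite x1 y1; nra.
Qed.

Lemma pk_radial (r : R) (x y : C) : 0 <= r -> nrm x = 1 ->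
  pk (cofr r * x) y = (1 - r ^+ 2) * (nrm (y - cofr r * x) ^+ 2)^-1.
Proof. by move=> r0 x1; rewrite /pk nrmM nrm_cofr x1 mulr1 ger0_norm. Qed.

Lemma EFin_mulfI (a x y : R) : a != 0 -> (a * x)%:E = (a * y)%:E -> x = y.
Proof. by move=> a0 [] /(mulfI a0). Qed.

Lemma pi2_sqr_neq0 : (pi *+ 2 : R) ^+ 2 != 0.
Proof. by rewrite expf_neq0 // lt0r_neq0 // pi2_gt0. Qed.

(** For x and y on the circle |y - r x| = |x - r y|, so the kernel is symmetric and Tonelli's
    theorem exchanges the roles of b and b'. *)
Lemma poisson_sym b b' (r : R) : bm b -> bm b' -> 0 <= r < 1 ->
  (forall x, nrm x = 1 -> 0 <= b x) -> (forall x, nrm x = 1 -> 0 <= b' x) ->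
  mean (fun x => b' x * poisson b (cofr r * x)) = mean (fun x => b x * poisson b' (cofr r * x)).
Proof.
move=> bb bb' r01 b0 b'0; have /andP[r0 r1] := r01.
pose k (x y : C) : R := (nrm (y - cofr r * x) ^+ 2)^-1.
have r2 : 0 <= 1 - r ^+ 2 by rewrite subr_ge0 expr_le1 // ltW.
have rx (x : C) : nrm x = 1 -> nrm (cofr r * x) < 1.
  by move=> x1; rewrite nrmM nrm_cofr x1 mulr1 ger0_norm.
(* Extending both functions by 0 gives a nonnegative measurable integrand on the whole product
   space. *)
pose Phi (p : borelCC R * borelCC R) : \bar R :=
  (((b' \_ T) p.1 * (b \_ T) p.2) * ((1 - r ^+ 2) * k p.1 p.2))%:E.
have [mb _] := bb; have [mb' _] := bb'.
have mPhi : measurable_fun setT Phi.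
  apply/measurable_EFinP; apply: measurable_funM.
    apply: measurable_funM.
      by apply: measurableT_comp (@measurable_fst _ _ _ _); apply/(measurable_restrictT _ _).1.
    by apply: measurableT_comp (@measurable_snd _ _ _ _); apply/(measurable_restrictT _ _).1.
  by apply: measurable_funM; [exact: measurable_cst|exact: measurable_inv_dist].
have pos (g : C -> R) (x : C) : (forall x, nrm x = 1 -> 0 <= g x) -> 0 <= (g \_ T) x.
  move=> g0; rewrite patchE; case: ifP => // /set_mem /circleE; exact: g0.
have Phi0 p : (0 <= Phi p)%E.
  rewrite lee_fin; apply: mulr_ge0; first by apply: mulr_ge0; exact: pos.
  by apply: mulr_ge0 => //; rewrite invr_ge0 exprn_ge0.
have key (g g' : C -> R) : bm g -> bm g' ->
    (\int[sigma]_x \int[sigma]_y ((g' \_ T) x * (g \_ T) y * ((1 - r ^+ 2) * k x y))%:E)%E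
    = ((pi *+ 2) ^+ 2 * mean (fun x => g' x * poisson g (cofr r * x)))%:E.
  move=> bg bg'.
  have bgr : bm (fun x => g' x * poisson g (cofr r * x)).
    by apply: bmM => //; apply: cont_on_bm; exact: bm_poisson_radial.
  rewrite expr2 -mulrA -meanZ // -integral_mean; last exact: bmZ.
  rewrite [RHS]integral_mkcond; apply: eq_integral => x _.
  rewrite [RHS]patchE; case: ifP => xT; last first.
    rewrite -[RHS](integral0 sigma setT); apply: eq_integral => y _.
    by rewrite patchE xT !mul0r.
  have /circleE x1 := set_mem xT.
  have bp : bm (fun y => g' x * (g y * pk (cofr r * x) y)).
    by apply: bmZ; apply: bm_poisson => //; exact: rx.
  rewrite -meanZ; last by apply: bm_poisson => //; exact: rx.
  rewrite -integral_mean // [RHS]integral_mkcond; apply: eq_integral => y _.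
  rewrite !patchE xT; case: ifP => yT; last by rewrite mulr0 mul0r.
  by rewrite pk_radial // mulrA.
have tonelli := @fubini_tonelli _ _ _ _ R sigma sigma Phi mPhi Phi0.
have swap : (\int[sigma]_y \int[sigma]_x Phi (x, y))%E =
    (\int[sigma]_y \int[sigma]_x ((b \_ T) y * (b' \_ T) x * ((1 - r ^+ 2) * k y x))%:E)%E.
  apply: eq_integral => y _; apply: eq_integral => x _; congr (_%:E).
  rewrite /= [(b' \_ T) x * _]mulrC.
  have [xT|xT] := boolP (x \in T); last by rewrite [(b' \_ T) x]patchE (negbTE xT) mulr0 !mul0r.
  have [yT|yT] := boolP (y \in T); last by rewrite [(b \_ T) y]patchE (negbTE yT) !mul0r.
  have /circleE x1 := set_mem xT; have /circleE y1 := set_mem yT.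
  have kxy : k x y = k y x by rewrite /k (dist_sym r x1 y1).
  by rewrite kxy.
have E := etrans (esym (key _ _ bb bb')) (etrans tonelli (etrans swap (key _ _ bb' bb))).
exact: EFin_mulfI pi2_sqr_neq0 E.
Qed.

End arc_length_integrals.

(** * Poisson integrals of order 1 - r at almost every point of a set *)

Section almost_everywhere_estimates.
Variable R : realType.
Local Notation C := (CC R).
Local Notation T := (unit_circle R : set (borelCC R)).
Local Notation sigma := (@arc_length R).
Implicit Types (b F G : C -> R).

Lemma radial_lt1 (r : R) (x : C) : 0 <= r < 1 -> nrm x = 1 -> nrm (cofr r * x) < 1.
Proof. by move=> /andP[r0 r1] x1; rewrite nrmM nrm_cofr x1 mulr1 ger0_norm. Qed.

Lemma nrm_radial_sub (r : R) (x : C) : r <= 1 -> nrm x = 1 -> nrm (x - cofr r * x) = 1 - r.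
Proof.
move=> r1 x1; have -> : x - cofr r * x = cofr (1 - r) * x.
  by rewrite cofrD cofrN cofr1 mulrBl mul1r.
by rewrite nrmM nrm_cofr x1 mulr1 ger0_norm ?subr_ge0.
Qed.

(** The shift along the radius is r' - r <= 1 - r, and 1 - r is at most the distance from y to r
    x. *)
Lemma radial_dist (r r' : R) (x y : C) : 0 <= r -> r <= r' -> r' <= 1 -> nrm x = 1 -> nrm y = 1 ->
  nrm (y - cofr r' * x) <= 2 * nrm (y - cofr r * x).
Proof.
move=> r0 rr r1 x1 y1; apply: le_trans (nrm_triangle _ (cofr r * x) _) _.
have : nrm (cofr r * x - cofr r' * x) = r' - r.
  by rewrite -mulrBl nrmM x1 mulr1 -cofrN -cofrD nrm_cofr ler0_norm ?opprB // subr_le0.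
have := nrm_sub_le y (cofr r * x); rewrite y1 nrmM nrm_cofr x1 mulr1 ger0_norm // => h ->.
lra.
Qed.

Lemma inv_sq_le (p q : R) : 0 < p -> 0 < q -> q <= 2 * p -> (p ^+ 2)^-1 <= 4 * (q ^+ 2)^-1.
Proof.
move=> p0 q0 qp; rewrite -[leLHS]mul1r ler_pdivrMr ?exprn_gt0 // mulrAC.
rewrite ler_pdivlMr ?exprn_gt0 // mul1r.
have -> : 4 * p ^+ 2 = (2 * p) ^+ 2 by ring.
by rewrite ler_pXn2r // nnegrE; lra.
Qed.

(** At r x in place of x this is the Poisson integrand divided by 1 - r^2; at x itself it is the
    limit as r tends to 1. The value at y = x is 0, the inverse of 0 being 0. *)
Definition sing b (x y : C) : R := b y * (nrm (y - x) ^+ 2)^-1.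

Lemma sing_radial_le b (r r' : R) (x y : C) : 0 <= r -> r <= r' -> r' <= 1 ->
  nrm x = 1 -> nrm y = 1 -> 0 <= b y -> (r' = 1 -> x = y -> b y = 0) ->
  sing b (cofr r * x) y <= 4 * sing b (cofr r' * x) y.
Proof.
move=> r0 rr r1 x1 y1 b0 bx; rewrite /sing.
have [yE|yN] := eqVneq (y - cofr r' * x) 0.
  have yx : y = cofr r' * x by apply/eqP; rewrite -subr_eq0 yE.
  have r'1 : r' = 1.
    by move: y1; rewrite yx nrmM nrm_cofr x1 mulr1 ger0_norm //; exact: le_trans rr.
  by rewrite bx // ?mul0r ?mulr0 // yx r'1 mul1r.
have d0 : 0 < nrm (y - cofr r' * x) by rewrite nrm_gt0.
have h := radial_dist r0 rr r1 x1 y1.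
have d1 : 0 < nrm (y - cofr r * x) by lra.
rewrite mulrCA; apply: ler_wpM2l => //.
exact: inv_sq_le d1 d0 h.
Qed.

Lemma measurable_sing b (x : C) : measurable_fun T (b : borelCC R -> R) ->
  measurable_fun T (sing b x : borelCC R -> R).
Proof.
move=> mb; apply: measurable_funM => //; apply: measurable_funTS.
have mp : measurable_fun setT (fun y : borelCC R => ((x : borelCC R), y)).
  by apply: measurable_fun_pair; [exact: measurable_cst|exact: measurable_id].
have := measurableT_comp (@measurable_inv_dist R 1) mp.
by congr measurable_fun; apply/funext => y /=; rewrite mul1r.
Qed.

Lemma poisson_sing b (r : R) (x : C) : bm b -> 0 <= r < 1 -> nrm x = 1 ->
  poisson b (cofr r * x) = (1 - r ^+ 2) * mean (sing b (cofr r * x)) /\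
  bm (sing b (cofr r * x)).
Proof.
move=> bb r01 x1; have rx := radial_lt1 r01 x1; have /andP[r0 r1] := r01.
have p0 : 0 < 1 - r ^+ 2 by rewrite subr_gt0 expr_lt1.
have bs : bm (sing b (cofr r * x)).
  apply: (@bm_eq R (fun y => (1 - r ^+ 2)^-1 * (b y * pk (cofr r * x) y))).
    by move=> y y1; rewrite pk_radial // mulrCA mulKf // lt0r_neq0.
  by apply/bmZ/bm_poisson.
split=> //; rewrite -meanZ //; apply: eq_mean => y y1.
by rewrite pk_radial // /sing mulrCA.
Qed.

Lemma limn_einf_le (u : (\bar R)^nat) (c : \bar R) : (forall n, u n <= c)%E -> (limn_einf u <= c)%E.
Proof.
move=> uc; rewrite limn_einf_lim; apply: lime_le; first exact: is_cvg_einfs.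
apply: nearW => n; apply: le_trans (uc n); apply: ereal_inf_lbound.
by exists n => //=.
Qed.

Lemma limn_einf_ge (u : (\bar R)^nat) (c : \bar R) (n0 : nat) :
  (forall n, (n0 <= n)%N -> c <= u n)%E -> (c <= limn_einf u)%E.
Proof.
move=> uc; rewrite limn_einf_lim; apply: lime_ge; first exact: is_cvg_einfs.
exists n0 => // n /= n0n; apply: le_ereal_inf_tmp => _ [m /= nm <-].
by apply: uc; exact: leq_trans nm.
Qed.

Lemma limn_einf_lt (u : (\bar R)^nat) (c : \bar R) (n0 : nat) : (limn_einf u < c)%E ->
  exists2 n, (n0 <= n)%N & (u n < c)%E.
Proof.
move=> uc; apply: contrapT => h; move: uc; apply/negP; rewrite -leNgt.
apply: (@limn_einf_ge _ _ n0) => n n0n; rewrite leNgt; apply/negP => un.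
by apply: h; exists n.
Qed.

Lemma measurable_limn_einf (D : set (borelCC R)) (f : (borelCC R -> \bar R)^nat) :
  (forall n, measurable_fun D (f n)) -> measurable_fun D (fun x => limn_einf (f ^~ x)).
Proof.
move=> mf; have -> : (fun x => limn_einf (f ^~ x)) =
    (fun x => (- limn_esup ((fun n x => - f n x) ^~ x))%E) by [].
apply: measurableT_comp => //; apply: measurable_fun_limn_esup => n.
exact: measurableT_comp.
Qed.

(** Let J_m (x) = P[b](r_m x) / (1 - r_m^2). The hypothesis bounds the integrals of J_m over K, so
    by Fatou's lemma liminf J_m is finite at almost every x in K; a second use of Fatou's lemma, in
    y, reaches the singular kernel. *)
Lemma singular_ae (K : set C) b (c : R) : closed K -> K `<=` unit_circle R ->
  bm b -> (forall x, nrm x = 1 -> 0 <= b x) -> (forall x, K x -> b x = 0) ->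
  (forall r, 0 <= r < 1 -> mean (fun x => \1_K x * poisson b (cofr r * x)) <= c * (1 - r)) ->
  \forall x \ae sigma, K x -> (\int[sigma]_(y in T) (sing b x y)%:E < +oo)%E.
Proof.
move=> cK KT bb b0 bK bc; have mK : measurable (K : set (borelCC R)) by exact: measurable_closed_CC.
have [mb _] := bb.
pose r m : R := 1 - m.+2%:R^-1.
have im m : 0 < m.+2%:R^-1 :> R by rewrite invr_gt0.
have im1 m : m.+2%:R^-1 < 1 :> R by rewrite invf_lt1 // ltr1n.
have r01 m : 0 <= r m < 1.
  by rewrite /r; move: (im m) (im1 m); move: (m.+2%:R^-1) => i *; apply/andP; split; lra.
have r1 m : r m <= 1 by case/andP: (r01 m) => _ /ltW.
have r0 m : 0 <= r m by case/andP: (r01 m).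
have rS m m' : (m <= m')%N -> r m <= r m'.
  by move=> mm; rewrite /r lerD2l lerN2 lef_pV2 ?posrE // ler_nat !ltnS.
have p0 m : 0 < 1 - r m ^+ 2.
  by rewrite subr_gt0 expr_lt1 //; case/andP: (r01 m).
pose J m (x : C) : R := poisson b (cofr (r m) * x) / (1 - r m ^+ 2).
have cJ m : cont_on (unit_circle R) (J m).
  move=> x Tx e e0; have [d d0 dP] := cont_onZ (1 - r m ^+ 2)^-1 (bm_poisson_radial bb (r01 m)) Tx e0.
  by exists d => // y Ty yx; rewrite /J ![_ / (1 - _)]mulrC; exact: dP.
have JE m x : nrm x = 1 -> J m x = mean (sing b (cofr (r m) * x)).
  move=> x1; rewrite /J; have [-> _] := poisson_sing bb (r01 m) x1.
  by rewrite mulrAC mulfV ?mul1r // gt_eqF.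
have J0 m x : nrm x = 1 -> 0 <= J m x.
  move=> x1; apply: divr_ge0; last exact: ltW.
  by apply: poisson_ge0 => //; exact: radial_lt1.
have mJ m : measurable_fun (K : set (borelCC R)) (J m : borelCC R -> R).
  by apply: cont_on_measurable => //; apply: cont_on_subset (cJ m).
have mJe m : measurable_fun (K : set (borelCC R)) (EFin \o J m : borelCC R -> \bar R).
  exact/measurable_EFinP.
have iJ m : (\int[sigma]_(x in (K : set (borelCC R))) (EFin \o J m) x <= (pi *+ 2 * `|c|)%:E)%E.
  have bKJ : bm (fun x => \1_K x * J m x).
    apply: bmM; last exact: cont_on_bm.
    split; first by apply: measurable_indic.
    by exists 1 => x _; rewrite indicE; case: (x \in K); rewrite ?normr1 ?normr0.
  have -> : (\int[sigma]_(x in (K : set (borelCC R))) (EFin \o J m) x)%E =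
      (\int[sigma]_(x in T) (\1_K x * J m x)%:E)%E.
    rewrite [LHS]integral_mkcond [RHS]integral_mkcond; apply: eq_integral => x _.
    rewrite !patchE indicE; case: ifP => xK.
      by rewrite mem_set ?mul1r //; apply: KT; exact: set_mem.
    by rewrite mul0r if_same.
  rewrite integral_mean // lee_fin ler_pM2l ?pi2_gt0 //.
  have -> : mean (fun x => \1_K x * J m x) =
     (1 - r m ^+ 2)^-1 * mean (fun x => \1_K x * poisson b (cofr (r m) * x)).
    rewrite -meanZ; first by apply: eq_mean => x _; rewrite /J; ring.
    apply: bm_eq (bmZ (1 - r m ^+ 2) bKJ) => x _; rewrite /J; field.
    by rewrite gt_eqF.
  rewrite mulrC ler_pdivrMr //; apply: le_trans (bc _ (r01 m)) _.
  apply: (@le_trans _ _ (`|c| * (1 - r m))).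
    by apply: ler_wpM2r; [rewrite subr_ge0|exact: ler_norm].
  apply: ler_wpM2l => //; rewrite lerD2l lerN2 expr2 ler_piMl //.
have mliminf : measurable_fun (K : set (borelCC R)) (fun x => limn_einf (fun m => (EFin \o J m) x)).
  exact: measurable_limn_einf.
have lim0 x : K x -> (0 <= limn_einf (fun m => (EFin \o J m) x))%E.
  by move=> Kx; apply: (@limn_einf_ge _ _ 0%N) => m _; rewrite lee_fin J0 //; exact/circleE/KT.
have int : sigma.-integrable (K : set (borelCC R)) (fun x => limn_einf (fun m => (EFin \o J m) x)).
  apply/integrableP; split=> //.
  apply: (@le_lt_trans _ _ (pi *+ 2 * `|c|)%:E); last by rewrite ltry.
  rewrite (eq_integral (fun x : borelCC R => limn_einf (fun m => (EFin \o J m) x))); last first.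
    by move=> x xK; rewrite gee0_abs // lim0 //; exact: set_mem.
  apply: le_trans (fatou _ _ _ _) _ => //.
    by move=> m x Kx; rewrite lee_fin J0 //; exact/circleE/KT.
  exact: limn_einf_le.
have := integrable_ae mK int; apply: filterS => x /= h Kx; have {h} h := h Kx.
have /circleE x1 := KT x Kx.
have [M uM] : exists M : R, (limn_einf (fun m => (EFin \o J m) x) < M%:E)%E.
  by exists (fine (limn_einf (fun m => (EFin \o J m) x)) + 1); rewrite EFinD fineK // lteDl.
(* The liminf only bounds J_m' for infinitely many m'; monotonicity in r up to the factor 4 extends
   the bound to every m. *)
have JM m : J m x <= 4 * M.
  have [m' mm' JM'] := limn_einf_lt m uM; rewrite lte_fin in JM'.
  apply: le_trans (_ : 4 * J m' x <= _); last by rewrite ler_pM2l // ltW.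
  rewrite !JE //; have [_ b1] := poisson_sing bb (r01 m) x1.
  have [_ b2] := poisson_sing bb (r01 m') x1.
  rewrite -meanZ //; apply: mean_le => //; first exact: bmZ.
  move=> y y1; apply: sing_radial_le => //; [exact: rS|exact: b0|].
  by move=> rm1; have := r01 m'; rewrite rm1 ltxx andbF.
have msing m : measurable_fun T (fun y => (sing b (cofr (r m) * x) y)%:E).
  by apply/measurable_EFinP; exact: measurable_sing.
have sing0 z y : T y -> (0 <= (sing b z y)%:E)%E.
  by move=> /circleE y1; rewrite lee_fin mulr_ge0 ?b0 // invr_ge0 exprn_ge0.
apply: (@le_lt_trans _ _ (pi *+ 2 * (4 * (4 * M)))%:E); last by rewrite ltry.
(* For y other than x, the singular kernel is at most 4 times the kernel at r_m x once 1 - r_m <= |y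
   - x|; for y = x both sides vanish with b x. *)
apply: (@le_trans _ _ (\int[sigma]_(y in T) limn_einf (fun m => 4%:E * (sing b (cofr (r m) * x) y)%:E))%E).
  apply: ge0_le_integral; first exact: measurable_circle.
  - by move=> y Ty; exact: sing0.
  - by apply/measurable_EFinP; exact: measurable_sing.
  - by apply: (@measurable_limn_einf T (fun m y => 4%:E * (sing b (cofr (r m) * x) y)%:E)%E) => m;
    apply: measurable_funeM.
  move=> y Ty; have /circleE y1 := Ty.
  have [yx|yx] := eqVneq y x.
    apply: (@limn_einf_ge _ _ 0%N) => m _; rewrite /sing yx bK // !mul0r mule0 //.
  have d0 : 0 < nrm (y - x) by rewrite nrm_gt0 subr_eq0.
  pose m0 := Num.Def.archi_bound (nrm (y - x))^-1.
  have m0P : (nrm (y - x))^-1 < m0%:R by apply: archi_boundP; rewrite invr_ge0.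
  apply: (@limn_einf_ge _ _ m0) => m m0m; rewrite -EFinM lee_fin.
  have rm : 1 - r m <= nrm (y - x).
    rewrite /r opprB addrC subrK -[leRHS]invrK lef_pV2 ?posrE ?invr_gt0 //.
    by apply: le_trans (ltW m0P) _; rewrite ler_nat; apply: leq_trans m0m _; rewrite -addn2 leq_addr.
  have dd : nrm (y - cofr (r m) * x) <= 2 * nrm (y - x).
    apply: le_trans (nrm_triangle _ x _) _.
    by rewrite (nrm_radial_sub (r1 m) x1); move: rm; set q := r m => ?; lra.
  have d1 : 0 < nrm (y - cofr (r m) * x).
    by rewrite nrm_gt0 circle_subr_neq0 // radial_lt1.
  rewrite /sing mulrCA; apply: ler_wpM2l; first exact: b0.
  exact: inv_sq_le d0 d1 dd.
apply: le_trans (fatou _ _ _ _) _ => //.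
- by move=> m; apply: measurable_funeM.
- by move=> m y Ty; apply: mule_ge0 => //; exact: sing0.
apply: limn_einf_le => m.
have [_ b1] := poisson_sing bb (r01 m) x1.
have -> : (\int[sigma]_(y in T) (4%:E * (sing b (cofr (r m) * x) y)%:E))%E =
   (\int[sigma]_(y in T) (4 * sing b (cofr (r m) * x) y)%:E)%E by [].
rewrite integral_mean; last exact: bmZ.
by rewrite lee_fin ler_pM2l ?pi2_gt0 // meanZ // ler_pM2l // -JE.
Qed.

Lemma dominated_small (F : nat -> C -> R) (g : C -> R) :
  (forall j, measurable_fun T (F j : borelCC R -> R)) -> measurable_fun T (g : borelCC R -> R) ->
  (forall j y, nrm y = 1 -> 0 <= F j y <= g y) ->
  (\int[sigma]_(y in T) (g y)%:E < +oo)%E ->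
  (forall y, nrm y = 1 -> F ^~ y @ \oo --> 0) ->
  forall e : R, 0 < e -> exists j0, forall j, (j0 <= j)%N ->
    (\int[sigma]_(y in T) (F j y)%:E <= e%:E)%E.
Proof.
move=> mF mg Fg gfin F0 e e0.
have ig : sigma.-integrable T (EFin \o g).
  apply/integrableP; split; first exact/measurable_EFinP.
  move: gfin; congr (_ < _)%E; apply: eq_integral => y /set_mem /circleE y1 /=.
  by have /andP[h1 h2] := Fg 0%N y y1; rewrite ger0_norm // (le_trans h1).
have [] := @dominated_convergence _ _ _ sigma T (@measurable_circle R)
  (fun j => EFin \o F j : borelCC R -> \bar R) (cst 0%E) (EFin \o g).
- by move=> j; exact/measurable_EFinP.
- exact: measurable_cst.
- apply: aeW => y /circleE y1; apply/fine_cvgP; split; first exact: nearW.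
  exact: F0.
- exact: ig.
- apply: aeW => y j /circleE y1 /=; rewrite lee_fin; have /andP[h1 h2] := Fg j y y1.
  by rewrite ger0_norm.
move=> _ _; rewrite integral0 => /fine_cvgP[fin /cvgrPdist_lt/(_ e e0) near1].
have [j0 _ j0P] := filterI fin near1; exists j0 => j j0j.
have [/= f1 f2] := j0P j j0j; rewrite -(fineK f1) lee_fin.
by move: f2; rewrite sub0r normrN => /ltW; apply: le_trans; exact: ler_norm.
Qed.

(** The 8 is the 4 of [sing_radial_le] times 1 + r <= 2; the division by 2 pi in the mean is only
    used as a division by at least 1. *)
Lemma poisson_le_sing b (r e : R) (x : C) : bm b -> 0 <= r < 1 -> nrm x = 1 ->
  (forall y, nrm y = 1 -> 0 <= b y) -> b x = 0 ->
  (\int[sigma]_(y in T) (sing b x y)%:E <= e%:E)%E ->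
  poisson b (cofr r * x) <= 8 * (1 - r) * e.
Proof.
move=> bb r01 x1 b0 bx be; have [-> bs] := poisson_sing bb r01 x1.
have /andP[r0 r1] := r01; have [mb _] := bb; have [ms _] := bs.
have sing0 z y : T y -> (0 <= (sing b z y)%:E)%E.
  by move=> /circleE y1; rewrite lee_fin mulr_ge0 ?b0 // invr_ge0 exprn_ge0.
have h : pi *+ 2 * mean (sing b (cofr r * x)) <= 4 * e.
  rewrite -lee_fin -integral_mean // EFinM.
  apply: (@le_trans _ _ (4%:E * \int[sigma]_(y in T) (sing b x y)%:E)%E); last first.
    by apply: lee_wpmul2l => //; rewrite lee_fin.
  rewrite -ge0_integralZl_EFin //; last 2 first.
  - by move=> y Ty; exact: sing0.
  - by apply/measurable_EFinP; exact: measurable_sing.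
  apply: ge0_le_integral; first exact: measurable_circle.
  - by move=> y Ty; exact: sing0.
  - exact/measurable_EFinP.
  - by apply: measurable_funeM; apply/measurable_EFinP; exact: measurable_sing.
  move=> y /circleE y1; rewrite -EFinM lee_fin.
  have := @sing_radial_le b r 1 x y r0 (ltW r1) (lexx 1) x1 y1 (b0 y y1).
  by rewrite cofr1 mul1r; apply=> _ <-.
have m0 : 0 <= mean (sing b (cofr r * x)).
  by apply: mean_ge0 => y y1; rewrite mulr_ge0 ?b0 // invr_ge0 exprn_ge0.
have p2 := pi_ge2 R.
have h2 : mean (sing b (cofr r * x)) <= 4 * e.
  by apply: le_trans h; rewrite mulr2n; nra.
have -> : 1 - r ^+ 2 = (1 - r) * (1 + r) by ring.
have -> : 8 * (1 - r) * e = (1 - r) * (2 * (4 * e)) by ring.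
rewrite -mulrA; apply: ler_wpM2l; first lra.
by apply: ler_pM => //; lra.
Qed.

End almost_everywhere_estimates.

(** * Poisson integrals attached to a closed subset of the circle *)

Section closed_subsets_of_the_circle.
Variable R : realType.
Local Notation C := (CC R).
Local Notation T := (unit_circle R : set (borelCC R)).
Local Notation sigma := (@arc_length R).
Implicit Types (b F G : C -> R).

Definition dist_to (K : set C) (x : C) : R := inf [set nrm (x - y) | y in K].

Section distance.
Variable K : set C.
Hypothesis K0 : K !=set0.

Lemma dist_to_le x y : K y -> dist_to K x <= nrm (x - y).
Proof.
move=> Ky; apply: ge_inf; last by exists y.
by exists 0 => _ [z _ <-].
Qed.

Lemma dist_to_ge x (c : R) : (forall y, K y -> c <= nrm (x - y)) -> c <= dist_to K x.
Proof.
move=> h; apply: lb_le_inf; last by move=> _ [y Ky <-]; exact: h.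
by have [y Ky] := K0; exists (nrm (x - y)), y.
Qed.

Lemma dist_to_ge0 x : 0 <= dist_to K x.
Proof. by apply: dist_to_ge => y _; exact: nrm_ge0. Qed.

Lemma dist_to_lip x z : dist_to K x <= dist_to K z + nrm (x - z).
Proof.
rewrite -lerBlDr; apply: dist_to_ge => y Ky; rewrite lerBlDr.
have := nrm_triangle x z y; have := dist_to_le x Ky; lra.
Qed.

Lemma cont_on_dist_to D : cont_on D (dist_to K).
Proof.
move=> x Dx e e0; exists e => // y Dy yx; apply: le_lt_trans yx.
have := dist_to_lip x y; have := dist_to_lip y x; rewrite [nrm (x - y)]nrmB ler_norml => *.
by apply/andP; split; lra.
Qed.

Lemma dist_to_in x : K x -> dist_to K x = 0.
Proof.
move=> Kx; apply/eqP; rewrite eq_le dist_to_ge0 andbT.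
by apply: le_trans (dist_to_le x Kx) _; rewrite subrr nrm0.
Qed.

Lemma dist_to_gt0 x : closed K -> ~ K x -> 0 < dist_to K x.
Proof.
move=> cK /(closedP_nrm cK)[e e0 eP]; apply: lt_le_trans e0 _.
apply: dist_to_ge => y Ky; rewrite leNgt; apply/negP => yx.
by apply: (eP y) => //; rewrite nrmB.
Qed.

Lemma dist_to_lt x (c : R) : dist_to K x < c -> exists2 y, K y & nrm (x - y) < c.
Proof.
move=> xc; apply: contrapT => h; move: xc; apply/negP; rewrite -leNgt.
apply: dist_to_ge => y Ky; rewrite leNgt; apply/negP => yx; apply: h.
by exists y.
Qed.

End distance.

Lemma ln_ratio (r : R) : 0 <= r < 1 -> 0 <= ln (2 / (1 + r)) <= 1 - r.
Proof.
move=> /andP[r0 r1]; have rp : 0 < 1 + r by lra.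
have E : 2 / (1 + r) = 1 + (1 - r) / (1 + r) by field; rewrite gt_eqF.
have q0 : 0 <= (1 - r) / (1 + r) by apply: divr_ge0; lra.
have q1 : (1 - r) / (1 + r) <= 1 - r by rewrite ler_pdivrMr // ler_peMr; lra.
rewrite E ln_ge0 ?lerDl //=; apply: le_trans q1.
have h := @expR_ge1Dx R ((1 - r) / (1 + r)).
rewrite -[leRHS]expRK ler_ln ?posrE ?expR_gt0 //; lra.
Qed.

Lemma bm_indic (A : set C) : measurable (A : set (borelCC R)) -> bm (\1_A : C -> R).
Proof.
move=> mA; split; first exact: measurable_indic.
by exists 1 => x _; rewrite indicE; case: (_ \in _); rewrite ?normr1 ?normr0.
Qed.

Lemma indic01 (A : set C) (x : C) : 0 <= (\1_A x : R) <= 1.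
Proof. by rewrite indicE; case: (_ \in _); rewrite lexx ler01. Qed.

Lemma bm_poisson_radial' b (r : R) : bm b -> 0 <= r < 1 -> bm (fun x => poisson b (cofr r * x)).
Proof. by move=> bb r01; apply: cont_on_bm; exact: bm_poisson_radial. Qed.

Lemma mean_poisson b (r : R) : bm b -> 0 <= r < 1 -> (forall x, nrm x = 1 -> 0 <= b x) ->
  mean (fun x => poisson b (cofr r * x)) = mean b.
Proof.
move=> bb r01 b0; have := @poisson_sym R b (fun=> 1) r bb (bm_cst 1) r01 b0.
rewrite (@eq_mean R _ (fun x => poisson b (cofr r * x))); last by move=> *; rewrite mul1r.
move=> ->; last by move=> *; exact: ler01.
by apply: eq_mean => x x1; rewrite poisson_cst ?mulr1 // radial_lt1.
Qed.

Section closed_set.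
Variable K : set C.
Hypotheses (cK : closed K) (KT : K `<=` unit_circle R) (K0 : K !=set0).

Let mK : measurable (K : set (borelCC R)). Proof. exact: measurable_closed_CC. Qed.

Let bK : bm (\1_K : C -> R). Proof. exact: bm_indic. Qed.

Let mKc : measurable (~` K : set (borelCC R)). Proof. exact: measurableC. Qed.

(** P[G](r x) and G have the same mean over the circle, so P[G](r x) - G(x) + ln (2 / (1 + r)),
    which is nonnegative everywhere, has mean at most 1 - r. On K, where G vanishes, it dominates
    P[G](r x). *)
Lemma superharmonic_singular_ae G : bm G -> (forall x, nrm x = 1 -> 0 <= G x) ->
  (forall x, K x -> G x = 0) ->
  (forall r x, 0 <= r < 1 -> nrm x = 1 ->
     G x <= ln (2 / (1 + r)) + poisson G (cofr r * x)) ->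
  \forall x \ae sigma, K x -> (\int[sigma]_(y in T) (sing G x y)%:E < +oo)%E.
Proof.
move=> bG G0 GK GP; apply: (@singular_ae R K G 1) => // r r01; rewrite mul1r.
have /andP[l0 l1] := ln_ratio r01.
have bP := bm_poisson_radial' bG r01.
set l := ln (2 / (1 + r)) in l0 l1.
apply: (@le_trans _ _ (mean (fun x => poisson G (cofr r * x) - G x + l))); last first.
  rewrite meanD ?meanB ?mean_poisson ?mean_cst ?subrr ?add0r //.
    exact: bmB.
  exact: bm_cst.
apply: mean_le; [exact: bmM|by apply: bmD; [exact: bmB|exact: bm_cst]|].
move=> x x1; rewrite indicE; have [/set_mem Kx|nK] := boolP (x \in K).
  by rewrite mul1r GK // subr0 lerDl.
rewrite mul0r; have := GP r x r01 x1; rewrite -/l; lra.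
Qed.

(** The truncation allows the singular integral of the distance to be made arbitrarily small, by
    dominated convergence as e tends to 0. *)
Definition trunc_dist (e : R) (x : C) : R := Num.min (dist_to K x) e.

Lemma cont_trunc_dist e D : cont_on D (trunc_dist e).
Proof. exact: cont_on_min _ (cont_on_dist_to K0 (D := D)). Qed.

Lemma bm_trunc_dist e : bm (trunc_dist e).
Proof. exact/cont_on_bm/cont_trunc_dist. Qed.

Lemma trunc_dist_ge0 e x : 0 <= e -> 0 <= trunc_dist e x.
Proof. by move=> e0; rewrite le_min e0 dist_to_ge0. Qed.

Lemma trunc_dist_in e x : 0 <= e -> K x -> trunc_dist e x = 0.
Proof. by move=> e0 Kx; rewrite /trunc_dist dist_to_in // min_l. Qed.

(* Marcinkiewicz: the interval around y of length dist(y, K) carries the bulk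
   of the Poisson kernel at the point (1 - dist(y, K)) y. *)
Lemma trunc_dist_singular_ae :
  \forall x \ae sigma, K x -> (\int[sigma]_(y in T) (sing (trunc_dist (1 / 2)) x y)%:E < +oo)%E.
Proof.
have h0 : 0 <= 1 / 2 :> R by lra.
have b0 x : nrm x = 1 -> 0 <= trunc_dist (1 / 2) x by move=> _; exact: trunc_dist_ge0.
have bb := bm_trunc_dist (1 / 2).
(* The 32 is 2 * 16: 1 - r^2 <= 2 (1 - r), and |x - (1 - m) y| <= 2 |x - y| <= 4 |x - r y| compares
   the kernels at r y and (1 - m) y. The weight m is absorbed by 1 - (1 - m)^2 = m (2 - m) >= m. *)
apply: (@singular_ae R K _ 32) => //.
  by move=> x Kx; exact: trunc_dist_in.
move=> r r01; have /andP[r0 r1] := r01.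
have K01 x : nrm x = 1 -> 0 <= (\1_K x : R) by move=> _; case/andP: (indic01 K x).
rewrite (poisson_sym bb bK r01 b0 K01).
have bP := bm_poisson_radial' bK r01.
rewrite -[leRHS]mean_cst; apply: mean_le; [exact: bmM|exact: bm_cst|].
move=> y y1; set m := trunc_dist (1 / 2) y.
have ry := radial_lt1 r01 y1.
have m0 : 0 <= m by exact: b0.
have [mE|mn] := eqVneq m 0.
  by rewrite mE mul0r mulr_ge0 //; lra.
have mp : 0 < m by rewrite lt_def mn.
have m2 : m <= 1 / 2 by rewrite ge_min lexx orbT.
have md : m <= dist_to K y by rewrite ge_min lexx.
have m01 : 0 <= 1 - m < 1 by apply/andP; split; lra.
have my := radial_lt1 m01 y1.
rewrite -meanZ; last exact: bm_poisson.
have pkb := bm_pk my.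
apply: (@le_trans _ _ (mean (fun x => 32 * (1 - r) * pk (cofr (1 - m) * y) x))); last first.
  by rewrite meanZ // mean_pk // mulr1.
apply: mean_le; [by apply: bmZ; exact: bm_poisson|exact: bmZ|].
move=> x x1; rewrite indicE; have [/set_mem Kx|_] := boolP (x \in K); last first.
  by rewrite mul0r mulr0 mulr_ge0 ?pk_ge0 //; lra.
rewrite mul1r !pk_radial //; last by case/andP: m01.
have xy : m <= nrm (x - y) by apply: le_trans md _; rewrite nrmB; exact: dist_to_le.
have d1 : 0 < nrm (x - cofr r * y) by rewrite nrm_gt0 circle_subr_neq0.
have d2 : 0 < nrm (x - cofr (1 - m) * y) by rewrite nrm_gt0 circle_subr_neq0.
have h1 : nrm (x - cofr (1 - m) * y) <= 2 * nrm (x - y).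
  apply: le_trans (nrm_triangle _ y _) _.
  by rewrite nrm_radial_sub //; [lra|case/andP: m01 => _ /ltW].
have h2 : nrm (x - y) <= 2 * nrm (x - cofr r * y).
  have := @radial_dist R r 1 y x r0 (ltW r1) (lexx 1) y1 x1.
  by rewrite cofr1 mul1r.
have h3 : nrm (x - cofr (1 - m) * y) <= 2 * (2 * nrm (x - cofr r * y)) by lra.
have d1' : 0 < 2 * nrm (x - cofr r * y) by rewrite mulr_gt0.
have := inv_sq_le d1' d2 h3; rewrite exprMn invfM.
set A := (nrm (x - cofr r * y) ^+ 2)^-1; set B := (nrm (x - cofr (1 - m) * y) ^+ 2)^-1 => AB.
have A0 : 0 <= A by rewrite invr_ge0 exprn_ge0.
have B0 : 0 <= B by rewrite invr_ge0 exprn_ge0.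
have {}AB : A <= 16 * B.
  by move: AB; rewrite mulrC ler_pdivrMr ?exprn_gt0 //; lra.
have r2 : 1 - r ^+ 2 <= 2 * (1 - r) by nra.
have r20 : 0 <= 1 - r ^+ 2 by rewrite subr_ge0 expr_le1 // ltW.
have s1 : m * ((1 - r ^+ 2) * A) <= m * (2 * (1 - r) * (16 * B)).
  by apply: ler_wpM2l => //; apply: ler_pM.
apply: le_trans s1 _.
have -> : 32 * (1 - r) * ((1 - (1 - m) ^+ 2) * B) = (32 * (1 - r) * B) * (m * (2 - m)) by ring.
have -> : m * (2 * (1 - r) * (16 * B)) = (32 * (1 - r) * B) * m by ring.
apply: ler_wpM2l; first by rewrite !mulr_ge0 //; lra.
by rewrite ler_peMr //; lra.
Qed.

(** The indicator of the complement is [psi j], continuous and zero on K, plus [rho j], of small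
    mean by dominated convergence. P[psi j] is close to psi j, which is at most j (1 - r) at r x for
    x in K; P[rho j] keeps the mean of rho j. *)
Lemma mean_poisson_complement (e : R) : 0 < e -> exists2 d : R, 0 < d &
  forall r, 0 <= r < 1 -> 1 - r < d ->
    mean (fun x => \1_K x * poisson (\1_(~` K)) (cofr r * x)) <= e.
Proof.
move=> e0; have e3 : 0 < e / 3 by rewrite divr_gt0.
pose psi (j : nat) (x : C) : R := Num.min (j%:R * dist_to K x) 1.
pose rho (j : nat) (x : C) : R := \1_(~` K) x - psi j x.
have cpsi j D : cont_on D (psi j).
  exact: cont_on_min _ (cont_onZ j%:R (cont_on_dist_to K0 (D := D))).
have bpsi j : bm (psi j) by exact/cont_on_bm/cpsi.
have bKc : bm (\1_(~` K) : C -> R) by exact: bm_indic.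
have brho j : bm (rho j) by exact: bmB.
have psi0 j x : 0 <= psi j x by rewrite le_min ler01 andbT mulr_ge0 ?dist_to_ge0.
have rho01 j x : 0 <= rho j x <= 1.
  rewrite /rho indicE in_setC; have [/set_mem Kx|_] := boolP (x \in K).
    by rewrite /psi dist_to_in // mulr0 min_l // subrr lexx ler01.
  by rewrite subr_ge0 ge_min lexx orbT /= lerBlDr lerDl psi0.
have rholim x : nrm x = 1 -> rho ^~ x @ \oo --> 0.
  move=> _; apply: cvg_near_cst; rewrite /rho indicE in_setC.
  have [/set_mem Kx|/negP nK] := boolP (x \in K).
    by apply: nearW => j; rewrite /psi dist_to_in // mulr0 min_l // subrr.
  have dx : 0 < dist_to K x by apply: dist_to_gt0 => // Kx; apply: nK; exact: mem_set.
  have := @archi_boundP R (dist_to K x)^-1; rewrite invr_ge0 (ltW dx) => /(_ isT) h.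
  exists (Num.Def.archi_bound (dist_to K x)^-1) => // j /= hj.
  rewrite /psi min_r ?subrr // -ler_pdivrMr // div1r; apply: le_trans (ltW h) _.
  by rewrite ler_nat.
have fin1 : (\int[sigma]_(y in T) (1 : R)%:E < +oo)%E.
  by rewrite (integral_mean (bm_cst 1)) ltry.
have [j0 j0P] := @dominated_small R rho (fun=> 1) (fun j => (brho j).1) (bm_cst (1 : R)).1
  (fun j y _ => rho01 j y) fin1 rholim _ e3.
have rsmall : mean (rho j0) <= e / 3.
  have := j0P j0 (leqnn _); rewrite integral_mean // lee_fin => h.
  have p2 := pi_ge2 R; have : 0 <= mean (rho j0) by apply: mean_ge0 => x _; case/andP: (rho01 j0 x).
  by move=> m0; apply: le_trans h; rewrite mulr2n; nra.
have [d d0 dP] := poisson_boundary (cpsi j0 _) e3.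
pose J : R := j0%:R + 1; have J0 : 0 < J by rewrite /J ltr_wpDl.
exists (Num.min d (e / 3 / J)); first by rewrite lt_min d0 divr_gt0.
move=> r r01; rewrite lt_min => /andP[rd]; rewrite ltr_pdivlMr // => rJ.
have /andP[r0 r1] := r01.
apply: (@le_trans _ _ (mean (fun x => (e / 3 + e / 3) + poisson (rho j0) (cofr r * x)))); last first.
  rewrite meanD ?mean_cst ?mean_poisson //.
  - lra.
  - by move=> x _; case/andP: (rho01 j0 x).
  - exact: bm_cst.
  - exact: bm_poisson_radial'.
apply: mean_le.
- by apply: bmM => //; exact: bm_poisson_radial'.
- by apply: bmD; [exact: bm_cst|exact: bm_poisson_radial'].
move=> x x1; have rx := radial_lt1 r01 x1.
have pr0 : 0 <= poisson (rho j0) (cofr r * x).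
  by apply: poisson_ge0 => // y _; case/andP: (rho01 j0 y).
rewrite indicE; have [/set_mem Kx|_] := boolP (x \in K); last by rewrite mul0r; lra.
rewrite mul1r.
have -> : poisson (\1_(~` K)) (cofr r * x) =
    poisson (psi j0) (cofr r * x) + poisson (rho j0) (cofr r * x).
  rewrite -poissonD //; congr poisson; apply/funext => y; rewrite /rho addrC subrK //.
rewrite lerD2r.
have := dP (cofr r * x); rewrite nrmM nrm_cofr x1 mulr1 ger0_norm // => /(_ _ r1) h.
have {}h := h (_ : 1 - d < r); have rd' : 1 - d < r by lra.
have {h} := h rd'; rewrite ler_norml => /andP[_ h].
have : psi j0 (cofr r * x) <= j0%:R * (1 - r).
  rewrite ge_min; apply/orP; left; apply: ler_wpM2l => //.
  apply: le_trans (dist_to_le (cofr r * x) Kx) _.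
  by rewrite nrmB nrm_radial_sub // ltW.
have : j0%:R * (1 - r) <= (1 - r) * J by rewrite mulrC ler_wpM2l ?lerDl //; lra.
lra.
Qed.

(** By Chebyshev's inequality, the points of K where the Poisson integral stays above 1 / (j + 1)
    for all k >= k0 form a null set. Only countably many such sets have to be discarded. *)
Lemma thin_complement_ae (r : nat -> R) : (forall k, 0 <= r k < 1) ->
  (forall e, 0 < e -> exists k0, forall k, (k0 <= k)%N -> 1 - r k < e) ->
  \forall x \ae sigma, K x -> forall (e : R) k0, 0 < e ->
    exists2 k, (k0 <= k)%N & poisson (\1_(~` K)) (cofr (r k) * x) < e.
Proof.
move=> r01 rlim.
have bKc : bm (\1_(~` K) : C -> R) by exact: bm_indic.
pose P k (x : C) := poisson (\1_(~` K)) (cofr (r k) * x).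
have bP k : bm (P k) by exact: bm_poisson_radial'.
pose A (jk : nat * nat) : set (borelCC R) :=
  K `&` \bigcap_(k in [set k | (jk.2 <= k)%N]) (T `&` P k @^-1` `[jk.1.+1%:R^-1, +oo[%classic).
have mA jk : measurable (A jk).
  apply: measurableI => //; apply: bigcap_measurableType => k _.
  by have [mP _] := bP k; apply: mP => //; exact: measurable_itv.
have P0 k x : nrm x = 1 -> 0 <= P k x.
  move=> x1; apply: poisson_ge0 => [|y _]; first exact: radial_lt1.
  by case/andP: (indic01 (~` K) y).
have A0 jk : sigma (A jk) = 0%E.
  have bA : bm (\1_(A jk : set C) : C -> R) by exact: bm_indic.
  have i0 : 0 < jk.1.+1%:R^-1 :> R by rewrite invr_gt0.
  have m0 : mean (\1_(A jk : set C)) = 0.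
    apply/eqP; rewrite eq_le; apply/andP; split; last first.
      by apply: mean_ge0 => x _; case/andP: (indic01 (A jk) x).
    apply/ler_addgt0Pr => e e0; rewrite add0r.
    have [d d0 dP] := mean_poisson_complement (mulr_gt0 e0 i0).
    have [k1 k1P] := rlim d d0.
    pose k := maxn k1 jk.2.
    have := dP (r k) (r01 k) (k1P k (leq_maxl _ _)).
    rewrite -ler_pdivrMr // -[X in _ / X]invrK invrK => /(le_trans _); apply.
    rewrite mulrC -meanZ; last by apply: bmM => //; exact: bP.
    apply: mean_le => //; first by apply: bmZ; apply: bmM => //; exact: bP.
    move=> x x1; rewrite indicE; have [/set_mem [Kx Ax]|_] := boolP (x \in _); last first.
      apply: mulr_ge0; first by rewrite ?invrK ?invr_ge0.
      by apply: mulr_ge0; [case/andP: (indic01 K x)|exact: P0].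
    rewrite indicE mem_set // mul1r mulrC ler_pdivlMr // mul1r.
    have [_] := Ax k (leq_maxr _ _); rewrite /= in_itv /= andbT; exact.
  have := integral_mean bA; rewrite m0 mulr0 integral_indic // => h.
  have AT : A jk `&` T = A jk by apply/setIidl => x [Kx _]; exact: KT.
  by rewrite -[X in sigma X]AT h.
have : forall j k0, \forall x \ae sigma, ~ A (j, k0) x.
  move=> j k0; exists (A (j, k0)); split; [exact: mA|exact: A0|].
  by move=> x /= /contrapT.
move=> h; have := ae_foralln (fun j => ae_foralln (h j)).
apply: filterS => x hx Kx e k0 e0.
have [j je] : exists j : nat, j.+1%:R^-1 < e.
  exists (Num.Def.archi_bound e^-1); rewrite -[ltRHS]invrK ltf_pV2 ?posrE ?invr_gt0 //.
  have := @archi_boundP R e^-1; rewrite invr_ge0 (ltW e0) => /(_ isT) /lt_trans; apply.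
  by rewrite ltr_nat.
apply: contrapT => nk; apply: (hx j k0); split=> // k /= kk0; split; first exact: KT.
rewrite /= in_itv /= andbT leNgt; apply/negP => Pk; apply: nk; exists k => //.
exact: lt_trans je.
Qed.

End closed_set.

End closed_subsets_of_the_circle.

(** * A lower bound for Poisson integrals; Taylor sums and approach regions *)

Section barrier_tools.
Variable R : realType.
Local Notation C := (CC R).
Local Notation T := (unit_circle R : set (borelCC R)).

Lemma poisson_harmonic (g : C -> C) (rho : R) (z : C) : 1 < rho ->
  (forall w, nrm w < rho -> exists a, cder g w a) -> nrm z < 1 ->
  poisson (fun x => cre (g x)) z = cre (g z).
Proof.
by move=> rho1 dg z1; rewrite -(cauchy_formula rho1 dg z1) (cauchy_poisson rho1 dg z1).
Qed.

(** The kernel of w is on the circle the real part of a function holomorphic across the closed disc,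
    so its Poisson integral at w is that real part at w. *)
Lemma poisson_pk_diag (w : C) : nrm w < 1 ->
  poisson (pk w) w = (1 + nrm w ^+ 2) / (1 - nrm w ^+ 2).
Proof.
move=> w1; have w0 := nrm_ge0 w; have wp : 0 < 1 + nrm w by lra.
pose rho := 2 / (1 + nrm w); have rho1 : 1 < rho by rewrite /rho ltr_pdivlMr; lra.
pose g (x : C) : C := 2 * (1 - cj w * x)^-1 - 1.
have dg x : nrm x < rho -> exists a, cder g x a.
  rewrite /rho ltr_pdivlMr // => xr.
  have [|a da] := @cder_conj_kernel R w x; first by rewrite nrmM nrm_cj; nra.
  by eexists; apply: cderB (cder_cst _ _); exact: cderZ da.
have wne : 1 - nrm w ^+ 2 != 0 by rewrite gt_eqF // subr_gt0 expr_lt1.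
have -> : poisson (pk w) w = poisson (fun x => cre (g x)) w.
  by apply: eq_mean => y y1; rewrite pk_cre_conj.
rewrite (poisson_harmonic rho1 dg w1) /g [cj w * w]mulrC mul_cj.
have -> : 2 * (1 - cofr (nrm w ^+ 2))^-1 - 1 = cofr (2 * (1 - nrm w ^+ 2)^-1 - 1).
  move: (nrm w ^+ 2) => m.
  by rewrite [RHS]cofrD [cofr (2 * _)]cofrM cofrV [cofr (1 - _)]cofrD !cofrN cofr_nat.
by rewrite cre_cofr; field.
Qed.

(* The test function (1 - |w|) pk w - 1/8 is at most 2, and it is nonpositive
   at distance at least 4 (1 - |w|) from w. *)
Lemma poisson_lower (b : C -> R) (w : C) (beta : R) : bm b ->
  (forall y, nrm y = 1 -> 0 <= b y) -> nrm w < 1 -> 0 <= beta ->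
  (forall y, nrm y = 1 -> nrm (y - w) <= 4 * (1 - nrm w) -> beta <= b y) ->
  3 / 16 * beta <= poisson b w.
Proof.
move=> bb b0 w1 beta0 hb; have w0 := nrm_ge0 w.
have d0 : 0 < 1 - nrm w by rewrite subr_gt0.
set s := nrm w in w0 w1 d0 hb *.
pose k := beta / 2 * (1 - s).
have -> : 3 / 16 * beta = poisson (fun=> 3 / 16 * beta) w by rewrite poisson_cst.
have bpk := bm_pk w1.
apply: (@le_trans _ _ (poisson (fun y => k * pk w y + - (beta / 16)) w)).
  rewrite (poissonD (bmZ k bpk) (bm_cst _) w1) (poissonZ k bpk w1) !(poisson_cst _ w1).
  rewrite poisson_pk_diag // -/s /k.
  have -> : beta / 2 * (1 - s) * ((1 + s ^+ 2) / (1 - s ^+ 2)) =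
     beta / 2 * ((1 + s ^+ 2) / (1 + s)).
    have -> : 1 - s ^+ 2 = (1 - s) * (1 + s) by ring.
    by field; rewrite !gt_eqF //; lra.
  (* The Poisson integral of the test function at w is thus at least beta / 4 - beta / 16 = 3 / 16 *
     beta. *)
  have : 1 / 2 <= (1 + s ^+ 2) / (1 + s) by rewrite ler_pdivlMr; [nra|lra].
  by move: (_ / (1 + s)) => q hq; nra.
apply: poisson_le => //; first by apply: bmD; [exact: bmZ|exact: bm_cst].
move=> y y1; have dy := dist_circle w1 y1; rewrite -/s in dy.
have s2 : 1 - s ^+ 2 <= 2 * (1 - s) by nra.
have s20 : 0 <= 1 - s ^+ 2 by nra.
have [ny|ny] := leP (nrm (y - w)) (4 * (1 - s)).
  apply: le_trans (hb y y1 ny).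
  suff : k * pk w y <= beta by move=> h; lra.
  rewrite /k /pk -/s mulrA ler_pdivrMr ?exprn_gt0 //; last exact: lt_le_trans dy.
  have -> : beta / 2 * (1 - s) * (1 - s ^+ 2) = beta * ((1 - s ^+ 2) * (1 - s) / 2) by ring.
  apply: ler_wpM2l => //; nra.
apply: le_trans (b0 y y1).
suff : k * pk w y <= beta / 16 by move=> h; lra.
rewrite /k /pk -/s mulrA ler_pdivrMr ?exprn_gt0 //; last by apply: lt_le_trans dy.
have -> : beta / 2 * (1 - s) * (1 - s ^+ 2) = beta * ((1 - s) * (1 - s ^+ 2) / 2) by ring.
have -> : beta / 16 * nrm (y - w) ^+ 2 = beta * (nrm (y - w) ^+ 2 / 16) by ring.
apply: ler_wpM2l => //.
have : (4 * (1 - s)) ^+ 2 <= nrm (y - w) ^+ 2.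
  by rewrite ler_pXn2r ?nnegrE // ?ltW // mulr_gt0.
nra.
Qed.

Lemma cder_taylor_sum (f : C -> C) n w : exists a, cder (taylor_sum f n) w a.
Proof.
elim: n => [|n [a da]].
  exists 0; apply: cder_eq (cder_cst (derive1n 0 f 0 / 0`!%:R) w).
  by exists 1 => // x _; rewrite /taylor_sum big_ord_recr big_ord0 /= add0r expr0 mulr1.
eexists; apply: cder_eq (cderD da (cderZ (derive1n n.+1 f 0 / n.+1`!%:R) (cderX n w))).
by exists 1 => // x _; rewrite /taylor_sum [RHS]big_ord_recr.
Qed.

Lemma stolzE (alpha : R) (x z : C) : stolz alpha x z <->
  nrm z < 1 /\ nrm (z - x) < alpha * (1 - nrm z).
Proof.
rewrite /stolz /= discE !normE.
have -> : (1 : C) - cofr (nrm z) = cofr (1 - nrm z) by rewrite cofrD cofrN.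
by rewrite -[_%:C%C * _]cofrM cofr_lt.
Qed.

End barrier_tools.

(** * Partial sums and f near a closed set on which both are controlled *)

Section core.
Variable R : realType.
Local Notation C := (CC R).
Local Notation T := (unit_circle R : set (borelCC R)).
Local Notation sigma := (@arc_length R).
Variables (f : C -> C) (n : nat -> nat) (K : set C) (M : R).
Hypotheses (hf : holomorphic_on (unit_disc R) f) (hn : {homo n : j k / (j < k)%N}).
Hypotheses (cK : closed K) (KT : K `<=` unit_circle R) (K0 : K !=set0) (M0 : 0 < M).

Let S k : C -> C := taylor_sum f (n k).
Let N_ k : R := (n k)%:R.

Hypothesis SK : forall k x, K x -> nrm (S k x) <= M.
Hypothesis fK : forall x z, K x -> stolz 6 x z -> nrm (f z) <= M.

Lemma leq_subseq k : (k <= n k)%N.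
Proof. by elim: k => // k ih; apply: leq_ltn_trans ih _; exact: hn. Qed.

Lemma subseq_archi (a b : R) : 0 < b -> exists k0, forall k, (k0 <= k)%N -> a <= N_ k * b.
Proof.
move=> b0; exists (Num.Def.archi_bound (`|a| / b)) => k hk.
rewrite -ler_pdivrMr //; apply: (@le_trans _ _ (`|a| / b)).
  by apply: ler_wpM2r; [rewrite invr_ge0 ltW|exact: ler_norm].
have := @archi_boundP R (`|a| / b); rewrite divr_ge0 ?(ltW b0) // => /(_ isT) /ltW /le_trans; apply.
by rewrite /N_ ler_nat; apply: leq_trans hk (leq_subseq k).
Qed.

Lemma S_growth (e : R) : 0 < e -> exists k0, forall k x, (k0 <= k)%N -> nrm x = 1 ->
  nrm (S k x) <= M * expR (N_ k * e).
Proof.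
(* The exponent is split in three: one factor exp (N_k e / 3) pays for rho^(- n_k) in the Cauchy
   estimates, one for the number of terms, and one for the constant [D]. *)
move=> e0; pose rho := expR (- (e / 3)).
have e3 : 0 < e / 3 by rewrite divr_gt0.
have rho0 : 0 < rho by exact: expR_gt0.
have rho1 : rho < 1 by rewrite /rho -[X in _ < X]expR0 ltr_expR oppr_lt0.
have [B B0 [aB _]] := taylor_bounds hf rho0 rho1.
pose D := B * (3 / e + 1) / M.
have [k0 k0P] := subseq_archi D e3.
exists k0 => k x hk x1; have kP := k0P k hk.
set E := expR (N_ k * (e / 3)).
have E1 : 1 + N_ k * (e / 3) <= E by exact: expR_ge1Dx.
have E0 : 0 < E by exact: expR_gt0.
have EE : expR (N_ k * e) = E * E * E.
  by rewrite /E -!expRD; congr expR; field.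
have rE : (rho ^+ n k)^-1 = E.
  by rewrite /rho -expRM_natl -expRN; congr expR; rewrite /N_ mulrN opprK.
have step : nrm (S k x) <= (N_ k + 1) * (B * E).
  rewrite /S /taylor_sum; apply: (@le_trans _ _ (\sum_(j < (n k).+1) (B * E))).
    elim/big_ind2: _ => [|a b c d ab cd|j _]; first by rewrite nrm0.
      by apply: le_trans (nrmD _ _) _; exact: lerD.
    rewrite nrmM nrmX x1 expr1n mulr1; apply: le_trans (aB j) _.
    apply: ler_wpM2l => //; rewrite -rE lef_pV2 ?posrE ?exprn_gt0 //.
    by apply: ler_wiXn2l; rewrite ?ltW //; have := ltn_ord j; rewrite ltnS.
  by rewrite sumr_const card_ord -mulr_natl /N_ -natr1.
apply: le_trans step _; rewrite EE.
have N0 : 0 <= N_ k by rewrite /N_.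
have h1 : N_ k + 1 <= (3 / e + 1) * E.
  apply: (@le_trans _ _ ((3 / e + 1) * (1 + N_ k * (e / 3)))); last first.
    by apply: ler_wpM2l => //; rewrite addr_ge0 // divr_ge0 // ltW.
  have -> : (3 / e + 1) * (1 + N_ k * (e / 3)) = N_ k + 1 + 3 / e + N_ k * (e / 3).
    by field; rewrite gt_eqF.
  have q1 : 0 <= 3 / e by rewrite divr_ge0 // ltW.
  have q2 : 0 <= N_ k * (e / 3) by rewrite mulr_ge0 // ltW.
  lra.
have h2 : D <= E by apply: le_trans kP _; apply: le_trans E1; rewrite lerDr.
apply: (@le_trans _ _ ((3 / e + 1) * E * (B * E))).
  by apply: ler_wpM2r => //; rewrite mulr_ge0 // ltW.
have -> : (3 / e + 1) * E * (B * E) = M * D * (E * E).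
  by rewrite /D; field; rewrite !gt_eqF.
have -> : M * (E * E * E) = M * E * (E * E) by ring.
by apply: ler_wpM2r; [apply: mulr_ge0; exact: ltW|rewrite ler_pM2l].
Qed.

Definition log_max k (x : C) : R := ln (Num.max (nrm (S k x)) M).

Lemma log_max_ge k x : ln M <= log_max k x.
Proof. by rewrite /log_max ler_ln ?posrE // ?le_max ?lexx ?orbT // lt_max M0 orbT. Qed.

Lemma log_max_le k x (a : R) : nrm (S k x) <= M * expR a -> 0 <= a -> log_max k x <= ln M + a.
Proof.
move=> h a0; rewrite /log_max -[a in leRHS]expRK -lnM ?posrE ?expR_gt0 //.
rewrite ler_ln ?posrE ?mulr_gt0 ?expR_gt0 // ?lt_max ?M0 ?orbT // ge_max h /=.
by rewrite ler_peMr ?(ltW M0) // -expR0 ler_expR.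
Qed.

Lemma log_maxK k x : nrm (S k x) <= expR (log_max k x).
Proof. by rewrite /log_max lnK ?posrE ?le_max ?lexx // lt_max M0 orbT. Qed.

Lemma cont_log_max k D : cont_on D (log_max k).
Proof.
have [_ _ cS] := @cder_ex_cont R D (S k) (fun z _ => cder_taylor_sum f (n k) z).
have cm := cont_on_max M cS.
by apply: (@cont_on_comp _ _ _ (@ln R) _ cm) => w _; apply: continuous_ln; rewrite lt_max M0 orbT.
Qed.

Lemma bm_log_max k : bm (log_max k).
Proof. exact/cont_on_bm/cont_log_max. Qed.

(** The cut at 1 makes the supremum over k finite at every point from the start; by [rate_small] it
    is inactive on the circle for large k. *)
Definition rate k (x : C) : R := Num.min ((log_max k x - ln M) / N_ k) 1.

Lemma rate_ge0 k x : 0 <= rate k x.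
Proof. by rewrite le_min ler01 andbT divr_ge0 ?subr_ge0 ?log_max_ge // /N_ ler0n. Qed.

Lemma rate_le1 k x : rate k x <= 1.
Proof. by rewrite ge_min lexx orbT. Qed.

Lemma rate_small (e : R) : 0 < e -> exists k0, forall k x, (k0 <= k)%N -> nrm x = 1 ->
  (log_max k x - ln M) / N_ k <= e.
Proof.
move=> e0; have [k0 k0P] := S_growth e0; exists k0 => k x hk x1.
have := log_max_le (k0P k x hk x1) (mulr_ge0 (ler0n _ _) (ltW e0)).
rewrite -lerBlDl /N_; case: (n k) => [|m] h; first by rewrite invr0 mulr0 ltW.
by rewrite ler_pdivrMr ?ltr0n // mulrC.
Qed.

Lemma bm_rate k : bm (rate k).
Proof.
apply: cont_on_bm.
have -> : rate k = (fun x => Num.min ((N_ k)^-1 * (log_max k x + - ln M)) 1).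
  by apply/funext => x; rewrite /rate mulrC.
exact: cont_on_min _ (cont_onZ _ (cont_onD (@cont_log_max k _) (@cont_on_cst _ _ _))).
Qed.

Definition env N (x : C) : R := sups (rate ^~ x) N.

Lemma rate_le_env N k x : (N <= k)%N -> rate k x <= env N x.
Proof.
move=> Nk; apply: ub_le_sup; last by exists k.
by exists 1 => _ [j _ <-]; exact: rate_le1.
Qed.

Lemma env_le N x (a : R) : (forall k, (N <= k)%N -> rate k x <= a) -> env N x <= a.
Proof.
move=> h; apply: ge_sup; first by exists (rate N x), N => //=.
by move=> _ [k /= Nk <-]; exact: h.
Qed.

Lemma env_ge0 N x : 0 <= env N x.
Proof. exact: le_trans (rate_ge0 N x) (rate_le_env x (leqnn N)). Qed.

Lemma bm_env N : bm (env N).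
Proof.
split; last first.
  exists 1 => x _; rewrite ger0_norm ?env_ge0 //.
  by apply: env_le => k _; exact: rate_le1.
apply: (@measurable_fun_sups _ _ _ T (fun k (x : borelCC R) => rate k x)).
  by move=> x _; exists 1 => _ [k _ <-]; exact: rate_le1.
by move=> k; have [] := bm_rate k.
Qed.

Lemma env_mono N N' x : (N <= N')%N -> env N' x <= env N x.
Proof.
by move=> NN; apply: env_le => k kN; apply: rate_le_env; exact: leq_trans kN.
Qed.

Lemma env_small (e : R) : 0 < e -> exists N1, forall N x, (N1 <= N)%N -> nrm x = 1 -> env N x <= e.
Proof.
move=> e0; have [k0 k0P] := rate_small e0; exists k0 => N x hN x1.
apply: env_le => k Nk; rewrite /rate ge_min k0P //; exact: leq_trans Nk.
Qed.

Lemma log_max_K k x : K x -> log_max k x = ln M.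
Proof. by move=> Kx; rewrite /log_max max_r // SK. Qed.

Lemma env_K N x : K x -> env N x = 0.
Proof.
move=> Kx; apply/eqP; rewrite eq_le env_ge0 andbT; apply: env_le => k _.
by rewrite /rate log_max_K // subrr mul0r ge_min lexx.
Qed.

(** From some index on the cut in [rate] is inactive; k >= 1 moreover makes n_k positive, so that
    the division by n_k can be undone. *)
Lemma env_start : exists N1, forall N k x, (N1 <= N)%N -> (N <= k)%N -> nrm x = 1 ->
  (0 < n k)%N /\ log_max k x <= ln M + N_ k * env N x.
Proof.
have [k0 k0P] := rate_small (@ltr01 R); exists (maxn k0 1) => N k x hN Nk x1.
have hk : (maxn k0 1 <= k)%N by exact: leq_trans Nk.
have nk : (0 < n k)%N by apply: leq_trans (leq_subseq k); apply: leq_trans hk; exact: leq_maxr.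
split=> //; have r1 := k0P k x (leq_trans (leq_maxl _ _) hk) x1.
have := rate_le_env x Nk; rewrite /rate min_l // ler_pdivrMr ?ltr0n // => h.
by rewrite mulrC -lerBlDl.
Qed.

(** The loss (2 / (1 + r))^(n_k) of [poly_radial_majorant] becomes ln (2 / (1 + r)) after taking
    logarithms and dividing by n_k. It no longer depends on k, so the estimate passes to the
    supremum. *)
Lemma env_superharmonic : exists N1, forall N r x, (N1 <= N)%N -> 0 <= r < 1 -> nrm x = 1 ->
  env N x <= ln (2 / (1 + r)) + poisson (env N) (cofr r * x).
Proof.
have [N1 N1P] := env_start; exists N1 => N r x hN r01 x1.
have /andP[r0 r1] := r01; have rx := radial_lt1 r01 x1.
apply: env_le => k Nk; have [nk _] := N1P N k x hN Nk x1.
have nk0 : 0 < N_ k by rewrite /N_ ltr0n.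
have /andP[l0 l1] := ln_ratio r01; set l := ln (2 / (1 + r)) in l0 *.
have P0 : 0 <= poisson (env N) (cofr r * x) by apply: poisson_ge0 => // y _; exact: env_ge0.
rewrite /rate ge_min; apply/orP; left; rewrite ler_pdivrMr // lerBlDl.
apply: log_max_le; last by rewrite mulr_ge0 // ?addr_ge0 // ltW.
pose p := \poly_(j < (n k).+1) (derive1n j f 0 / j`!%:R).
have pE y : p.[y] = S k y by rewrite /p horner_poly.
rewrite -pE; apply: le_trans (@poly_radial_majorant R p (n k) r M x (size_poly _ _) r01 M0 x1) _.
have -> : (2 / (1 + r)) ^+ n k = expR (N_ k * l).
  by rewrite expRM_natl /l lnK // posrE divr_gt0 //; lra.
have -> : M * expR ((l + poisson (env N) (cofr r * x)) * N_ k) =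
   expR (N_ k * l) * expR (ln M + N_ k * poisson (env N) (cofr r * x)).
  rewrite -expRD -{1}(lnK (M0 : M \is Num.pos)) -expRD; congr expR; ring.
rewrite ler_pM2l ?expR_gt0 // ler_expR.
have bl : bm (fun y => ln M + N_ k * env N y).
  by apply: bmD; [exact: bm_cst|apply: bmZ; exact: bm_env].
rewrite -(poissonZ _ (bm_env N) rx) -{1}(poisson_cst (ln M) rx) -poissonD //; last 2 first.
- exact: bm_cst.
- by apply: bmZ; exact: bm_env.
apply: poisson_le => //.
  by apply: bm_eq (bm_log_max k) => y _; rewrite /log_max -pE.
by move=> y y1; rewrite pE; have [] := N1P N k y hN Nk y1.
Qed.

Lemma S_disc_bound : exists N1, forall N k w, (N1 <= N)%N -> (N <= k)%N -> nrm w < 1 ->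
  nrm (S k w) <= M * expR (N_ k * poisson (env N) w).
Proof.
have [N1 N1P] := env_start; exists N1 => N k w hN Nk w1.
have two1 : 1 < (2 : R) by lra.
apply: le_trans (@poisson_majorant R (S k) 2 M w two1 M0
  (fun z _ => cder_taylor_sum f (n k) z) w1) _.
rewrite -{2}(lnK (M0 : M \is Num.pos)) -expRD ler_expR.
rewrite -(poissonZ _ (bm_env N) w1) -(poisson_cst (ln M) w1) -poissonD //; last 2 first.
- exact: bm_cst.
- by apply: bmZ; exact: bm_env.
apply: poisson_le => //; first exact: bm_log_max.
  by apply: bmD; [exact: bm_cst|apply: bmZ; exact: bm_env].
by move=> y y1; have [] := N1P N k y hN Nk y1.
Qed.

(** This is why the difference is squared. Cauchy's estimate only gives |S_k - f| <= D (|w| /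
    rho)^(n_k + 1) with rho < 1, which does not compensate |w|^(- n_k); after squaring, (|w| /
    rho^2)^(n_k) is left, and it tends to 0 uniformly on |w| <= q < rho^2. *)
Lemma compact_part (q : R) : 0 < q -> q < 1 -> exists k1, forall k w, (k1 <= k)%N ->
  0 < nrm w -> nrm w <= q -> nrm (S k w - f w) ^+ 2 * (nrm w ^+ n k)^-1 <= 4 * M ^+ 2.
Proof.
move=> q0 q1; pose rho := (1 + q) / 2.
have rho0 : 0 < rho by rewrite /rho; lra.
have rho1 : rho < 1 by rewrite /rho; lra.
have qr : q < rho by rewrite /rho; lra.
have qr2 : q < rho ^+ 2.
  have : 0 < (1 - q) ^+ 2 by rewrite exprn_gt0 // subr_gt0.
  by rewrite /rho expr_div_n; lra.
have [B B0 [_ hB]] := taylor_bounds hf rho0 rho1.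
pose D := B / (1 - q / rho).
have qr1 : q / rho < 1 by rewrite ltr_pdivrMr // mul1r.
have D0 : 0 <= D by rewrite divr_ge0 // subr_ge0 ltW.
pose t := q / rho ^+ 2.
have r20 : 0 < rho ^+ 2 by exact: exprn_gt0.
have t0 : 0 <= t by rewrite divr_ge0 // ltW.
have t1 : t < 1 by rewrite ltr_pdivrMr // mul1r.
have [m0 m0P] : exists m0, forall m, (m0 <= m)%N -> D ^+ 2 * t ^+ m <= 4 * M ^+ 2.
  have e0 : 0 < 4 * M ^+ 2 / (D ^+ 2 + 1).
    by rewrite divr_gt0 ?mulr_gt0 ?exprn_gt0 // ltr_wpDl ?sqr_ge0.
  have := @cvg_expr R t; rewrite ger0_norm // => /(_ t1) /cvgrPdist_lt/(_ _ e0)[m0 _ hm].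
  exists m0 => m hm0; have := hm m hm0; rewrite sub0r normrN ger0_norm ?exprn_ge0 //.
  rewrite ltr_pdivlMr ?ltr_wpDl ?sqr_ge0 // => /ltW; apply: le_trans.
  by rewrite mulrC; apply: ler_wpM2l; [exact: exprn_ge0|rewrite lerDl].
exists m0 => k w hk w0 wq.
have wr : nrm w < rho by exact: le_lt_trans qr.
have hw := hB (n k) w wr.
have wrho : nrm w / rho <= q / rho by rewrite ler_pM2r ?invr_gt0.
have {}hw : nrm (S k w - f w) <= D * (nrm w / rho) ^+ (n k).+1.
  apply: le_trans hw _; rewrite /D mulrAC; apply: ler_wpM2r.
    by rewrite exprn_ge0 // divr_ge0 // ltW.
  apply: ler_wpM2l => //; rewrite lef_pV2 ?posrE; lra.
apply: (@le_trans _ _ (D ^+ 2 * (nrm w / rho ^+ 2) ^+ n k)).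
  rewrite ler_pdivrMr ?exprn_gt0 //.
  apply: (@le_trans _ _ ((D * (nrm w / rho) ^+ (n k).+1) ^+ 2)).
    by rewrite ler_pXn2r ?nnegrE // mulr_ge0 // exprn_ge0 // divr_ge0 // ltW.
  rewrite [(D * _) ^+ 2]exprMn -[leRHS]mulrA; apply: ler_wpM2l; first exact: exprn_ge0.
  have -> : ((nrm w / rho) ^+ (n k).+1) ^+ 2 = (nrm w / rho) ^+ 2 * ((nrm w / rho) ^+ 2) ^+ n k.
    by rewrite -exprM mulnC exprM exprS.
  have -> : (nrm w / rho ^+ 2) ^+ n k * nrm w ^+ n k = ((nrm w / rho) ^+ 2) ^+ n k.
    by rewrite -exprMn; congr (_ ^+ _); field; rewrite gt_eqF.
  have a0 : 0 <= nrm w / rho by rewrite divr_ge0 // ltW.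
  have a1 : nrm w / rho <= 1 by lra.
  by apply: ler_piMl; [exact/exprn_ge0/exprn_ge0|exact: exprn_ile1].
apply: le_trans (m0P (n k) _); last by apply: leq_trans hk _; exact: leq_subseq.
apply: ler_wpM2l; first exact: exprn_ge0.
apply: lerXn2r; rewrite ?nnegrE //; last by rewrite /t ler_pM2r ?invr_gt0.
by rewrite divr_ge0 // ltW.
Qed.

(** A distance at most 5 (1 - |w|) provides a point of K at distance less than 6 (1 - |w|), whence
    the aperture 6 in the assumption on f. *)
Lemma approach_bound : exists N1, forall N k w, (N1 <= N)%N -> (N <= k)%N -> nrm w < 1 ->
  dist_to K w <= 5 * (1 - nrm w) ->
  nrm (S k w - f w) ^+ 2 <= 4 * M ^+ 2 * expR (2 * (N_ k * poisson (env N) w)).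
Proof.
have [N1 N1P] := S_disc_bound; exists N1 => N k w hN Nk w1 dw.
have Sw := N1P N k w hN Nk w1.
have P0 : 0 <= N_ k * poisson (env N) w.
  by rewrite mulr_ge0 ?ler0n // poisson_ge0 // => y _; exact: env_ge0.
move: P0 Sw; set a := N_ k * _ => a0 Sw.
have [x Kx xw] : exists2 x, K x & nrm (w - x) < 6 * (1 - nrm w).
  by apply: dist_to_lt => //; lra.
have fw : nrm (f w) <= M.
  by apply: (fK Kx); apply/stolzE.
have e1 : 1 <= expR a by rewrite -[X in X <= _]expR0 ler_expR.
have -> : 4 * M ^+ 2 * expR (2 * a) = (2 * M * expR a) ^+ 2.
  have -> : expR (2 * a) = expR a * expR a by rewrite -expRD; congr expR; ring.
  by ring.
rewrite lerXn2r ?nnegrE // ?mulr_ge0 ?expR_ge0 // ?(ltW M0) //.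
have Me : M <= M * expR a by rewrite ler_peMr // ltW.
by apply: le_trans (nrmD _ _) _; rewrite nrmN; lra.
Qed.

(** The slope 5 is 1 + 4: circle points within 4 (1 - |w|) of w, the range used by [poisson_lower],
    are still at distance at least 1 - |w| from K. *)
Lemma trunc_dist_lower (eta : R) w : 0 < eta -> nrm w < 1 -> 1 - nrm w <= eta ->
  5 * (1 - nrm w) <= dist_to K w -> 3 / 16 * (1 - nrm w) <= poisson (trunc_dist K eta) w.
Proof.
move=> e0 w1 we dw; apply: poisson_lower => //.
- exact: bm_trunc_dist.
- by move=> y _; apply: trunc_dist_ge0 => //; exact: ltW.
- by rewrite subr_ge0 ltW.
move=> y _ yw; rewrite le_min we andbT.
by have := dist_to_lip K0 w y; rewrite [nrm (w - y)]nrmB; lra.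
Qed.

(** A compact piece of the sawtooth region: the inner cut keeps w^(- n) holomorphic, and the outer
    cut at r < 1 keeps the piece inside the disc. *)
Definition approach_region (r : R) : set C :=
  [set w | [/\ 1 / 2 <= nrm w, nrm w <= r & dist_to K w <= 5 * (1 - nrm w)]].

Lemma compact_approach_region r : compact (approach_region r).
Proof.
apply: (@compact_closed_nrm _ _ r); last by move=> w [].
apply: closed_nrm => w nw.
have [h1|h1] := ltP (nrm w) (1 / 2).
  exists (1 / 2 - nrm w); first by rewrite subr_gt0.
  by move=> v vw [v1 _ _]; have := nrm_sub_le v w; lra.
have [h2|h2] := ltP r (nrm w).
  exists (nrm w - r); first by rewrite subr_gt0.
  by move=> v vw [_ v1 _]; have := nrm_sub_le w v; rewrite nrmB; lra.
have [h3|h3] := ltP (5 * (1 - nrm w)) (dist_to K w); last by case: nw.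
(* The distance to K is 1-Lipschitz and 5 (1 - |w|) is 5-Lipschitz, whence the division by 6. *)
exists ((dist_to K w - 5 * (1 - nrm w)) / 6); first by rewrite divr_gt0 // subr_gt0.
move=> v vw [_ _ v1]; have := nrm_sub_le w v; have := dist_to_lip K0 w v.
by rewrite [nrm (w - v)]nrmB; lra.
Qed.

Lemma approach_region_interior r w : 1 / 2 < nrm w -> nrm w < r ->
  dist_to K w < 5 * (1 - nrm w) ->
  exists2 d : R, 0 < d & forall v, nrm (v - w) < d -> approach_region r v.
Proof.
move=> w0 w1 dw.
exists (Num.min (nrm w - 1 / 2) (Num.min (r - nrm w) ((5 * (1 - nrm w) - dist_to K w) / 6))).
  by rewrite !lt_min !subr_gt0 w0 w1 divr_gt0 // subr_gt0.
move=> v; rewrite !lt_min => /and3P[h1 h2 h3].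
have := nrm_sub_le w v; have := nrm_sub_le v w; have := dist_to_lip K0 v w.
by rewrite [nrm (w - v)]nrmB => *; split; lra.
Qed.

(* The factor 6 makes 2 * 6 * (3 / 16) >= 2: on the sides of the region the
   distance term then absorbs |w|^(- n) <= exp (2 n (1 - |w|)). *)
Definition barrier (eta : R) N (x : C) : R := env N x + 6 * trunc_dist K eta x.

Lemma bm_barrier eta N : bm (barrier eta N).
Proof. by apply: bmD (bm_env N) _; apply: bmZ; exact: bm_trunc_dist. Qed.

Lemma poisson_barrier eta N w : nrm w < 1 ->
  poisson (barrier eta N) w = poisson (env N) w + 6 * poisson (trunc_dist K eta) w.
Proof.
move=> w1; rewrite -(poissonZ _ (bm_trunc_dist K0 eta) w1) -poissonD //.
  exact: bm_env.
by apply: bmZ; exact: bm_trunc_dist.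
Qed.

(** Three kinds of boundary points: for |w| <= 1 - eta, which covers the inner cut, [compact_part]
    suffices; on |w| = r the factor r^(- n_k) is part of the bound; on the lateral sides the
    distance term of the barrier pays for |w|^(- n_k). The threshold k1 does not depend on r, so r
    may tend to 1 with k fixed. *)
Lemma barrier_boundary : exists N1, forall N (eta : R), (N1 <= N)%N -> 0 < eta -> eta <= 1 / 2 ->
  exists k1, forall k r w, (k1 <= k)%N -> r < 1 -> approach_region r w ->
    ~ (exists2 d : R, 0 < d & forall v, nrm (v - w) < d -> approach_region r v) ->
    nrm (S k w - f w) ^+ 2 * (nrm w ^+ n k)^-1 <=
      4 * M ^+ 2 * (r ^+ n k)^-1 * expR (2 * (N_ k * poisson (barrier eta N) w)).
Proof.
have [N1 N1P] := approach_bound; exists N1 => N eta hN e0 e1.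
have [||k1 k1P] := @compact_part (1 - eta); try lra.
exists (maxn N k1) => k r w; rewrite geq_max => /andP[Nk hk] r1 [w0 wr dw] nint.
have w1 : nrm w < 1 by exact: le_lt_trans r1.
have wp : 0 < nrm w by lra.
have Pt : 0 <= poisson (trunc_dist K eta) w.
  by apply: poisson_ge0 => // y _; apply: trunc_dist_ge0 => //; exact: ltW.
have Pe : 0 <= poisson (env N) w by apply: poisson_ge0 => // y _; exact: env_ge0.
have N0 : 0 <= N_ k by exact: ler0n.
have M2 : 0 <= 4 * M ^+ 2 by rewrite mulr_ge0 // exprn_ge0 // ltW.
have bound := N1P N k w hN Nk w1 dw.
rewrite poisson_barrier //.
have rk1 : 1 <= (r ^+ n k)^-1.
  rewrite invf_ge1 ?exprn_gt0 ?(lt_le_trans wp) //.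
  by rewrite exprn_ile1 // ?(ltW r1) // (le_trans _ wr) // ltW.
have wk0 : 0 < nrm w ^+ n k by rewrite exprn_gt0.
have small_exp a : 0 <= a -> 1 <= expR a :> R.
  by move=> a0; rewrite -[X in X <= _]expR0 ler_expR.
have [wq|wq] := leP (nrm w) (1 - eta).
  apply: le_trans (k1P k w hk wp wq) _; rewrite -mulrA ler_peMr //.
  rewrite mulr_ege1 // small_exp // mulr_ge0 // mulr_ge0 // addr_ge0 // mulr_ge0 //.
have [wE|wN] := eqVneq (nrm w) r.
  rewrite wE [leRHS]mulrAC ler_pM2r ?invr_gt0 -?wE //; apply: le_trans bound _.
  apply: ler_wpM2l => //; rewrite ler_expR ler_pM2l // ler_wpM2l // lerDl mulr_ge0 //.
have dE : 5 * (1 - nrm w) <= dist_to K w.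
  rewrite leNgt; apply/negP => dlt; apply: nint; apply: approach_region_interior => //; first lra.
  by rewrite lt_neqAle wN.
have tl := trunc_dist_lower e0 w1 _ dE.
have {}tl : 3 / 16 * (1 - nrm w) <= poisson (trunc_dist K eta) w by apply: tl; lra.
rewrite ler_pdivrMr //; apply: le_trans bound _.
rewrite -[X in _ <= X]mulrA -[X in _ <= X]mulrA; apply: ler_wpM2l => //.
set E := expR (2 * (N_ k * (_ + _))).
apply: (@le_trans _ _ (1 * (E * nrm w ^+ n k))); last first.
  by apply: ler_wpM2r => //; rewrite mulr_ge0 ?expR_ge0 // ltW.
(* With t = 1 - |w| <= 1 / 2 this is exp (- 2 t) <= 1 / (1 + 2 t) <= 1 - t. *)
have wexp : expR (- (2 * (1 - nrm w))) <= nrm w.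
  rewrite expRN; apply: (@le_trans _ _ (1 + 2 * (1 - nrm w))^-1).
    by rewrite lef_pV2 ?posrE ?expR_gt0 ?expR_ge1Dx //; lra.
  by rewrite invf_ple ?posrE //; [rewrite -div1r ler_pdivrMr //; nra|lra].
have wexpn : expR (- (2 * (1 - nrm w)) * N_ k) <= nrm w ^+ n k.
  by rewrite mulrC expRM_natl; apply: lerXn2r; rewrite ?nnegrE ?expR_ge0 // ltW.
rewrite mul1r; apply: (@le_trans _ _ (E * expR (- (2 * (1 - nrm w)) * N_ k))).
  rewrite /E -expRD ler_expR; move: tl N0.
  generalize (N_ k) (poisson (env N) w) (poisson (trunc_dist K eta) w) => A B D tl N0.
  by nra.
by rewrite ler_pM2l ?expR_gt0.
Qed.

Lemma cder_ex_invX m (w : C) : w != 0 -> exists a, cder (fun v => v^-1 ^+ m) w a.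
Proof.
move=> w0; case: m => [|m]; first by exists 0; exact: cder_cst.
eexists; exact: (@cder_comp R (fun v => v ^+ m.+1) (fun v => v^-1) w _ _ (cderX m _) (cderV w0)).
Qed.

(** The maximum principle is applied to [phi] on the region cut at r, for every r < 1; with k fixed,
    r^(- n_k) disappears as r tends to 1. *)
Lemma approach_bound_barrier : exists N1, forall N (eta : R), (N1 <= N)%N -> 0 < eta -> eta <= 1 / 2 ->
  exists k1, forall k z, (k1 <= k)%N -> 1 / 2 <= nrm z -> nrm z < 1 ->
    dist_to K z <= 5 * (1 - nrm z) ->
    nrm (S k z - f z) ^+ 2 <=
      4 * M ^+ 2 * nrm z ^+ n k * expR (2 * (N_ k * poisson (barrier eta N) z)).
Proof.
have [N1 N1P] := barrier_boundary; exists N1 => N eta hN e0 e1.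
have [k1 k1P] := N1P N eta hN e0 e1; exists k1 => k z hk z0 z1 dz.
have [H HP] := herglotz (bm_barrier eta N).
pose phi w := (S k w - f w) * (S k w - f w) * w^-1 ^+ n k * cexp (- cofr (2 * N_ k) * H w).
have nphi w : nrm w < 1 -> nrm (phi w) = nrm (S k w - f w) ^+ 2 * (nrm w ^+ n k)^-1 *
    expR (- (2 * (N_ k * poisson (barrier eta N) w))).
  move=> w1; have [HE _] := HP w w1.
  rewrite /phi !nrmM nrmX nrmV nrm_cexp exprVn; congr (_ * expR _).
  by rewrite -cofrN reimE HE cre_cofr cim_cofr mul0r subr0 mulNr mulrA.
have dphi w : 0 < nrm w -> nrm w < 1 -> exists a, cder phi w a.
  move=> wp w1; have [_ [a dH]] := HP w w1.
  have [b dS] := cder_taylor_sum f (n k) w.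
  have [c df] := derivable_cder (hf (proj2 (discE w) w1)).
  have [d dX] := @cder_ex_invX (n k) w (etrans (esym (nrm_gt0 w)) wp).
  have dh := cderB dS df.
  have dE := @cder_comp R (@cexp R) (fun v => - cofr (2 * N_ k) * H v) w _ _
    (@cder_cexp R _) (cderZ _ dH).
  by eexists; exact: cderM (cderM (cderM dh dh) dX) dE.
have M2 : 0 < 4 * M ^+ 2 by rewrite mulr_gt0 // exprn_gt0.
have nz : 0 < nrm z by lra.
have main r : nrm z <= r -> r < 1 -> nrm (phi z) <= 4 * M ^+ 2 * (r ^+ n k)^-1.
  move=> zr r1; have rp : 0 < r by exact: lt_le_trans zr.
  apply: (@max_principle R (approach_region r) phi _ (@compact_approach_region r)); last by split.
  - by move=> w [w0 wr _]; apply: dphi; lra.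
  - by rewrite mulr_ge0 ?invr_ge0 ?exprn_ge0 // ltW.
  move=> w Qw nint; have := k1P k r w hk r1 Qw nint; have [w0 wr _] := Qw.
  rewrite nphi ?(le_lt_trans wr) // => h.
  by rewrite expRN ler_pdivrMr ?expR_gt0.
have : nrm (phi z) <= 4 * M ^+ 2.
  (* Dividing by n_(k+1), which is positive even when n_k = 0, gives q^(- n_k) = exp (t n_k /
     n_(k+1)) <= exp t. *)
  apply: le_expR_eps => // t t0; pose q := expR (- (t / N_ k.+1)).
  have Np : 0 < N_ k.+1 by rewrite ltr0n (leq_trans _ (leq_subseq _)).
  have q1 : q < 1 by rewrite /q -[X in _ < X]expR0 ltr_expR oppr_lt0 divr_gt0.
  have qp : 0 < q by exact: expR_gt0.
  have zq : nrm z <= Num.max (nrm z) q by rewrite le_max lexx.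
  have mq1 : Num.max (nrm z) q < 1 by rewrite gt_max z1.
  apply: le_trans (main _ zq mq1) _; rewrite mulrC; apply: ler_wpM2r; first exact: ltW.
  have mp : 0 < Num.max (nrm z) q by rewrite lt_max nz.
  apply: (@le_trans _ _ (q ^+ n k)^-1).
    rewrite lef_pV2 ?posrE ?exprn_gt0 //; apply: lerXn2r.
    - exact: ltW.
    - exact: ltW.
    - by rewrite le_max lexx orbT.
  rewrite -expRM_natl -expRN ler_expR mulrN opprK.
  rewrite mulrCA ger_pMr // ler_pdivrMr // mul1r ler_nat.
  by apply: ltnW; apply: hn.
rewrite nphi // expRN ler_pdivrMr ?expR_gt0 // ler_pdivrMr ?exprn_gt0 //.
by rewrite mulrAC.
Qed.

(** On the circle |y - x|^2 = Re (2 - 2 conj x * y), which is harmonic in y and equals 2 - 2 r at r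
    x. A quadratic penalty thus costs only a multiple of 1 - r. *)
Lemma poisson_sqr_dist (r : R) x : 0 <= r < 1 -> nrm x = 1 ->
  poisson (fun y => nrm (y - x) ^+ 2) (cofr r * x) = 2 * (1 - r).
Proof.
move=> r01 x1; have rx := radial_lt1 r01 x1.
pose g (y : C) : C := 2 - 2 * cj x * y.
have nE y : nrm y = 1 -> nrm (y - x) ^+ 2 = cre (g y).
  move=> y1; have : nrm y ^+ 2 = 1 by rewrite y1 expr1n.
  have : nrm x ^+ 2 = 1 by rewrite x1 expr1n.
  by rewrite !nrm_sqr /g !reimE => ? ?; lra.
have -> : poisson (fun y => nrm (y - x) ^+ 2) (cofr r * x) =
    poisson (fun y => cre (g y)) (cofr r * x).
  by apply: eq_mean => y y1; rewrite nE.
rewrite (@poisson_harmonic R g 2) //; first last.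
- move=> w _; eexists; apply: cderB (cder_cst _ _) _; exact: cderZ (cder_id w).
- lra.
have : nrm x ^+ 2 = 1 by rewrite x1 expr1n.
by rewrite nrm_sqr /g !reimE => h; nra.
Qed.

(** On K close to x, |S_k y - s| <= 3 e: one e for S_k against S_k0, one for the continuity of S_k0
    alone, one for S_k0 x against s. All other points are charged to the indicator of the complement
    or to |y - x|^2 / d^2, one of which makes the bracket at least 1, and there M exp (N_k env N)
    bounds S_k. *)
Lemma log_dist_bound (e : R) x N0 k0 (s : C) : 0 < e -> K x ->
  (forall k k' y, (N0 <= k)%N -> (N0 <= k')%N -> K y -> nrm (S k y - S k' y) <= e) ->
  (N0 <= k0)%N -> nrm (S k0 x - s) <= e ->
  exists2 d : R, 0 < d & exists N1, forall N k y, (N1 <= N)%N -> (N <= k)%N -> nrm y = 1 ->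
    ln (Num.max (nrm (S k y - s)) (3 * e)) <= ln (3 * e) +
      ln ((2 * M + 3 * e) / (3 * e)) * (\1_(~` K) y + nrm (y - x) ^+ 2 / d ^+ 2) +
      N_ k * env N y.
Proof.
move=> e0 Kx hC Nk0 k0s.
have [a dS] := cder_taylor_sum f (n k0) x; have [d d0 dP] := cder_cont dS e0.
have [N1 N1P] := env_start; exists d => //; exists (maxn N0 N1) => N k y.
rewrite geq_max => /andP[hN0 hN1] Nk y1.
have e3 : 0 < 3 * e by rewrite mulr_gt0.
have mx : 0 < Num.max (nrm (S k y - s)) (3 * e) by rewrite lt_max e3 orbT.
set B := ln (_ / _); have B0 : 0 <= B.
  by rewrite ln_ge0 // ler_pdivlMr // mul1r lerDr mulr_ge0 // ltW.
have BE : ln (3 * e) + B = ln (2 * M + 3 * e).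
  have p0 : 0 < 2 * M + 3 * e by rewrite addr_gt0 // mulr_gt0.
  by rewrite -lnM ?posrE // ?divr_gt0 // mulrC divfK // gt_eqF.
have sM : nrm s <= M + e.
  have := nrm_triangle s (S k0 x) 0; rewrite !subr0 nrmB.
  by have := SK k0 Kx; lra.
have nE : 0 <= N_ k * env N y by rewrite mulr_ge0 ?ler0n ?env_ge0.
have q0 : 0 <= nrm (y - x) ^+ 2 / d ^+ 2 by rewrite divr_ge0 ?exprn_ge0 // ltW.
have far : 1 <= \1_(~` K) y + nrm (y - x) ^+ 2 / d ^+ 2 ->
  ln (Num.max (nrm (S k y - s)) (3 * e)) <= ln (3 * e) +
      B * (\1_(~` K) y + nrm (y - x) ^+ 2 / d ^+ 2) + N_ k * env N y.
  move=> h1; apply: (@le_trans _ _ (ln (2 * M + 3 * e) + N_ k * env N y)); last first.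
    by rewrite -BE lerD2r lerD2l ler_peMr.
  have p0 : 0 < 2 * M + 3 * e by rewrite addr_gt0 // mulr_gt0.
  have E1 : 1 <= expR (N_ k * env N y) by rewrite -[X in X <= _]expR0 ler_expR.
  rewrite -[N_ k * env N y]expRK -lnM ?posrE ?expR_gt0 //.
  rewrite ler_ln ?posrE ?mulr_gt0 ?expR_gt0 // ge_max; apply/andP; split; last first.
    by apply: (@le_trans _ _ (2 * M + 3 * e)); rewrite ?lerDr ?ler_peMr ?mulr_ge0 ?(ltW M0) ?(ltW p0).
  have [_ lk] := N1P N k y hN1 Nk y1.
  have Sy : nrm (S k y) <= M * expR (N_ k * env N y).
    apply: le_trans (log_maxK k y) _.
    by rewrite -{1}(lnK (M0 : M \is Num.pos)) -expRD ler_expR.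
  apply: le_trans (nrmD _ _) _; rewrite nrmN.
  move: E1 Sy; generalize (expR (N_ k * env N y)) => E E1 Sy.
  have : M <= M * E by rewrite ler_peMr // ltW.
  have : e <= e * E by rewrite ler_peMr // ltW.
  by lra.
have [Ky|nKy] := pselect (K y); last first.
  by apply: far; rewrite indicE mem_set //= lerDl.
have [yx|yx] := leP d (nrm (y - x)).
  apply: far; rewrite indicE memNset //= ?add0r.
  by rewrite ler_pdivlMr ?exprn_gt0 // mul1r lerXn2r ?nnegrE // ltW.
apply: (@le_trans _ _ (ln (3 * e))); last first.
  have /andP[i0 _] := @indic01 R (~` K) y.
  rewrite -addrA lerDl; apply: addr_ge0 => //; apply: mulr_ge0 => //; exact: addr_ge0.
rewrite ler_ln ?posrE // ge_max lexx andbT.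
have h1 := hC k k0 y (leq_trans hN0 Nk) Nk0 Ky.
have h2 := dP y yx.
have -> : 3 * e = e + (e + e) by ring.
apply: le_trans (nrm_triangle _ (S k0 y) _) _; apply: (lerD h1).
apply: le_trans (nrm_triangle _ (S k0 x) _) _; exact: (lerD (ltW h2) k0s).
Qed.

Lemma taylor_radial_bound (e : R) x N0 k0 (s : C) : 0 < e -> K x ->
  (forall k k' y, (N0 <= k)%N -> (N0 <= k')%N -> K y -> nrm (S k y - S k' y) <= e) ->
  (N0 <= k0)%N -> nrm (S k0 x - s) <= e ->
  exists2 B : R, 0 <= B & exists N1, forall N k r, (N1 <= N)%N -> (N <= k)%N -> 0 <= r < 1 ->
    nrm (S k (cofr r * x) - s) <= 3 * e *
      expR (B * (poisson (\1_(~` K)) (cofr r * x) + (1 - r)) +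
            N_ k * poisson (env N) (cofr r * x)).
Proof.
move=> e0 Kx hC Nk0 k0s.
have x1 : nrm x = 1 by apply/circleE/KT.
have e3 : 0 < 3 * e by rewrite mulr_gt0.
have [d d0 [N1 N1P]] := log_dist_bound e0 Kx hC Nk0 k0s.
set B := ln (_ / _) in N1P; have B0 : 0 <= B.
  by rewrite ln_ge0 // ler_pdivlMr // mul1r lerDr mulr_ge0 // ltW.
(* The summand 2 / d^2 is the Poisson integral of the quadratic penalty, from [poisson_sqr_dist]. *)
exists (B * (1 + 2 / d ^+ 2)).
  by rewrite mulr_ge0 // addr_ge0 // divr_ge0 // exprn_ge0 // ltW.
exists N1 => N k r hN Nk r01; have rx := radial_lt1 r01 x1; have /andP[r0 r1] := r01.
have two1 : 1 < (2 : R) by lra.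
have dp w : exists a, cder (fun y => S k y - s) w a.
  have [a da] := cder_taylor_sum f (n k) w.
  by eexists; exact: cderB da (cder_cst s w).
apply: le_trans (@poisson_majorant R (fun y => S k y - s) 2 (3 * e) (cofr r * x) two1 e3
  (fun w _ => dp w) rx) _.
rewrite -{2}(lnK (e3 : 3 * e \is Num.pos)) -expRD ler_expR.
have bKc : bm (\1_(~` K) : C -> R).
  by apply: bm_indic; apply: measurableC; exact: measurable_closed_CC.
have bq : bm (fun y => nrm (y - x) ^+ 2).
  apply: cont_on_bm; apply: (@cont_on_comp _ _ _ (fun u => u ^+ 2)) (cont_on_nrm x) => y _.
  exact: exprn_continuous.
pose b1 y := B * \1_(~` K) y; pose b2 y := (B / d ^+ 2) * nrm (y - x) ^+ 2.
pose b3 y := N_ k * env N y.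
have bb1 : bm b1 by exact: bmZ.
have bb2 : bm b2 by exact: bmZ.
have bb3 : bm b3 by apply: bmZ; exact: bm_env.
have bb12 : bm (fun y => b1 y + b2 y) by exact: bmD.
have bb : bm (fun y => b1 y + b2 y + b3 y) by exact: bmD.
apply: (@le_trans _ _ (poisson (fun y => ln (3 * e) + (b1 y + b2 y + b3 y)) (cofr r * x))).
  apply: poisson_le => //; last 1 first.
  - move=> y y1; have := N1P N k y hN Nk y1.
    by rewrite /b1 /b2 /b3 mulrDr [B * (_ / _)]mulrCA [B / _ * _]mulrC !addrA.
  - have [_ _ cp] := @cder_ex_cont R (unit_circle R) _ (fun w _ => dp w).
    apply: cont_on_bm; apply: (@cont_on_comp _ _ _ (@ln R)) (cont_on_max (3 * e) cp) => w _.
    by apply: continuous_ln; rewrite lt_max e3 orbT.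
  - by apply: bmD => //; exact: bm_cst.
rewrite (poissonD (bm_cst _) bb rx) (poissonD bb12 bb3 rx) (poissonD bb1 bb2 rx).
rewrite (poissonZ _ bKc rx) (poissonZ _ bq rx) (poissonZ _ (bm_env N) rx).
rewrite (poisson_cst _ rx) poisson_sqr_dist // lerD2l lerD2r.
have P0 : 0 <= poisson (\1_(~` K)) (cofr r * x).
  by apply: poisson_ge0 => // y _; have /andP[] := @indic01 R (~` K) y.
move: P0; set P := poisson _ _ => P0.
have q0 : 0 <= 2 / d ^+ 2 by rewrite divr_ge0 // exprn_ge0 // ltW.
have -> : B / d ^+ 2 * (2 * (1 - r)) = B * (2 / d ^+ 2 * (1 - r)) by ring.
rewrite -mulrDr -[leRHS]mulrA; apply: ler_wpM2l => //; nra.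
Qed.

(** The value 0 for n_k <= A keeps every radius in [0, 1), so that statements about all k make
    sense; only large k matter. *)
Definition radius A k : R := if (A < n k)%N then 1 - A%:R / N_ k else 0.

Lemma radius_itv A k : (0 < A)%N -> 0 <= radius A k < 1.
Proof.
rewrite /radius => A0; case: ifPn => [An|_]; last by rewrite lexx ltr01.
have n0 : 0 < N_ k by rewrite ltr0n (ltn_trans A0).
rewrite subr_ge0 ler_pdivrMr // mul1r ler_nat (ltnW An) /=.
by rewrite ltrBlDr ltrDl divr_gt0 // ltr0n.
Qed.

Lemma radius_near A (t : R) : 0 < t -> exists k0, forall k, (k0 <= k)%N ->
  1 - radius A k < t /\ N_ k * (1 - radius A k) = A%:R.
Proof.
move=> t0; have mt : 0 < Num.min t 1 by rewrite lt_min t0 ltr01.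
have [k0 k0P] := subseq_archi A.+1%:R mt; exists k0 => k /k0P h.
have An : (A < n k)%N.
  rewrite -(ler_nat R); apply: le_trans h _.
  by rewrite ler_piMr ?ler0n // ge_min lexx orbT.
have n0 : 0 < N_ k by rewrite ltr0n (leq_ltn_trans _ An).
rewrite /radius An opprB addrC subrK; split; last by rewrite mulrC divfK // gt_eqF.
rewrite ltr_pdivrMr //; apply: (@lt_le_trans _ _ A.+1%:R); first by rewrite ltr_nat.
apply: le_trans h _; rewrite mulrC; apply: ler_wpM2r; first exact: ltW.
by rewrite ge_min lexx.
Qed.

Section boundary_point.
Variable x : C.
Hypothesis Kx : K x.
Hypothesis env_sing : forall e : R, 0 < e -> exists N1, forall N, (N1 <= N)%N ->
  (\int[sigma]_(y in T) (sing (env N) x y)%:E <= e%:E)%E.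
Hypothesis dist_sing : forall e : R, 0 < e -> exists2 eta : R, 0 < eta <= 1 / 2 &
  (\int[sigma]_(y in T) (sing (trunc_dist K eta) x y)%:E <= e%:E)%E.
Hypothesis thin : forall A, (0 < A)%N -> forall (e : R) k0, 0 < e ->
  exists2 k, (k0 <= k)%N & poisson (\1_(~` K)) (cofr (radius A k) * x) < e.

Let x1 : nrm x = 1. Proof. exact/circleE/KT. Qed.

Lemma poisson_env_radial (e : R) : 0 < e -> exists N1, forall N r, (N1 <= N)%N -> 0 <= r < 1 ->
  poisson (env N) (cofr r * x) <= e * (1 - r).
Proof.
move=> e0; have e8 : 0 < e / 8 by rewrite divr_gt0.
have [N1 N1P] := env_sing e8; exists N1 => N r hN r01.
have := poisson_le_sing (bm_env N) r01 x1 (fun y _ => env_ge0 N y) (env_K N Kx) (N1P N hN).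
by move=> /le_trans; apply; rewrite le_eqVlt; apply/orP; left; apply/eqP; field.
Qed.

Lemma poisson_trunc_dist_radial (e : R) : 0 < e -> exists2 eta : R, 0 < eta <= 1 / 2 &
  forall r, 0 <= r < 1 -> poisson (trunc_dist K eta) (cofr r * x) <= e * (1 - r).
Proof.
move=> e0; have e8 : 0 < e / 8 by rewrite divr_gt0.
have [eta /andP[h0 h1] hI] := dist_sing e8; exists eta; first by rewrite h0.
move=> r r01.
have := poisson_le_sing (bm_trunc_dist K0 eta) r01 x1
  (fun y _ => trunc_dist_ge0 K0 y (ltW h0)) (trunc_dist_in K0 (ltW h0) Kx) hI.
by move=> /le_trans; apply; rewrite le_eqVlt; apply/orP; left; apply/eqP; field.
Qed.

Lemma radial_error A : (0 < A)%N -> exists k1, forall k, (k1 <= k)%N ->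
  nrm (S k (cofr (radius A k) * x) - f (cofr (radius A k) * x)) <= 2 * M * expR (- (A%:R / 4)).
Proof.
move=> A0; have [N1 N1P] := approach_bound_barrier.
(* 1 / 8 for env N and 6 * (1 / 48) for the distance term add up to 1 / 4, so exp (2 n_k P[barrier])
   <= exp (A / 2). Against |z|^(n_k) <= exp (- A), the square root leaves exp (- A / 4). *)
have c8 : 0 < 1 / 8 :> R by lra.
have c48 : 0 < 1 / 48 :> R by lra.
have [N2 N2P] := poisson_env_radial c8.
have [eta /andP[h0 h1] tP] := poisson_trunc_dist_radial c48.
pose N := maxn N1 N2.
have [k1 k1P] := N1P N eta (leq_maxl _ _) h0 h1.
have half : 0 < 1 / 2 :> R by lra.
have [k2 k2P] := @radius_near A _ half.
exists (maxn k1 k2) => k; rewrite geq_max => /andP[hk1 hk2].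
have [rh NA] := k2P k hk2; have r01 := radius_itv k A0.
move: rh NA r01; set r := radius A k => rh NA r01; have /andP[r0 r1] := r01.
have Pe := N2P N r (leq_maxr _ _) r01; have Pt := tP r r01.
have rx := radial_lt1 r01 x1.
have nr : nrm (cofr r * x) = r by rewrite nrmM nrm_cofr x1 mulr1 ger0_norm.
have rz : nrm (cofr r * x - x) = 1 - r by rewrite nrmB nrm_radial_sub // ltW.
have := k1P k (cofr r * x) hk1; rewrite nr poisson_barrier //.
have dz : dist_to K (cofr r * x) <= 5 * (1 - r).
  by apply: le_trans (dist_to_le _ Kx) _; rewrite rz; lra.
have r2 : 1 / 2 <= r by lra.
move=> /(_ r2 r1 dz) h.
have E0 : 0 < expR (- (A%:R / 4)) :> R by exact: expR_gt0.
rewrite -(@ler_pXn2r _ 2) ?nnegrE // ?mulr_ge0 ?(ltW M0) ?(ltW E0) //.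
apply: le_trans h _.
have -> : (2 * M * expR (- (A%:R / 4))) ^+ 2 =
    4 * M ^+ 2 * (expR (- A%:R) * expR (A%:R / 2)).
  rewrite -expRD; have -> : - A%:R + A%:R / 2 = - (A%:R / 4) + - (A%:R / 4) :> R by field.
  by rewrite expRD; ring.
rewrite -mulrA; apply: ler_wpM2l; first by rewrite mulr_ge0 // exprn_ge0 // ltW.
have rA : r ^+ n k <= expR (- A%:R).
  have -> : expR (- A%:R) = expR (- (1 - r)) ^+ n k :> R.
    by rewrite -expRM_natl -NA; congr expR; rewrite -/(N_ k); ring.
  apply: lerXn2r; rewrite ?nnegrE ?expR_ge0 //.
  by apply: le_trans (expR_ge1Dx _); lra.
apply: ler_pM => //; first exact: exprn_ge0.
rewrite ler_expR -NA -/r; have n0 : 0 <= N_ k by exact: ler0n.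
have -> : N_ k * (1 - r) / 2 = 2 * (N_ k * (1 / 4 * (1 - r))) by field.
apply: ler_wpM2l => //; apply: ler_wpM2l => //; lra.
Qed.

Lemma radial_partial_sum (e : R) N0 k0 (s : C) A : 0 < e -> (0 < A)%N ->
  (forall k k' y, (N0 <= k)%N -> (N0 <= k')%N -> K y -> nrm (S k y - S k' y) <= e) ->
  (N0 <= k0)%N -> nrm (S k0 x - s) <= e ->
  forall k1, exists2 k, (k1 <= k)%N & nrm (S k (cofr (radius A k) * x) - s) <= 4 * e.
Proof.
move=> e0 A0 hC Nk0 k0s k1.
have [B B0 [N1 N1P]] := taylor_radial_bound e0 Kx hC Nk0 k0s.
(* exp c turns 3 e into 4 e. Half of c is spent on n_k P[env N], where n_k (1 - r) = A, and half on
   B (P[1_(~ K)] + (1 - r)), each summand being at most q. *)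
pose c : R := ln (4 / 3); have c0 : 0 < c by rewrite ln_gt0; lra.
have A1 : 0 < A%:R :> R by rewrite ltr0n.
have c1 : 0 < c / 2 / A%:R by rewrite !divr_gt0.
have [N2 N2P] := poisson_env_radial c1.
pose q := c / 4 / (B + 1); have B1 : 0 < B + 1 by rewrite ltr_wpDl.
have q0 : 0 < q by rewrite !divr_gt0.
have [k2 k2P] := @radius_near A q q0.
pose N := maxn N1 N2.
have [k] := thin A0 (maxn k1 (maxn k2 N)) q0.
rewrite 2!geq_max => /and3P[hk1 hk2 hN] thk; exists k => //.
have [rq NA] := k2P k hk2; have r01 := radius_itv k A0.
apply: le_trans (N1P N k _ (leq_maxl _ _) hN r01) _.
have Pe : poisson (env N) (cofr (radius A k) * x) <= c / 2 / A%:R * (1 - radius A k).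
  exact: N2P (leq_maxr N1 N2) r01.
have -> : 4 * e = 3 * e * expR c.
  by rewrite /c lnK ?posrE; [field|lra].
apply: ler_wpM2l; first by rewrite mulr_ge0 // ltW.
rewrite ler_expR; move: rq NA thk Pe.
generalize (poisson (\1_(~` K)) (cofr (radius A k) * x)) => P.
generalize (poisson (env N) (cofr (radius A k) * x)) => P'.
move: r01; generalize (radius A k) => r r01 rq NA thk Pe.
have h1 : B * (P + (1 - r)) <= c / 2.
  have : B * (P + (1 - r)) <= B * (q + q) by apply: ler_wpM2l => //; lra.
  move=> /le_trans; apply; have -> : c / 2 = (B + 1) * (q + q).
    by rewrite /q; field; rewrite gt_eqF.
  by apply: ler_wpM2r; [lra|rewrite lerDl].
have h2 : N_ k * P' <= c / 2.
  have : N_ k * P' <= N_ k * (c / 2 / A%:R * (1 - r)) by apply: ler_wpM2l; rewrite ?ler0n.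
  move=> /le_trans; apply; rewrite mulrCA NA divfK ?gt_eqF //.
by rewrite [c]splitr; exact: lerD.
Qed.

Lemma radial_limit_gap (e : R) N0 k0 (s l : C) : 0 < e ->
  (forall k k' y, (N0 <= k)%N -> (N0 <= k')%N -> K y -> nrm (S k y - S k' y) <= e) ->
  (N0 <= k0)%N -> nrm (S k0 x - s) <= e ->
  (forall t : R, 0 < t -> exists2 d : R, 0 < d & forall r, 0 <= r < 1 -> 1 - r < d ->
     nrm (f (cofr r * x) - l) <= t) ->
  nrm (s - l) <= 4 * e.
Proof.
move=> e0 hC Nk0 k0s hl; apply/ler_addgt0Pr => t t0.
have t2 : 0 < t / 2 by rewrite divr_gt0.
have [d d0 dP] := hl _ t2.
(* From exp (A / 4) >= A / 4 one gets 2 M exp (- A / 4) <= 8 M / A <= t / 2; the successor makes A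
   positive. *)
pose A := (Num.Def.archi_bound (16 * M / t)).+1.
have A0 : (0 < A)%N by [].
have AP : 16 * M / t <= A%:R.
  have := @archi_boundP R (16 * M / t); rewrite divr_ge0 ?mulr_ge0 ?(ltW M0) ?(ltW t0) //.
  by move=> /(_ isT) /ltW /le_trans; apply; rewrite ler_nat.
have [k1 k1P] := radial_error A0.
have [k2 k2P] := @radius_near A d d0.
have [k hk hS] := radial_partial_sum e0 A0 hC Nk0 k0s (maxn k1 k2).
move: hk; rewrite geq_max => /andP[hk1 hk2].
have [rd _] := k2P k hk2.
have h1 := k1P k hk1; have h2 := dP _ (radius_itv k A0) rd.
have h3 : 2 * M * expR (- (A%:R / 4)) <= t / 2.
  rewrite expRN ler_pdivrMr ?expR_gt0 //.
  apply: (@le_trans _ _ (t / 2 * (A%:R / 4))).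
    by move: AP; rewrite ler_pdivrMr // => AP; lra.
  apply: ler_wpM2l; first exact: ltW.
  by apply: le_trans (expR_ge1Dx _); rewrite lerDr.
move: h1 h2 hS; set z := cofr _ * x => h1 h2 hS.
have -> : 4 * e + t = 4 * e + (t / 2 + t / 2) by field.
apply: le_trans (nrm_triangle _ (S k z) _) _; rewrite nrmB; apply: (lerD hS).
by apply: le_trans (nrm_triangle _ (f z) _) _; apply: (lerD (le_trans h1 h3)).
Qed.

End boundary_point.

Lemma env_cvg0 N y : nrm y = 1 -> (fun j => env (N + j)%N y) @ \oo --> (0 : R).
Proof.
move=> y1; apply/cvgrPdist_le => t t0; have [N1 N1P] := env_small t0.
exists N1 => // j /= hj; rewrite sub0r normrN ger0_norm ?env_ge0 //.
by apply: N1P => //; apply: leq_trans hj (leq_addl _ _).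
Qed.

Lemma trunc_dist_cvg0 y : (fun j => trunc_dist K (1 / j.+2%:R) y) @ \oo --> (0 : R).
Proof.
apply/cvgrPdist_le => t t0; exists (Num.Def.archi_bound t^-1) => // j /= hj.
have j0 : 0 < j.+2%:R :> R by rewrite ltr0n.
have e0 : 0 <= 1 / j.+2%:R :> R by rewrite divr_ge0.
rewrite sub0r normrN ger0_norm ?trunc_dist_ge0 // ge_min; apply/orP; right.
rewrite ler_pdivrMr // -ler_pdivrMl // mulr1.
have := @archi_boundP R t^-1; rewrite invr_ge0 (ltW t0) => /(_ isT) /ltW /le_trans; apply.
by rewrite ler_nat (leq_trans hj) // ltnW // ltnW.
Qed.

Lemma sing_cvg0 (b : nat -> C -> R) x y : b ^~ y @ \oo --> (0 : R) ->
  (fun j => sing (b j) x y) @ \oo --> (0 : R).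
Proof. by move=> h; rewrite -(mul0r ((nrm (y - x) ^+ 2)^-1)); apply: cvgM => //; exact: cvg_cst. Qed.

(** The exceptional set is fixed before e, s and l. At the remaining points the singular integrals
    of [env N1] and of the distance truncated at 1 / 2 are finite, and they dominate those of all
    later envelopes and smaller truncations, which therefore tend to 0. *)
Lemma limit_gap_ae : \forall x \ae sigma, K x -> forall (e : R) N0 k0 (s l : C), 0 < e ->
  (forall k k' y, (N0 <= k)%N -> (N0 <= k')%N -> K y -> nrm (S k y - S k' y) <= e) ->
  (N0 <= k0)%N -> nrm (S k0 x - s) <= e ->
  (forall t : R, 0 < t -> exists2 d : R, 0 < d & forall r, 0 <= r < 1 -> 1 - r < d ->
     nrm (f (cofr r * x) - l) <= t) ->
  nrm (s - l) <= 4 * e.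
Proof.
have [N1 N1P] := env_superharmonic.
have ae1 := superharmonic_singular_ae cK KT (bm_env N1) (fun y _ => env_ge0 N1 y)
  (env_K N1) (fun r y => @N1P N1 r y (leqnn _)).
have ae2 := trunc_dist_singular_ae cK KT K0.
have ae3 : \forall x \ae sigma, forall A, K x -> forall (e : R) k0, 0 < e ->
    exists2 k, (k0 <= k)%N & poisson (\1_(~` K)) (cofr (radius A.+1 k) * x) < e.
  apply: ae_foralln => A; apply: thin_complement_ae => // [k|e e0]; first exact: radius_itv.
  have [k0 k0P] := @radius_near A.+1 e e0; exists k0 => k hk.
  by have [] := k0P k hk.
apply: (@filterS3 _ _ (ae_filter_ringOfSetsType sigma) _ _ _ _ _ ae1 ae2 ae3) => x s1 s2 s3 Kx e N0 k0 s l.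
apply: radial_limit_gap => //.
- move=> t t0.
  have [||||j0 j0P] := @dominated_small R (fun j => sing (env (N1 + j)) x) (sing (env N1) x) _ _ _ (s1 Kx) _ t t0.
  + by move=> j; apply: measurable_sing; have [] := bm_env (N1 + j).
  + by apply: measurable_sing; have [] := bm_env N1.
  + move=> j y _; rewrite mulr_ge0 ?env_ge0 ?invr_ge0 ?exprn_ge0 //=.
    by apply: ler_wpM2r; [rewrite invr_ge0 exprn_ge0|apply: env_mono; exact: leq_addr].
  + by move=> y y1; apply: sing_cvg0; exact: env_cvg0.
  exists (N1 + j0)%N => N hN; have := j0P (N - N1)%N.
  rewrite subnKC; last exact: leq_trans (leq_addr _ _) hN.
  by apply; rewrite leq_subRL // (leq_trans (leq_addr _ _) hN).
- move=> t t0.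
  have e0 j : 0 <= 1 / j.+2%:R :> R by rewrite divr_ge0.
  have [||||j0 j0P] := @dominated_small R (fun j => sing (trunc_dist K (1 / j.+2%:R)) x)
    (sing (trunc_dist K (1 / 2)) x) _ _ _ (s2 Kx) _ t t0.
  + by move=> j; apply: measurable_sing; have [] := bm_trunc_dist K0 (1 / j.+2%:R).
  + by apply: measurable_sing; have [] := bm_trunc_dist K0 (1 / 2).
  + move=> j y _; rewrite mulr_ge0 ?trunc_dist_ge0 ?invr_ge0 ?exprn_ge0 //=.
    apply: ler_wpM2r; first by rewrite invr_ge0 exprn_ge0.
    rewrite /trunc_dist le_min !ge_min lexx /=; apply/orP; right.
    by rewrite !div1r lef_pV2 ?posrE ?ltr0n // ler_nat.
  + by move=> y y1; apply: sing_cvg0; exact: trunc_dist_cvg0.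
  exists (1 / j0.+2%:R); last exact: j0P.
  by rewrite divr_gt0 ?ltr0n //= !div1r lef_pV2 ?posrE ?ltr0n // ler_nat.
- by case=> // A _; exact: s3.
Qed.

End core.

(** * Countable exhaustion by closed sets, and conclusion *)

Section exhaustion.
Variable R : realType.
Local Notation C := (CC R).

Lemma cvg_nrm (u : nat -> C) l : u @ \oo --> l <->
  forall e : R, 0 < e -> exists k0, forall k, (k0 <= k)%N -> nrm (u k - l) <= e.
Proof.
split=> [/cvgrPdist_le ul e e0|h].
  have := ul (cofr e); rewrite (cofr_lt 0) => /(_ e0)[k0 _ k0P]; exists k0 => k /k0P.
  by rewrite /= normE cofr_le nrmB.
apply/cvgrPdist_le => _ /cpos[e e0 ->]; have [k0 k0P] := h e e0; exists k0 => // k /k0P.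
by rewrite normE cofr_le nrmB.
Qed.

Lemma ntlim_nrm f (x l : C) (alpha e : R) : is_ntlim f x l -> 1 < alpha -> 0 < e ->
  exists2 d : R, 0 < d & forall z, stolz alpha x z -> nrm (z - x) < d -> nrm (f z - l) <= e.
Proof.
move=> fl a1 e0; have /cvgrPdist_le/(_ (cofr e)) := fl alpha a1.
rewrite (cofr_lt 0) => /(_ e0) /nbhs_nrm[d d0 dP]; exists d => // z sz zx.
by have := dP z zx sz; rewrite normE cofr_le nrmB.
Qed.

Lemma ntlim_radial f (x l : C) : nrm x = 1 -> is_ntlim f x l -> forall t : R, 0 < t ->
  exists2 d : R, 0 < d & forall r, 0 <= r < 1 -> 1 - r < d -> nrm (f (cofr r * x) - l) <= t.
Proof.
move=> x1 fl t t0; have two1 : 1 < (2 : R) by lra.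
have [d d0 dP] := ntlim_nrm fl two1 t0; exists d => // r r01 rd; have /andP[r0 r1] := r01.
have rx : nrm (cofr r * x - x) = 1 - r by rewrite nrmB nrm_radial_sub // ltW.
apply: dP; last by rewrite rx.
apply/stolzE; rewrite rx nrmM nrm_cofr x1 mulr1 ger0_norm //; split=> //; lra.
Qed.

(** Within d of x the limit bounds f; the rest of the approach region lies in the compact disc |z|
    <= 1 - d / alpha. *)
Lemma ntlim_bounded f (x l : C) (alpha : R) : holomorphic_on (unit_disc R) f ->
  is_ntlim f x l -> 1 < alpha -> exists B : R, forall z, stolz alpha x z -> nrm (f z) <= B.
Proof.
move=> hf fl a1; have a0 : 0 < alpha by lra.
have [d d0 dP] := ntlim_nrm fl a1 ltr01.
have q0 : 0 < d / alpha by rewrite divr_gt0.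
have [|_ _ cf] := @cder_ex_cont R [set z | nrm z <= 1 - d / alpha] f.
  by move=> z /= z1; apply: derivable_cder; apply/hf/discE; lra.
have [B B0 BP] := cont_on_bounded (@compact_disc R _) cf.
exists (B + (nrm l + 1)) => z sz; have [zx|zx] := ltP (nrm (z - x)) d.
  by have := nrm_sub_le (f z) l; have := dP z sz zx; lra.
have /stolzE[_ zx'] := sz.
apply: le_trans (ler_norm _) (le_trans (BP z _) _); last by rewrite lerDl; have := nrm_ge0 l; lra.
have : d / alpha < 1 - nrm z by rewrite ltr_pdivrMr // mulrC; exact: le_lt_trans zx'.
by rewrite /=; lra.
Qed.

Lemma eventually_bounded (u : nat -> R) k0 (c : R) : (forall k, (k0 <= k)%N -> u k <= c) ->
  exists B, forall k, u k <= B.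
Proof.
elim: k0 c => [|k0 ih] c h; first by exists c => k; exact: h.
apply: (ih (Num.max c (u k0))) => k; rewrite leq_eqVlt => /predU1P[<-|/h uc].
  by rewrite le_max lexx orbT.
by rewrite le_max uc.
Qed.

Lemma closed_forall (J : Type) (A : J -> set C) : (forall i, closed (A i)) ->
  closed [set x | forall i, A i x].
Proof.
move=> cA; have -> : [set x | forall i, A i x] = \bigcap_i A i.
  by apply/seteqP; split=> x h i; [move=> _; exact: h|exact: (h i I)].
by apply: closed_bigI => i _; exact: cA.
Qed.

Lemma closed_nrm_le (g : C -> C) (c : R) : (forall x, exists a, cder g x a) ->
  closed [set x | nrm (g x) <= c].
Proof.
move=> dg; apply: closed_nrm => x /negP; rewrite -ltNge => cx.
have [a da] := dg x; have [|d d0 dP] := cder_cont da (e := nrm (g x) - c).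
  by rewrite subr_gt0.
exists d => // w /dP h; apply/negP; rewrite -ltNge.
by have := nrm_sub_le (g x) (g w); rewrite nrmB; lra.
Qed.

(** For fixed z, the points x whose approach region contains z form an open set. *)
Lemma closed_stolz (alpha : R) (z : C) (P : Prop) : closed [set x : C | stolz alpha x z -> P].
Proof.
apply: closed_nrm => x /= /not_implyP[/stolzE[z1 zx] nP].
exists (alpha * (1 - nrm z) - nrm (z - x)); first by rewrite subr_gt0.
move=> w wx h; apply: nP; apply: h; apply/stolzE; split=> //.
by have := nrm_triangle z x w; rewrite [nrm (x - w)]nrmB; lra.
Qed.

(** Each condition is closed in x and the three parameters are natural numbers; by
    [tame_exhaustion], for every j these sets cover the points where both limits exist. The bound on
    the partial sums concerns all k, the finitely many early ones being absorbed in m. *)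
Definition tame (f : C -> C) (n : nat -> nat) m j N0 : set C :=
  [set x | [/\ unit_circle R x,
     forall k, nrm (taylor_sum f (n k) x) <= m.+1%:R,
     forall k k',
       nrm (taylor_sum f (n (N0 + k)%N) x - taylor_sum f (n (N0 + k')%N) x) <= j.+1%:R^-1 &
     forall z, stolz 6 x z -> nrm (f z) <= m.+1%:R]].

Lemma closed_tame f n m j N0 : closed (tame f n m j N0).
Proof.
have -> : tame f n m j N0 = unit_circle R `&`
   ([set x | forall k, nrm (taylor_sum f (n k) x) <= m.+1%:R] `&`
   ([set x | forall k k',
       nrm (taylor_sum f (n (N0 + k)%N) x - taylor_sum f (n (N0 + k')%N) x) <= j.+1%:R^-1] `&`
    [set x | forall z, stolz 6 x z -> nrm (f z) <= m.+1%:R])).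
  by apply/seteqP; split=> x; [case|case=> ? [? []]].
apply: closedI; first exact: closed_circle.
apply: closedI; first by apply: closed_forall => k; apply: closed_nrm_le; exact: cder_taylor_sum.
apply: closedI; last by apply: closed_forall => z; exact: closed_stolz.
apply: closed_forall => k; apply: closed_forall => k'; apply: closed_nrm_le => x.
have [a da] := cder_taylor_sum f (n (N0 + k)%N) x.
have [b db] := cder_taylor_sum f (n (N0 + k')%N) x.
by eexists; exact: cderB da db.
Qed.

Lemma tame_exhaustion f n (x s l : C) j : holomorphic_on (unit_disc R) f -> nrm x = 1 ->
  taylor_sum f (n k) x @[k --> \oo] --> s -> is_ntlim f x l ->
  exists m N0, tame f n m j N0 x.
Proof.
move=> hf x1 /cvg_nrm hs fl.
have six1 : 1 < (6 : R) by lra.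
have [B1 B1P] := ntlim_bounded hf fl six1.
have e0 : 0 < (j.+1%:R^-1 / 2 : R) by rewrite divr_gt0 // invr_gt0 ltr0n.
have [N0 N0P] := hs _ e0.
have [B2 B2P] : exists B, forall k, nrm (taylor_sum f (n k) x) <= B.
  apply: (@eventually_bounded (fun k => nrm (taylor_sum f (n k) x)) N0 (nrm s + j.+1%:R^-1 / 2)).
  by move=> k hk; rewrite -lerBlDl; exact: le_trans (nrm_sub_le _ _) (N0P k hk).
pose m := Num.Def.archi_bound (`|B1| + `|B2|).
have mP : `|B1| + `|B2| <= m.+1%:R.
  have := @archi_boundP R (`|B1| + `|B2|); rewrite addr_ge0 // => /(_ isT) /ltW /le_trans; apply.
  by rewrite ler_nat.
have n1 := normr_ge0 B1; have n2 := normr_ge0 B2.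
exists m, N0; split.
- exact/circleE.
- by move=> k; apply: le_trans (B2P k) _; have := ler_norm B2; lra.
- move=> k k'; rewrite [leRHS]splitr; apply: le_trans (nrm_triangle _ s _) _.
  by apply: lerD; [|rewrite nrmB]; apply: N0P; exact: leq_addr.
- by move=> z sz; apply: le_trans (B1P z sz) _; have := ler_norm B1; lra.
Qed.

Lemma tame_limit_gap f n m j N0 : holomorphic_on (unit_disc R) f ->
  {homo n : j k / (j < k)%N} ->
  \forall x \ae @arc_length R, tame f n m j N0 x -> forall s l : C,
    taylor_sum f (n k) x @[k --> \oo] --> s -> is_ntlim f x l -> nrm (s - l) <= 4 / j.+1%:R.
Proof.
move=> hf hn; have [K0|K0] := pselect (tame f n m j N0 !=set0); last first.
  by apply: aeW => x Kx; case: K0; exists x.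
have j0 : 0 < (j.+1%:R^-1 : R) by rewrite invr_gt0 ltr0n.
have m0 : 0 < (m.+1%:R : R) by rewrite ltr0n.
have KT : tame f n m j N0 `<=` unit_circle R by move=> x [].
have SK k x : tame f n m j N0 x -> nrm (taylor_sum f (n k) x) <= m.+1%:R by case.
have fK x z : tame f n m j N0 x -> stolz 6 x z -> nrm (f z) <= m.+1%:R by case=> _ _ _; exact.
have := limit_gap_ae hf hn (@closed_tame f n m j N0) KT K0 m0 SK fK.
apply: (@filterS _ _ (ae_filter_ringOfSetsType (@arc_length R))) => x h Kx s l /cvg_nrm hs fl.
have [k0 k0P] := hs _ j0; have x1 : nrm x = 1 by apply/circleE/KT.
apply: (h Kx _ N0 (maxn N0 k0)) => //.
- by move=> k k' y hk hk' [_ _ hy _]; rewrite -(subnKC hk) -(subnKC hk').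
- exact: leq_maxl.
- by apply: k0P; exact: leq_maxr.
- exact: ntlim_radial.
Qed.

End exhaustion.

Theorem theorem1 (R : realType) (f : CC R -> CC R) (n : nat -> nat) :
  holomorphic_on (unit_disc R) f ->
  {homo n : j k / (j < k)%N} ->
  let E := [set zeta : CC R | unit_circle R zeta /\
              cvg (taylor_sum f (n k) zeta @[k --> \oo])] in
  let F := [set zeta : CC R | unit_circle R zeta /\
              exists l, is_ntlim f zeta l] in
  \forall zeta \ae @arc_length R, (E `&` F) zeta ->
    lim (taylor_sum f (n k) zeta @[k --> \oo]) = ntlim f zeta.
Proof.
move=> hf hn E F.
(* The parameters being countable, one null set serves them all, and j can be chosen after the
   point. *)
have gap := ae_foralln (fun m => ae_foralln (fun j => ae_foralln (fun N0 =>
  @tame_limit_gap R f n m j N0 hf hn))).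
apply: (@filterS _ _ (ae_filter_ringOfSetsType (@arc_length R)) _ _ _ gap) => x h [[/circleE x1 cS] [_ xF]].
have fl : is_ntlim f x (ntlim f x) := getPex xF.
apply/eqP; rewrite -subr_eq0 -nrm_eq0 eq_le nrm_ge0 andbT.
apply/ler_addgt0Pr => t t0; rewrite add0r.
pose j := Num.Def.archi_bound (4 / t).
have [m [N0 Kx]] := tame_exhaustion j hf x1 cS fl.
apply: le_trans (h m j N0 Kx _ _ cS fl) _.
rewrite ler_pdivrMr ?ltr0n // mulrC -ler_pdivrMr //.
have := @archi_boundP R (4 / t); rewrite divr_ge0 ?(ltW t0) // => /(_ isT) /ltW /le_trans; apply.
by rewrite ler_nat.
Qed.
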